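(* Let $\mathfrak g$ be a simple complex Lie algebra, let $\omega$ be any orientation of its Dynkin diagram, and let $B=P_\omega\otimes P_\omega^{op}$. (i) For any $Y\in U_\hbar(\mathfrak g)$ which is a noncommutative polynomial of elements $e^{\hbar x}$ ($x\in\mathfrak h$), $e_i$, and $f_i$, there exists a unique difference operator $D_Y$ on $H$ with coefficients in $B$ such that $(L(Y)\phi)|_{\mathfrak h}=D_Y\,\phi|_{\mathfrak h}$ for any Whittaker function $\phi$. (ii) If $Y$ and $Y'$ are central then $D_{YY'}=D_YD_{Y'}$.
   Context: $\mathfrak g$ has rank $r$, Cartan subalgebra $\mathfrak h$ and Cartan matrix $(a_{ij})$; $d_i\in\{1,2,3\}$ are the relatively prime integers such that $b_{ij}=d_ia_{ij}$ is symmetric. $\hbar$ is a formal parameter. $U_\hbar(\mathfrak g)$ is the Drinfeld–Jimbo quantum universal enveloping algebra with formal parameter $\hbar$, with generators $e_i,f_i,h_i$ ($i=1,\dots,r$) and the standard relations. $U_\hbar(\mathfrak n_+)$, $U_\hbar(\mathfrak n_-)$, $U_\hbar(\mathfrak h)$ are the subalgebras generated by the $e_i$, the $f_i$, and the Cartan generators $h_i$, respectively. $P_\omega$ is the quantum polynomial algebra generated by variables $x_1,\dots,x_r$ corresponding to the vertices of the Dynkin diagram, with relations $x_ix_j=e^{\pm\hbar b_{ij}}x_jx_i$, where the sign is $+$ if the edge $ij$ is oriented from $i$ to $j$ and $-$ otherwise. $\chi_+:U_\hbar(\mathfrak n_+)\to P_\omega$ and $\chi_-:U_\hbar(\mathfrak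 n_-)\to P_\omega$ are the homomorphisms with $\chi_+(e_i)=x_i$, $\chi_-(f_i)=x_i$. $A_{U_\hbar(\mathfrak g)}=U_\hbar(\mathfrak g)^*$ is the space of linear functions on $U_\hbar(\mathfrak g)$, with the two-sided action $((a,b)\circ\phi)(x)=\phi(axb)$; the maps $L,R:U_\hbar(\mathfrak g)\to\mathrm{End}(A_{U_\hbar(\mathfrak g)})$ are defined by $(a,b)\circ\phi=R(a)L(b)\phi$. Put $A_\omega=P_\omega\otimes A_{U_\hbar(\mathfrak g)}$, on which these actions are extended through the second factor and $P_\omega$ multiplies the first factor from the left and from the right. A Whittaker function on $U_\hbar(\mathfrak g)$ is an element $\phi\in A_\omega$ such that for any $a_\pm\in U_\hbar(\mathfrak n_\pm)$ one has $(a_-,a_+)\circ\phi=\chi_+(a_+)\,\phi\,\chi_-(a_-)$. The restriction $\phi\mapsto\phi|_{\mathfrak h}$, dual to the embedding $U_\hbar(\mathfrak h)\to U_\hbar(\mathfrak g)$, identifies the space of Whittaker functions with $P_\omega\otimes U_\hbar(\mathfrak h)^*$. $H$ is the formal maximal torus, i.e. the formal group associated to $\mathfrak h$, and $A_{\mathfrak h}=U(\mathfrak h)^*$ is its algebra of functions. A difference operator on $H$ is an operator on $A_{\mathfrak h}[[\hbar]]$ of the form of a finite sum $\sum f_iT_{\beta_i}$, where $f_i\in A_{\mathfrak h}[[\hbar]]$, $\beta_i\in\mathfrak h$, and $(T_\beta f)(x)=f(xe^{\hbar\beta})$. Difference operators form an algebra $D_q(H)$. A difference operator with coefficients in $B$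 (a $B$-valued difference operator) is an element of the algebraic, i.e. uncompleted, tensor product $D_q(H)\otimes B$; here $a\otimes b\in P_\omega\otimes P_\omega^{op}$ acts on $P_\omega$ by $p\mapsto apb$.
   Formalization: χ_± are antihomomorphisms (as homomorphisms they force φ=0 if the diagram has an edge); the f_i may carry powers of ħ in the denominator (needed for Y=e_i f_i); uniqueness and (ii) concern operators, not elements of D_q(H)⊗B, since B may act unfaithfully. *)

(* Defs.v *)
From HB Require Import structures.
From mathcomp Require Import all_boot all_order all_algebra.
From mathcomp Require Import boolp reals.
From mathcomp Require Import complex.
From mathcomp Require Import monalg mpoly.

Set Implicit Arguments.
Unset Strict Implicit.
Unset Printing Implicit Defensive.

Import Order.TTheory GRing.Theory Num.Theory.
Local Open Scope ring_scope.

(* V[[hbar]] : the sequence s stands for the formal series sum_n s_n hbar^n.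
   For V = C this is the ring C[[hbar]], over which V[[hbar]] is a module. *)
Definition hser (V : Type) : Type := nat -> V.

HB.instance Definition _ (V : Type) := gen_eqMixin (hser V).
HB.instance Definition _ (V : Type) := gen_choiceMixin (hser V).

Section HserZmod.
Variable V : zmodType.
Implicit Types s t : hser V.

Definition hser_zero : hser V := fun=> 0.
Definition hser_opp s : hser V := fun n => - s n.
Definition hser_add s t : hser V := fun n => s n + t n.

Fact hser_addA : associative hser_add.
Proof. by move=> s t u; apply: funext => n; apply: addrA. Qed.
Fact hser_addC : commutative hser_add.
Proof. by move=> s t; apply: funext => n; apply: addrC. Qed.
Fact hser_add0 : left_id hser_zero hser_add.
Proof. by move=> s; apply: funext => n; apply: add0r. Qed.
Fact hser_addN : left_inverse hser_zero hser_opp hser_add.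
Proof. by move=> s; apply: funext => n; apply: addNr. Qed.

HB.instance Definition _ := GRing.isZmodule.Build (hser V)
  hser_addA hser_addC hser_add0 hser_addN.

Lemma hserDE s t n : (s + t) n = s n + t n. Proof. by []. Qed.
Lemma hserNE s n : (- s) n = - s n. Proof. by []. Qed.
Lemma hser0E n : (0 : hser V) n = 0. Proof. by []. Qed.
End HserZmod.

Fact hser_triangle (V : zmodType) (F : nat -> nat -> nat -> V) n :
  \sum_(i < n.+1) \sum_(j < (n - i).+1) F i j (n - i - j)%N =
  \sum_(k < n.+1) \sum_(i < k.+1) F i (k - i)%N (n - k)%N.
Proof.
transitivity (\sum_(i < n.+1) \sum_(k < n.+1 | (i <= k)%N)
                F i (k - i)%N (n - k)%N); last first.
  rewrite (exchange_big_dep xpredT) //=; apply: eq_bigr => k _.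
  by rewrite (big_ord_narrow_leq (leq_ord k)).
apply: eq_bigr => i _; have le_in : (i <= n)%N by rewrite -ltnS.
rewrite -(big_mkord xpredT (fun j => F i j (n - i - j)%N)).
rewrite -(big_mkord (fun k => i <= k)%N (fun k => F i (k - i) (n - k)))%N.
rewrite [RHS](@big_cat_nat _ _ _ i) //=; last exact: leqW.
rewrite [X in _ = X + _](_ : _ = 0) ?add0r; last first.
  rewrite big_nat_cond big1 // => k /andP[/andP[_ lt_ki] le_ik].
  by rewrite leqNgt lt_ki in le_ik.
have := @big_addn _ 0 +%R 0 n.+1 i (fun k => i <= k)%N
  (fun k => F i (k - i) (n - k))%N.
rewrite add0n subSn // => ->; apply: eq_big => [j|j _]; first by rewrite leq_addl.
by rewrite addnK addnC subnDA.
Qed.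

Section HserRing.
Variable A : nzRingType.
Implicit Types s t : hser A.

Definition hser_one : hser A := fun n => (n == 0%N)%:R.
Definition hser_mul s t : hser A :=
  fun n => \sum_(i < n.+1) s i * t (n - i)%N.

Fact hser_mulA : associative hser_mul.
Proof.
move=> s t u; apply: funext => n; rewrite /hser_mul.
under eq_bigr => i _ do rewrite mulr_sumr.
rewrite (hser_triangle (fun i j k => s i * (t j * u k))).
apply: eq_bigr => k _; rewrite mulr_suml; apply: eq_bigr => i _.
by rewrite mulrA.
Qed.
Fact hser_mul1 : left_id hser_one hser_mul.
Proof.
move=> s; apply: funext => n; rewrite /hser_mul big_ord_recl /= mul1r subn0.
by rewrite big1 ?addr0 // => i _; rewrite mul0r.
Qed.
Fact hser_mulr1 : right_id hser_one hser_mul.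
Proof.
move=> s; apply: funext => n; rewrite /hser_mul big_ord_recr /=.
rewrite /hser_one subnn mulr1 big1 ?add0r // => i _.
by rewrite subn_eq0 leqNgt ltn_ord mulr0.
Qed.
Fact hser_mulDl : left_distributive hser_mul +%R.
Proof.
move=> s t u; apply: funext => n; rewrite hserDE -big_split /=.
by apply: eq_bigr => i _; rewrite hserDE mulrDl.
Qed.
Fact hser_mulDr : right_distributive hser_mul +%R.
Proof.
move=> s t u; apply: funext => n; rewrite hserDE -big_split /=.
by apply: eq_bigr => i _; rewrite hserDE mulrDr.
Qed.
Fact hser_one_neq0 : hser_one != 0.
Proof. by apply/eqP => /(congr1 (@^~ 0%N))/eqP; rewrite oner_eq0. Qed.

HB.instance Definition _ := GRing.Zmodule_isNzRing.Build (hser A)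
  hser_mulA hser_mul1 hser_mulr1 hser_mulDl hser_mulDr hser_one_neq0.

Lemma hserME s t n : (s * t) n = \sum_(i < n.+1) s i * t (n - i)%N.
Proof. by []. Qed.
End HserRing.

Section HserComRing.
Variable A : comNzRingType.

Fact hser_mulC : commutative (@hser_mul A).
Proof.
move=> s t; apply: funext => n; rewrite /hser_mul (reindex_inj rev_ord_inj) /=.
apply: eq_bigr => i _; rewrite mulrC subSS subKn //.
by rewrite -ltnS.
Qed.

HB.instance Definition _ := GRing.PzRing_hasCommutativeMul.Build (hser A)
  hser_mulC.
End HserComRing.

Section HserLmod.
Variables (C : comNzRingType) (V : lmodType C).
Implicit Types (c : hser C) (s : hser V).

Definition hser_scale c s : hser V :=
  fun n => \sum_(i < n.+1) c i *: s (n - i)%N.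

Fact hser_scaleA c1 c2 s :
  hser_scale c1 (hser_scale c2 s) = hser_scale (c1 * c2) s.
Proof.
apply: funext => n; rewrite /hser_scale.
under eq_bigr => i _ do rewrite scaler_sumr.
rewrite (hser_triangle (fun i j k => c1 i *: (c2 j *: s k))).
apply: eq_bigr => k _; rewrite hserME scaler_suml; apply: eq_bigr => i _.
by rewrite scalerA.
Qed.
Fact hser_scale1 : left_id 1 hser_scale.
Proof.
move=> s; apply: funext => n; rewrite /hser_scale big_ord_recl /= scale1r subn0.
by rewrite big1 ?addr0 // => i _; rewrite scale0r.
Qed.
Fact hser_scaleDr : right_distributive hser_scale +%R.
Proof.
move=> c s t; apply: funext => n; rewrite hserDE -big_split /=.
by apply: eq_bigr => i _; rewrite hserDE scalerDr.
Qed.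
Fact hser_scaleDl s : {morph hser_scale^~ s : c1 c2 / c1 + c2}.
Proof.
move=> c1 c2; apply: funext => n; rewrite hserDE -big_split /=.
by apply: eq_bigr => i _; rewrite hserDE scalerDl.
Qed.

HB.instance Definition _ := GRing.Zmodule_isLmodule.Build (hser C) (hser V)
  hser_scaleA hser_scale1 hser_scaleDr hser_scaleDl.

Lemma hserZE c s n : (c *: s) n = \sum_(i < n.+1) c i *: s (n - i)%N.
Proof. by []. Qed.
End HserLmod.

Section HserLalg.
Variables (C : comNzRingType) (A : lalgType C).

Fact hser_scaleAl (c : hser C) (s t : hser A) : c *: (s * t) = (c *: s) * t.
Proof.
apply: funext => n; rewrite hserZE hserME.
under eq_bigr => i _ do rewrite hserME scaler_sumr.
rewrite (hser_triangle (fun i j k => c i *: (s j * t k))).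
apply: eq_bigr => k _; rewrite hserZE mulr_suml; apply: eq_bigr => i _.
by rewrite scalerAl.
Qed.

HB.instance Definition _ :=
  GRing.Lmodule_isLalgebra.Build (hser C) (hser A) hser_scaleAl.
End HserLalg.

Section HserAlg.
Variables (C : comNzRingType) (A : algType C).

Fact hser_scaleAr (c : hser C) (s t : hser A) : c *: (s * t) = s * (c *: t).
Proof.
apply: funext => n; rewrite hserZE hserME.
under eq_bigr => i _.
  rewrite hserME scaler_sumr.
  under eq_bigr => j _ do rewrite scalerAr.
  over.
rewrite (hser_triangle (fun i j k => s j * (c i *: t k))).
under [RHS]eq_bigr => i _ do rewrite hserZE mulr_sumr.
rewrite (hser_triangle (fun i j k => s i * (c j *: t k))).
apply: eq_bigr => k _; rewrite (reindex_inj rev_ord_inj) /=.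
by apply: eq_bigr => i _; rewrite subSS subKn // -ltnS.
Qed.

HB.instance Definition _ :=
  GRing.Lalgebra_isAlgebra.Build (hser C) (hser A) hser_scaleAr.
End HserAlg.

Definition hconst (V : zmodType) (v : V) : hser V :=
  fun n => if n is 0%N then v else 0.

Definition hbar (C : nzRingType) : hser C := fun n => (n == 1%N)%:R.

(* s / hbar, when s has no constant term *)
Definition hquo (V : Type) (s : hser V) : hser V := fun n => s n.+1.

(* e^(hbar a) *)
Definition hexp (C : fieldType) (A : lalgType C) (a : A) : hser A :=
  fun n => (n`!%:R^-1 : C) *: a ^+ n.

(* the closure in the hbar-adic topology *)
Definition hclosure (C : nzRingType) (V : lmodType (hser C)) (S : V -> Prop)
    (x : V) : Prop :=
  forall n, exists y z, S y /\ x = y + hbar C ^+ n *: z.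

(* Topological presentations over C[[hbar]]: the hbar-adically completed free
   algebra C<G>[[hbar]] modulo the closed two-sided ideal generated by the
   elements r such that rel r. *)
Section Presented.
Variables (C : fieldType) (G : choiceType).

Definition free_alg := {malg C[{fmonom G}]}.
HB.instance Definition _ := GRing.Lalgebra.on free_alg.

Fact free_scaleAr (c : C) (x y : free_alg) : c *: (x * y) = x * (c *: y).
Proof.
apply/malgP => k; rewrite monalg.mcoeffZ mcoeffMl mulr_sumr.
rewrite (@mcoeffMlw _ _ (monalg.msupp x) (monalg.msupp y) x (c *: y)) ?monalg.msuppZ_le //.
apply: eq_bigr => k1 _; rewrite mulr_sumr; apply: eq_bigr => k2 _.
by rewrite monalg.mcoeffZ mulrnAr mulrCA.
Qed.
HB.instance Definition _ :=
  GRing.Lalgebra_isAlgebra.Build C free_alg free_scaleAr.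

Definition hfree := hser free_alg.
HB.instance Definition _ := GRing.Algebra.on hfree.

Definition free_gen (g : G) : free_alg := << fmu g >>.
Definition hfree_gen (g : G) : hfree := hconst (free_gen g).

Variable rel : hfree -> Prop.

Inductive ideal_gen : hfree -> Prop :=
| IdealRel x of rel x : ideal_gen x
| Ideal0 : ideal_gen 0
| IdealD x y of ideal_gen x & ideal_gen y : ideal_gen (x + y)
| IdealMl a x of ideal_gen x : ideal_gen (a * x)
| IdealMr a x of ideal_gen x : ideal_gen (x * a).

Definition closed_ideal : {pred hfree} :=
  fun x => `[< @hclosure C hfree ideal_gen x >].

Fact closed_ideal_zmod : zmod_closed closed_ideal.
Proof.
split=> [|x y /asboolP Ix /asboolP Iy]; apply/asboolP.
  by move=> n; exists 0, 0; split; [exact: Ideal0 | rewrite scaler0 addr0].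
move=> n; have [x1 [x2 [Ix1 ->]]] := Ix n; have [y1 [y2 [Iy1 ->]]] := Iy n.
exists (x1 + (-1) * y1), (x2 - y2); split.
  by apply: IdealD => //; apply: IdealMl.
by rewrite mulN1r scalerBr opprD addrACA.
Qed.
HB.instance Definition _ :=
  GRing.isZmodClosed.Build hfree closed_ideal closed_ideal_zmod.

Lemma closed_idealMl a x : x \in closed_ideal -> a * x \in closed_ideal.
Proof.
move=> /asboolP Ix; apply/asboolP => n; have [y [z [Iy ->]]] := Ix n.
exists (a * y), (a * z); split; first exact: IdealMl.
by rewrite mulrDr scalerAr.
Qed.

Lemma closed_idealMr a x : x \in closed_ideal -> x * a \in closed_ideal.
Proof.
move=> /asboolP Ix; apply/asboolP => n; have [y [z [Iy ->]]] := Ix n.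
exists (y * a), (z * a); split; first exact: IdealMr.
by rewrite mulrDl scalerAl.
Qed.

Lemma closed_idealZ (c : hser C) x :
  x \in closed_ideal -> c *: x \in closed_ideal.
Proof. by move=> Ix; rewrite -[x]mul1r scalerAl closed_idealMl. Qed.

Local Open Scope quotient_scope.

Definition presented : Type := Quotient.quot closed_ideal.
HB.instance Definition _ := ZmodQuotient.on presented.

Definition presented_pi (x : hfree) : presented := \pi_presented x.

Lemma presented_piP x y :
  presented_pi x = presented_pi y <-> x - y \in closed_ideal.
Proof. by rewrite (Quotient.idealrBE closed_ideal); split=> /eqP. Qed.

Lemma presented_piK (u : presented) : presented_pi (repr u) = u.
Proof. exact: reprK. Qed.

Fact presented_pi_zmod : zmod_morphism presented_pi.
Proof. by move=> x y; rewrite /presented_pi !piE. Qed.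
HB.instance Definition _ :=
  GRing.isZmodMorphism.Build hfree presented presented_pi presented_pi_zmod.

Definition presented_one : presented := presented_pi 1.
Definition presented_mul (u v : presented) : presented :=
  presented_pi (repr u * repr v).
Definition presented_scale (c : hser C) (u : presented) : presented :=
  presented_pi (c *: repr u).

Fact presented_mulE x y :
  presented_mul (presented_pi x) (presented_pi y) = presented_pi (x * y).
Proof.
apply/presented_piP.
have [x' Ex] : exists x', x' = repr (presented_pi x) by eexists.
have [y' Ey] : exists y', y' = repr (presented_pi y) by eexists.
rewrite -Ex -Ey.
have Ix : x' - x \in closed_ideal.
  by apply/presented_piP; rewrite Ex presented_piK.
have Iy : y' - y \in closed_ideal.
  by apply/presented_piP; rewrite Ey presented_piK.
have -> : x' * y' - x * y = (x' - x) * y' + x * (y' - y).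
  by rewrite mulrBl mulrBr addrA addrNK.
apply: rpredD; [exact: closed_idealMr | exact: closed_idealMl].
Qed.

Fact presented_scaleE c x :
  presented_scale c (presented_pi x) = presented_pi (c *: x).
Proof.
apply/presented_piP; rewrite -scalerBr; apply: closed_idealZ.
by apply/presented_piP; rewrite presented_piK.
Qed.

Fact presented_mulA : associative presented_mul.
Proof.
move=> u v w; rewrite -[u]presented_piK -[v]presented_piK -[w]presented_piK.
by rewrite !presented_mulE mulrA.
Qed.
Fact presented_mul1 : left_id presented_one presented_mul.
Proof. by move=> u; rewrite -[u]presented_piK presented_mulE mul1r. Qed.
Fact presented_mulr1 : right_id presented_one presented_mul.
Proof. by move=> u; rewrite -[u]presented_piK presented_mulE mulr1. Qed.
Fact presented_mulDl : left_distributive presented_mul +%R.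
Proof.
move=> u v w; rewrite -[u]presented_piK -[v]presented_piK -[w]presented_piK.
by rewrite -raddfD !presented_mulE mulrDl raddfD.
Qed.
Fact presented_mulDr : right_distributive presented_mul +%R.
Proof.
move=> u v w; rewrite -[u]presented_piK -[v]presented_piK -[w]presented_piK.
by rewrite -raddfD !presented_mulE mulrDr raddfD.
Qed.
HB.instance Definition _ := GRing.Zmodule_isPzRing.Build presented
  presented_mulA presented_mul1 presented_mulr1 presented_mulDl presented_mulDr.

Fact presented_scaleA a b u :
  presented_scale a (presented_scale b u) = presented_scale (a * b) u.
Proof. by rewrite -[u]presented_piK !presented_scaleE scalerA. Qed.
Fact presented_scale1 : left_id 1 presented_scale.
Proof. by move=> u; rewrite -[u]presented_piK presented_scaleE scale1r. Qed.
Fact presented_scaleDr : right_distributive presented_scale +%R.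
Proof.
move=> a u v; rewrite -[u]presented_piK -[v]presented_piK.
by rewrite -raddfD !presented_scaleE scalerDr raddfD.
Qed.
Fact presented_scaleDl u : {morph presented_scale^~ u : a b / a + b}.
Proof.
by move=> a b; rewrite -[u]presented_piK !presented_scaleE scalerDl raddfD.
Qed.
HB.instance Definition _ := GRing.Zmodule_isLmodule.Build (hser C) presented
  presented_scaleA presented_scale1 presented_scaleDr presented_scaleDl.

Lemma presented_piM x y :
  presented_pi (x * y) = presented_pi x * presented_pi y.
Proof. by rewrite -presented_mulE. Qed.

Lemma presented_pi1 : presented_pi 1 = 1. Proof. by []. Qed.

Lemma presented_piZ (c : hser C) x :
  presented_pi (c *: x) = c *: presented_pi x.
Proof. by rewrite -presented_scaleE. Qed.

Lemma presented_scaleAl (c : hser C) (u v : presented) :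
  c *: (u * v) = (c *: u) * v.
Proof.
rewrite -[u]presented_piK -[v]presented_piK -presented_piM.
by rewrite -!presented_piZ -presented_piM scalerAl.
Qed.

Lemma presented_scaleAr (c : hser C) (u v : presented) :
  c *: (u * v) = u * (c *: v).
Proof.
rewrite -[u]presented_piK -[v]presented_piK -presented_piM.
by rewrite -!presented_piZ -presented_piM scalerAr.
Qed.

Definition presented_gen (g : G) : presented := presented_pi (hfree_gen g).
End Presented.

Section Subalgebra.
Variables (C : fieldType) (G : choiceType) (rel : hfree C G -> Prop).
Variable S : presented rel -> Prop.

Inductive subalg_gen : presented rel -> Prop :=
| SubalgGen u of S u : subalg_gen u
| Subalg1 : subalg_gen 1
| SubalgZ (c : hser C) u of subalg_gen u : subalg_gen (c *: u)
| SubalgD u v of subalg_gen u & subalg_gen v : subalg_gen (u + v)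
| SubalgM u v of subalg_gen u & subalg_gen v : subalg_gen (u * v).

Definition closed_subalg_gen : presented rel -> Prop :=
  @hclosure C (presented rel) subalg_gen.
End Subalgebra.

Section LieAlgebra.
Variables (F : fieldType) (L : vectType F) (br : L -> L -> L).

Definition lie_bracket : Prop :=
  [/\ forall a x y z, br (a *: x + y) z = a *: br x z + br y z,
      forall a x y z, br z (a *: x + y) = a *: br z x + br z y,
      forall x, br x x = 0
    & forall x y z, br x (br y z) + br y (br z x) + br z (br x y) = 0].

Definition lie_ideal (I : {vspace L}) : Prop :=
  forall x y, y \in I -> br x y \in I.

Definition simple_lie : Prop :=
  [/\ lie_bracket, exists x y, br x y != 0
    & forall I, lie_ideal I -> I = 0%VS \/ I = fullv].

Variable H : {vspace L}.

Definition cartan_subalgebra : Prop :=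
  [/\ {in H &, forall x y, br x y = 0},
      {in H, forall x, exists2 X : seq L, basis_of fullv X &
         forall v, v \in X -> exists c, br x v = c *: v}
    & forall y, {in H, forall x, br x y = 0} -> y \in H].

(* Only the values on H of a functional al matter below. *)
Definition in_root_space (al : {linear L -> F^o}) (v : L) : Prop :=
  {in H, forall x, br x v = al x *: v}.

Definition lie_root (al : {linear L -> F^o}) : Prop :=
  (exists2 x, x \in H & al x != 0) /\
  exists2 v, v != 0 & in_root_space al v.

Definition simple_roots r (al : 'I_r -> {linear L -> F^o}) : Prop :=
  [/\ forall i, lie_root (al i),
      forall c : 'I_r -> F,
        {in H, forall x, \sum_i c i * al i x = 0} -> forall i, c i = 0
    & forall be, lie_root be -> exists n : 'I_r -> nat,
        {in H, forall x, be x = \sum_i (n i)%:R * al i x} \/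
        {in H, forall x, be x = - \sum_i (n i)%:R * al i x}].

Definition is_coroot (al : {linear L -> F^o}) (h : L) : Prop :=
  [/\ h \in H, al h = 2%:R
    & exists e f, [/\ in_root_space al e, in_root_space (\- al) f
                    & br e f = h]].

Definition cartan_matrix r (a : 'M[int]_r) : Prop :=
  exists (al : 'I_r -> {linear L -> F^o}) (h : 'I_r -> L),
    [/\ simple_roots al, forall i, is_coroot (al i) (h i)
      & forall i j, al j (h i) = (a i j)%:~R].
End LieAlgebra.

Section QuantumGroup.
Variables (C : fieldType) (r : nat) (a : 'M[int]_r) (d : 'I_r -> nat).

Definition symmetrizer : Prop :=
  [/\ forall i, d i \in [:: 1; 2; 3]%N,
      (\big[gcdn/0]_i d i = 1)%N
    & forall i j, (d i)%:Z * a i j = (d j)%:Z * a j i].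

Definition dynkin_edge (i j : 'I_r) : bool := (i != j) && (a i j != 0).

(* om i j means that the edge ij is oriented from i to j. *)
Definition orientation (om : rel 'I_r) : Prop :=
  (forall i j, om i j -> dynkin_edge i j) /\
  (forall i j, dynkin_edge i j -> om j i = ~~ om i j).

(* e^(hbar c) *)
Definition kexp (c : C) : hser C := hexp (c : C^o).

(* Gaussian binomials in q = e^(hbar n), symmetric under q -> q^-1:
   [m+1, k+1] = q^(k+1) [m, k+1] + q^-(m-k) [m, k]. *)
Fixpoint qbinom (n m k : nat) : hser C :=
  match m, k with
  | _, 0 => 1
  | 0, _.+1 => 0
  | m'.+1, k'.+1 => kexp (n * k'.+1)%N%:R * qbinom n m' k'.+1
                    + kexp (- (n * (m' - k'))%N%:R) * qbinom n m' k'
  end.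

Definition uq_index : choiceType := ('I_r + 'I_r + 'I_r)%type.
Local Notation gE i := (inl (inl i) : uq_index).
Local Notation gF i := (inl (inr i) : uq_index).
Local Notation gH i := (inr i : uq_index).
Local Notation E i := (@hfree_gen C uq_index (gE i)).
Local Notation F i := (@hfree_gen C uq_index (gF i)).
Local Notation H i := (@hfree_gen C uq_index (gH i)).
(* e^(+-hbar d_i h_i) *)
Local Notation K i := (hexp ((d i)%:R *: @free_gen C uq_index (gH i))).
Local Notation KV i := (hexp (- (d i)%:R *: @free_gen C uq_index (gH i))).

Definition qserre (x y : hfree C uq_index) (n m : nat) : hfree C uq_index :=
  \sum_(k < m.+1) ((-1) ^+ k * qbinom n m k) *: (x ^+ (m - k) * y * x ^+ k).

(* In uq_ef both sides of
   [e_i, f_i] = (e^(hbar d_i h_i) - e^(-hbar d_i h_i)) / (q_i - q_i^-1),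
   q_i = e^(hbar d_i), are multiplied by the unit (q_i - q_i^-1) / hbar of
   C[[hbar]]. *)
Inductive uq_rel : hfree C uq_index -> Prop :=
| uq_hh i j : uq_rel (H i * H j - H j * H i)
| uq_he i j : uq_rel (H i * E j - E j * H i - E j *~ a i j)
| uq_hf i j : uq_rel (H i * F j - F j * H i + F j *~ a i j)
| uq_ef_neq i j of i != j : uq_rel (E i * F j - F j * E i)
| uq_ef i : uq_rel (hquo (kexp (d i)%:R - kexp (- (d i)%:R)) *:
                      (E i * F i - F i * E i) - hquo (K i - KV i))
| uq_serre_e i j of i != j : uq_rel (qserre (E i) (E j) (d i) `|1 - a i j|%N)
| uq_serre_f i j of i != j : uq_rel (qserre (F i) (F j) (d i) `|1 - a i j|%N).

Definition uq := presented uq_rel.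
HB.instance Definition _ := GRing.PzRing.on uq.
HB.instance Definition _ := GRing.Lmodule.on uq.

Definition uqE i : uq := presented_gen uq_rel (gE i).
Definition uqF i : uq := presented_gen uq_rel (gF i).

(* U_hbar(n_+) and U_hbar(n_-) *)
Definition uq_np : uq -> Prop :=
  closed_subalg_gen (fun u => exists i, u = uqE i).
Definition uq_nm : uq -> Prop :=
  closed_subalg_gen (fun u => exists i, u = uqF i).

(* The Cartan subalgebra is C^r, in the basis h_1, ..., h_r of simple coroots;
   U_hbar(h) = U(h)[[hbar]] with U(h) = C[h_1, ..., h_r]. *)
Definition uh := hser (mpoly r C).
HB.instance Definition _ := GRing.ComNzRing.on uh.
HB.instance Definition _ := GRing.Algebra.on uh.

Definition hlin (x : 'rV[C]_r) : mpoly r C := \sum_i x 0 i *: 'X_i.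

Definition uh_exp (x : 'rV[C]_r) : uh := hexp (hlin x).

Definition uh_lift (p : mpoly r C) : free_alg C uq_index :=
  mmap (in_alg (free_alg C uq_index)) (fun i => free_gen C (gH i)) p.

Definition uh_emb (u : uh) : uq := presented_pi uq_rel (fun n => uh_lift (u n)).

Fact uh_emb_linear : linear uh_emb.
Proof.
move=> c u v; rewrite /uh_emb -presented_piZ -raddfD /=.
congr presented_pi; apply: funext => n.
rewrite !hserDE !hserZE /uh_lift raddfD raddf_sum /=; congr (_ + _).
by apply: eq_bigr => i _; rewrite mmapZ /= mulr_algl.
Qed.
HB.instance Definition _ :=
  GRing.isLinear.Build (hser C) uh uq *:%R uh_emb uh_emb_linear.

Definition uq_poly : uq -> Prop :=
  subalg_gen (fun u => (exists x, u = uh_emb (uh_exp x)) \/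
                       (exists i, u = uqE i \/ u = uqF i)).

Definition uq_central (Y : uq) : Prop := forall Z : uq, Y * Z = Z * Y.

Section Pomega.
Variable om : rel 'I_r.

Local Notation X i := (@hfree_gen C 'I_r i).

Definition pom_weight (i j : 'I_r) : C :=
  let b := ((d i)%:Z * a i j)%:~R in if om i j then b else - b.

Inductive pom_rel : hfree C 'I_r -> Prop :=
| pom_comm i j of i != j :
    pom_rel (X i * X j - kexp (pom_weight i j) *: (X j * X i)).

Definition pom := presented pom_rel.
HB.instance Definition _ := GRing.PzRing.on pom.
HB.instance Definition _ := GRing.Lmodule.on pom.

Definition pomX i : pom := presented_gen pom_rel i.

(* chi_+ (g = uqE, N = uq_np) and chi_- (g = uqF, N = uq_nm). They reverse
   products: for a function phi with phi(xa) = chi(a) phi(x) one has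
   chi(ab) phi(x) = phi(xab) = chi(b) phi(xa) = chi(b) chi(a) phi(x), and
   similarly on the other side. *)
Definition whittaker_char (g : 'I_r -> uq) (N : uq -> Prop) (chi : uq -> pom) :
    Prop :=
  [/\ forall (c : hser C) u v, N u -> N v ->
        chi (c *: u + v) = c *: chi u + chi v,
      chi 1 = 1,
      forall u v, N u -> N v -> chi (u * v) = chi v * chi u
    & forall i, chi (g i) = pomX i].

(* P_omega (x) U_hbar(g)^* and P_omega (x) U_hbar(h)^*, completed tensor
   products: P_omega-valued linear functions. *)
Definition afun_g := {linear uq -> pom}.
Definition afun_h := {linear uh -> pom}.

Fact afun_h_ext (psi psi' : afun_h) : psi =1 psi' -> psi = psi'.
Proof.
case: psi psi' => [f [[f1] [f2]]] [g [[g1] [g2]]] /= /funext eq_fg.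
move: g1 g2; rewrite -eq_fg => g1 g2.
by rewrite (Prop_irrelevance g1 f1) (Prop_irrelevance g2 f2).
Qed.

Definition Lact_fun (Y : uq) (phi : afun_g) (x : uq) : pom := phi (x * Y).
Fact Lact_linear Y phi : linear (Lact_fun Y phi).
Proof.
by move=> c u v; rewrite /Lact_fun mulrDl -presented_scaleAl linearP.
Qed.
HB.instance Definition _ Y phi :=
  GRing.isLinear.Build (hser C) uq pom *:%R (Lact_fun Y phi)
    (Lact_linear Y phi).
Definition Lact (Y : uq) (phi : afun_g) : afun_g := Lact_fun Y phi.

Definition restr_h (phi : afun_g) : afun_h := phi \o uh_emb.

Definition whittaker (chip chim : uq -> pom) (phi : afun_g) : Prop :=
  forall am ap x, uq_nm am -> uq_np ap ->
    phi (am * x * ap) = chip ap * phi x * chim am.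

(* A_h[[hbar]] is the dual of U_hbar(h). For psi in it,
     (T_be psi)(u) = psi(u e^(hbar be)),
     (f psi)(u) = sum f(u_(1)) psi(u_(2)),
   where on a product h_w of elements h_i, indexed by a word w, the coproduct
   is the sum over the ways to split w into two complementary subwords.
   The operator hbar^-N sum_k f_k T_(be_k) on A_h[[hbar]] is psi |-> psi \o T
   for the endomorphism T of U_hbar(h) described here, and in this form it
   acts on functions with values in any C[[hbar]]-module. The powers of hbar
   in the denominator come from 1 / (q_i - q_i^-1) in [e_i, f_i]. *)
Definition uh_word (w : seq 'I_r) : uh := hconst (\prod_(i <- w) 'X_i).

Definition diff_op (T : {linear uh -> uh}) : Prop :=
  exists (N n : nat) (f : 'I_n -> {linear uh -> (hser C)^o})
         (be : 'I_n -> 'rV[C]_r),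
    forall w : seq 'I_r,
      hbar C ^+ N *: T (uh_word w) =
      \sum_k \sum_(b : (size w).-tuple bool)
        (f k (uh_word (mask b w)) : hser C) *:
          (uh_word (mask (map negb b) w) * uh_exp (be k)).

(* The operators of the elements sum_k D_k (x) (x_k (x) y_k) of the algebraic
   tensor product D_q(H) (x) P_omega (x) P_omega^op. An element is not determined
   by its operator: if r = 1 then x_1 (x) 1 - 1 (x) x_1 acts by 0. *)
Definition bdiff_op (D : afun_h -> afun_h) : Prop :=
  exists (n : nat) (T : 'I_n -> {linear uh -> uh}) (x y : 'I_n -> pom),
    (forall k, diff_op (T k)) /\
    forall psi u, D psi u = \sum_k x k * psi (T k u) * y k.

Definition represents (chip chim : uq -> pom) (Y : uq)
    (D : afun_h -> afun_h) : Prop :=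
  bdiff_op D /\
  forall phi, whittaker chip chim phi -> restr_h (Lact Y phi) = D (restr_h phi).

End Pomega.
End QuantumGroup.

(* Main.v *)
Require Import Defs.
From HB Require Import structures.
From mathcomp Require Import all_boot all_order all_algebra finmap.
From mathcomp Require Import boolp reals complex monalg mpoly ring zify.

Set Implicit Arguments.
Unset Strict Implicit.
Unset Printing Implicit Defensive.

Import Order.TTheory GRing.Theory Num.Theory.
Local Open Scope ring_scope.

(* The operator D_Y is read off from a normal form of Y, a combination of
   products f_w g e_v with g a combination of exponentials: a Whittaker
   function phi takes at u f_w g e_v the value chi_+(e_v) phi(u' g) chi_-(f_w),
   where u' is the translate of u by the weight of f_w.

   Uniqueness and (ii) hold because every psi on U_hbar(h) is the restriction of
   a Whittaker function. No PBW theorem is needed for that. Think of a function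
   phi as the family of values g w h = phi(h e_w), for words w. The generators
   act on such families by right translation, the action of f_i being dictated
   by the commutation relations. All relations hold identically except the Serre
   relations between the e_i; these hold on a submodule, because the Serre
   elements commute with the f_l. The required function is then
   x |-> (x psihat)([::], 1), with psihat w h = chi_+(e_w) psi(h).

   The characters chi_+ and chi_- are only given on closed subalgebras, and they
   are hbar-adically continuous. The topology induced on these subalgebras is
   their hbar-adic one, because the same extension of functions, now with values
   in U_hbar(g), gives linear projections onto them. *)

(** * Sums of hbar-adic series *)

(** The obstacle is that little is known a priori about U_hbar(g) and P_omega: they could have
    hbar-torsion, and only their separatedness (the ideal being closed) and the existence of sums of
    hbar-adic series are at hand. Hence identities are proved by coinduction on powers of hbar,
    C[[hbar]]-linear maps being automatically continuous, and every cancellation of q_i - q_i^-1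
    takes place in U_hbar(h), which is visibly torsion-free. The Serre relations for the x_i in
    P_omega are obtained as images, under the given chi_+ and chi_-, of the Serre relations between
    the e_i and between the f_i. One computation, the commutation of a Serre element with a lowering
    operator, serves twice; with e and f exchanged it reduces the Serre relations between the f_i to
    the empty word. A weight translation of U_hbar(h) is dual to multiplication by a character of
    the torus, which is why D_Y is a difference operator. *)

Section Hconst.
Variable V : zmodType.
Implicit Types v : V.

Lemma hconst_is_zmod_morphism : zmod_morphism (@hconst V).
Proof.
by move=> u v; apply: funext => -[|n]; rewrite hserDE hserNE //= subr0.
Qed.
HB.instance Definition _ := GRing.isZmodMorphism.Build V (hser V) (@hconst V)
  hconst_is_zmod_morphism.

Lemma hconst0 : hconst (0 : V) = 0.
Proof. exact: raddf0. Qed.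

Lemma hconstD u v : hconst (u + v) = hconst u + hconst v.
Proof. exact: raddfD. Qed.

End Hconst.

Section Series.
Variables (C : comNzRingType) (V : lmodType C).
Implicit Types (s : hser V) (v : V).

Lemma hconstZE (c : C) s n : (hconst c *: s) n = c *: s n.
Proof.
rewrite hserZE big_ord_recl /= subn0 big1 ?addr0 // => i _; exact: scale0r.
Qed.

Lemma hbarZE s n : (hbar C *: s) n = if n is m.+1 then s m else 0.
Proof.
rewrite hserZE; case: n => [|n].
  by rewrite big_ord1 /hbar /= scale0r.
rewrite big_ord_recl scale0r add0r big_ord_recl /= /hbar /= scale1r subSS subn0.
by rewrite big1 ?addr0 // => i _; exact: scale0r.
Qed.

Lemma hser_split s : s = hconst (s 0%N) + hbar C *: hquo s.
Proof.
apply: funext => n; rewrite hserDE hbarZE.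
by case: n => [|n] /=; rewrite ?addr0 ?add0r.
Qed.

Lemma hconst_is_linear (c : C) v : hconst (c *: v) = hconst c *: hconst v.
Proof. by apply: funext => n; rewrite hconstZE; case: n => //=; rewrite scaler0. Qed.

Lemma hquo_hbar s : hquo (hbar C *: s) = s.
Proof. by apply: funext => n; rewrite /hquo hbarZE. Qed.

Lemma hbarZ_hquo s : s 0%N = 0 -> hbar C *: hquo s = s.
Proof. by move=> s0; apply: funext => -[|n]; rewrite hbarZE. Qed.
End Series.

Lemma scale_hser_split (C : comNzRingType) (V : lmodType (hser C)) c (v : V) :
  c *: v = hconst (c 0%N) *: v + hbar C *: (hquo c *: v).
Proof. by rewrite {1}(@hser_split C C^o c : c = _ + _ * _) scalerDl scalerA. Qed.

Lemma hconst_mul (A : nzRingType) (a : A) (s : hser A) n :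
  (hconst a * s) n = a * s n.
Proof.
rewrite hserME big_ord_recl /= subn0 big1 ?addr0 // => i _; exact: mul0r.
Qed.

Lemma hconstM (A : nzRingType) (a b : A) : hconst (a * b) = hconst a * hconst b.
Proof. by apply: funext => -[|n]; rewrite hconst_mul //= mulr0. Qed.

Lemma hconst1 (A : nzRingType) : hconst (1 : A) = 1.
Proof. by apply: funext => -[|n]. Qed.

Section Complete.
Variable C : comNzRingType.

Definition hseparated (V : lmodType (hser C)) :=
  forall v : V, (forall n, exists w, v = hbar C ^+ n *: w) -> v = 0.

(* S p stands for the sum of the series p_0 + hbar p_1 + hbar^2 p_2 + ... *)
Definition hsummation (V : lmodType (hser C)) (S : (nat -> V) -> V) :=
  forall p, S p = p 0%N + hbar C *: S (fun n => p n.+1).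

Section Separated.
Variables (V : lmodType (hser C)) (Vsep : hseparated V).

(** Iterating the hypothesis gives v 0 = hbar^n v n for every n. *)
Lemma hsep_coind (v : nat -> V) :
  (forall n, v n = hbar C *: v n.+1) -> v 0%N = 0.
Proof.
move=> vS; apply: Vsep => n; exists (v n).
by elim: n => [|n IHn]; rewrite ?expr0 ?scale1r // {1}IHn vS exprSr scalerA.
Qed.

(* An equality of two expressions in a sequence p follows by coinduction. *)
Lemma hsep_coind2 (T : Type) (sh : T -> T) (f g : T -> V) :
  (forall p, f p - g p = hbar C *: (f (sh p) - g (sh p))) -> f =1 g.
Proof.
move=> fgS p; apply/eqP; rewrite -subr_eq0; apply/eqP.
exact: (hsep_coind (v := fun n => f (iter n sh p) - g (iter n sh p))).
Qed.

Variables (S : (nat -> V) -> V) (SP : hsummation S).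

(** In a separated module the recursion determines [S]: both sides obey the same recursion on the
    tails of p and q. *)
Lemma hsum_linear (c : hser C) p q :
  S (fun n => c *: p n + q n) = c *: S p + S q.
Proof.
apply: (hsep_coind2 (sh := fun pq => (fun n => pq.1 n.+1, fun n => pq.2 n.+1))
  (f := fun pq => S (fun n => c *: pq.1 n + pq.2 n))
  (g := fun pq => c *: S pq.1 + S pq.2) _ (p, q)) => -[{}p {}q] /=.
rewrite [in LHS]SP [S p in LHS]SP [S q in LHS]SP scalerBr !scalerDr !scalerA.
by rewrite [c * _]mulrC [X in _ - X]addrACA opprD addrACA subrr add0r.
Qed.

Lemma hsumD p q : S (fun n => p n + q n) = S p + S q.
Proof.
have := hsum_linear 1 p q; rewrite scale1r => <-.
by congr S; apply: funext => n; rewrite scale1r.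
Qed.

Lemma hsum0 : S (fun=> 0) = 0.
Proof.
by apply: (hsep_coind (v := fun=> S (fun=> 0))) => _; rewrite [in LHS]SP add0r.
Qed.

Lemma hsumZ (c : hser C) p : S (fun n => c *: p n) = c *: S p.
Proof.
have := hsum_linear c p (fun=> 0); rewrite hsum0 addr0 => <-.
by congr S; apply: funext => n; rewrite addr0.
Qed.

End Separated.

(** Linearity over C[[hbar]] already forces continuity: f commutes with multiplication by hbar, so
    both sides satisfy one recursion. *)
Lemma hsum_map (V W : lmodType (hser C)) (Wsep : hseparated W)
    (S : (nat -> V) -> V) (S' : (nat -> W) -> W)
    (SP : hsummation S) (S'P : hsummation S') (f : V -> W) (fL : linear f) p :
  f (S p) = S' (fun n => f (p n)).
Proof.
move: p; apply: (hsep_coind2 Wsep (sh := fun p n => p n.+1)) => p.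
by rewrite [in LHS]SP [in LHS]S'P [X in f X]addrC fL scalerBr opprD addrA addrK.
Qed.

(** u is the partial sum of the first N terms. This keeps infinite sums inside closed
    subalgebras. *)
Lemma hsep_tail (V : lmodType (hser C)) (S : (nat -> V) -> V) (SP : hsummation S)
    (Q : V -> Prop) (Q0 : Q 0) (QL : forall (c : hser C) u v, Q u -> Q v -> Q (c *: u + v))
    p N :
  (forall n, Q (p n)) -> exists u v, Q u /\ S p = u + hbar C ^+ N *: v.
Proof.
elim: N p => [|N IHN] p Qp; first by exists 0, (S p); rewrite expr0 scale1r add0r.
have [u [v [Qu Suv]]] := IHN (fun n => p n.+1) (fun n => Qp n.+1).
exists (hbar C *: u + p 0%N), v; split; first exact: QL.
by rewrite SP Suv scalerDr scalerA -exprS addrA [p _ + _]addrC.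
Qed.
End Complete.

(** * Actions of presented algebras *)

Definition mk_linear (R : pzRingType) (U V : lmodType R) (f : U -> V)
    (fL : linear f) : {linear U -> V} :=
  HB.pack f (GRing.isLinear.Build R U V *:%R f fL).

Lemma linear_at0 (R : pzRingType) (U V : lmodType R) (f : U -> V) :
  linear f -> f 0 = 0.
Proof. by move=> fL; exact: linear0 (mk_linear fL). Qed.

Section Presented.
Variables (C : fieldType) (G : choiceType) (rel : hfree C G -> Prop).
Local Notation P := (presented rel).

Lemma presented_surj (u : P) : exists x, u = presented_pi rel x.
Proof. by exists (repr u); rewrite presented_piK. Qed.

Lemma closed_ideal_gen x : ideal_gen rel x -> x \in closed_ideal rel.
Proof.
by move=> Ix; apply/asboolP => n; exists x, 0; rewrite scaler0 addr0.
Qed.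

Lemma presented_pi0 x : x \in closed_ideal rel -> presented_pi rel x = 0.
Proof.
by move=> Ix; rewrite -(raddf0 (presented_pi rel)); apply/presented_piP; rewrite subr0.
Qed.

Lemma presented_pi_rel x : rel x -> presented_pi rel x = 0.
Proof. by move=> rx; apply/presented_pi0/closed_ideal_gen/IdealRel. Qed.

(** This is where taking the closure of the ideal pays off: x congruent to a multiple of hbar^n
    modulo the closed ideal, for every n, is a limit of elements of the ideal. *)
Lemma presented_sep : hseparated P.
Proof.
move=> u usep; have [x ux] := presented_surj u; rewrite ux; apply: presented_pi0.
apply/asboolP => n; have [w uw] := usep n; have [z wz] := presented_surj w.
have : x - hbar C ^+ n *: z \in closed_ideal rel.
  by apply/presented_piP; rewrite presented_piZ -wz -uw -ux.
move=> /asboolP Ixz; have [y [t [Iy xt]]] := Ixz n.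
exists y, (z + t); split; first exact: Iy.
by rewrite scalerDr addrCA -xt addrC subrK.
Qed.

(** Representatives are summed coefficientwise; only finitely many terms hbar^n p_n reach a given
    power of hbar. *)
Definition presented_sum (p : nat -> P) : P :=
  presented_pi rel (fun m => \sum_(n < m.+1) repr (p n) (m - n)%N).

Lemma presented_sumP : hsummation presented_sum.
Proof.
move=> p; rewrite -[in RHS](presented_piK (p 0%N)) -presented_piZ -raddfD.
congr presented_pi; apply: funext => m; rewrite hserDE hbarZE.
rewrite big_ord_recl subn0; congr (_ + _).
by case: m => [|m]; rewrite ?big_ord0.
Qed.
End Presented.

Section FreeAction.
Variables (C : fieldType) (G : choiceType).
Local Notation A := (free_alg C G).

Lemma free_alg_ind (Q : A -> Prop) :
  Q 0 -> (forall c x y, Q x -> Q y -> Q (c *: x + y)) ->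
  (forall w : seq G, Q << FMonom w >>) -> forall x, Q x.
Proof.
move=> Q0 QL Qw x; rewrite (monalgE x); elim/big_ind: _ => // [u v Qu Qv|k _].
  by rewrite -[u]scale1r; apply: QL.
rewrite -[monalg.mcoeff k x]mulr1 -[<< _ *g _ >>]addr0.
have -> : << monalg.mcoeff k x * 1 *g k >> = monalg.mcoeff k x *: (<< k >> : A).
  by apply/malgP => k'; rewrite monalg.mcoeffZ !monalg.mcoeffU mulrnAr.
by apply: QL => //; case: k.
Qed.

Lemma fmonomM (w1 w2 : seq G) :
  << FMonom w1 >> * << FMonom w2 >> = << FMonom (w1 ++ w2) >> :> A.
Proof.
rewrite malgM_def fgmulUU mulr1; congr << _ >>.
by apply: val_inj; rewrite /= fmM.
Qed.

Lemma free_genE (g : G) : free_gen C g = << FMonom [:: g] >> :> A.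
Proof. by rewrite /free_gen fmuE. Qed.

Lemma free_alg1 : (1 : A) = << FMonom [::] >>.
Proof. by congr << _ >>; apply: val_inj; rewrite /= fm1. Qed.

Variables (M : lmodType (hser C)) (Msep : hseparated M).
Variables (S : (nat -> M) -> M) (SP : hsummation S).
Variable op : G -> {linear M -> M}.

Definition word_act (w : seq G) (m : M) : M := foldr (fun g => op g) m w.

Lemma word_act_linear w : linear (word_act w).
Proof. elim: w => //= g w IHw c u v; rewrite -linearP; congr (op g _); exact: IHw. Qed.

Definition free_act (x : A) (m : M) : M :=
  \sum_(k <- monalg.msupp x) hconst (monalg.mcoeff k x) *: word_act k m.

Lemma free_actEw (d : {fset {fmonom G}}) x m : (monalg.msupp x `<=` d)%fset ->
  free_act x m = \sum_(k <- d) hconst (monalg.mcoeff k x) *: word_act k m.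
Proof.
move=> le_xd; rewrite /free_act (big_fset_incl _ le_xd) //= => k _ kx.
by rewrite monalg.mcoeff_outdom // hconst0 scale0r.
Qed.

Lemma free_actL c x y m :
  free_act (c *: x + y) m = hconst c *: free_act x m + free_act y m.
Proof.
pose d := (monalg.msupp x `|` monalg.msupp y)%fset.
rewrite !(@free_actEw d) ?fsubsetUl ?fsubsetUr //; last first.
  apply: fsubset_trans (monalg.msuppD_le _ _) _.
  by rewrite fsetSU // monalg.msuppZ_le.
rewrite scaler_sumr -big_split; apply: eq_bigr => k _ /=.
by rewrite scalerA -scalerDl -hconstM -hconstD monalg.mcoeffD monalg.mcoeffZ.
Qed.

Lemma free_act_linear x : linear (free_act x).
Proof.
move=> c u v; rewrite /free_act scaler_sumr -big_split; apply: eq_bigr => k _ /=.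
by rewrite word_act_linear scalerDr !scalerA mulrC.
Qed.

Lemma free_act0 m : free_act 0 m = 0.
Proof. by rewrite /free_act monalg.msupp0 big_seq_fset0. Qed.

Lemma free_act_word w m : free_act << FMonom w >> m = word_act w m.
Proof. by rewrite /free_act monalg.msuppU1 big_seq_fset1 monalg.mcoeffUU hconst1 scale1r. Qed.

Lemma free_actM x y m : free_act (x * y) m = free_act x (free_act y m).
Proof.
move: x; apply: free_alg_ind => [|c u v IHu IHv|w1]; first by rewrite mul0r !free_act0.
  by rewrite mulrDl -scalerAl !free_actL IHu IHv.
move: y; apply: free_alg_ind => [|c u v IHu IHv|w2].
- by rewrite mulr0 free_act0 (linear_at0 (free_act_linear _)).
- by rewrite mulrDr -scalerAr !free_actL IHu IHv free_act_linear.
by rewrite fmonomM !free_act_word /word_act foldr_cat.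
Qed.

Definition hfree_act (x : hfree C G) (m : M) : M := S (fun n => free_act (x n) m).

Lemma hfree_act_linear x : linear (hfree_act x).
Proof.
move=> c u v; rewrite /hfree_act -(hsum_linear Msep SP).
by congr S; apply: funext => n; rewrite free_act_linear.
Qed.

Lemma hfree_actD x y m : hfree_act (x + y) m = hfree_act x m + hfree_act y m.
Proof.
rewrite /hfree_act -(hsumD Msep SP); congr S; apply: funext => n.
by rewrite hserDE -[x n]scale1r free_actL hconst1 !scale1r.
Qed.

Lemma hfree_act_split x m :
  hfree_act x m = free_act (x 0%N) m + hbar C *: hfree_act (hquo x) m.
Proof. by rewrite /hfree_act SP. Qed.

Lemma hfree_act_const (x : A) m : hfree_act (hconst x) m = free_act x m.
Proof.
rewrite hfree_act_split; have -> : hquo (hconst x) = 0 :> hfree C G by apply: funext.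
rewrite [X in _ + _ *: X](_ : _ = 0) ?scaler0 ?addr0 //.
rewrite /hfree_act -[RHS](hsum0 Msep SP); congr S; apply: funext => n.
exact: free_act0.
Qed.

Lemma hfree_act_hbar x m : hfree_act (hbar C *: x) m = hbar C *: hfree_act x m.
Proof. by rewrite hfree_act_split hbarZE free_act0 add0r hquo_hbar. Qed.

Lemma hfree_act_constM (x : A) y m :
  hfree_act (hconst x * y) m = free_act x (hfree_act y m).
Proof.
rewrite (hsum_map Msep SP SP (free_act_linear x)).
by congr S; apply: funext => n; rewrite hconst_mul free_actM.
Qed.

(** Coinduction on x: the constant term is handled by [hfree_act_constM], and what remains is hbar
    times the same statement for [hquo x]. *)
Lemma hfree_actM x y m : hfree_act (x * y) m = hfree_act x (hfree_act y m).
Proof.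
move: x; apply: (hsep_coind2 Msep (sh := fun x => hquo x)) => x.
have -> : x * y = hconst (x 0%N) * y + hbar C *: (hquo x * y).
  by rewrite {1}(hser_split x) mulrDl -scalerAl.
rewrite [X in X - _]hfree_actD [X in X + _ - _]hfree_act_constM.
rewrite [X in _ + X - _]hfree_act_hbar [X in _ - X]hfree_act_split.
by rewrite opprD addrACA subrr add0r -scalerBr.
Qed.

Lemma hfree_act_constZ c x m :
  hfree_act (hconst c *: x) m = hconst c *: hfree_act x m.
Proof.
rewrite /hfree_act -(hsumZ Msep SP); congr S; apply: funext => n.
by rewrite hconstZE -[c *: _]addr0 free_actL free_act0 addr0.
Qed.

Lemma hfree_actZ c x m : hfree_act (c *: x) m = c *: hfree_act x m.
Proof.
move: c; apply: (hsep_coind2 Msep (sh := fun c => hquo c)) => c.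
have cx := congr1 (hfree_act^~ m) (scale_hser_split c x); rewrite {}cx.
rewrite [X in X - _]hfree_actD [X in X + _ - _]hfree_act_constZ.
rewrite [X in _ + X - _]hfree_act_hbar [X in _ - X]scale_hser_split.
by rewrite opprD addrACA subrr add0r scalerBr.
Qed.

Lemma hfree_actB x y m : hfree_act (x - y) m = hfree_act x m - hfree_act y m.
Proof. by rewrite hfree_actD -[- y]scaleN1r hfree_actZ scaleN1r. Qed.

Lemma hfree_act0 m : hfree_act 0 m = 0.
Proof. by rewrite -[0 in LHS](scale0r 0) hfree_actZ scale0r. Qed.

Lemma hfree_act_sum (I : Type) (s : seq I) (F : I -> hfree C G) m :
  hfree_act (\sum_(i <- s) F i) m = \sum_(i <- s) hfree_act (F i) m.
Proof.
by elim: s => [|i s IHs]; rewrite ?big_nil ?hfree_act0 // !big_cons hfree_actD IHs.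
Qed.

Lemma hfree_act1 m : hfree_act 1 m = m.
Proof. by rewrite -hconst1 hfree_act_const free_alg1 free_act_word. Qed.

Lemma hfree_actX x n m : hfree_act (x ^+ n) m = iter n (hfree_act x) m.
Proof.
by elim: n => [|n IHn]; rewrite ?hfree_act1 // exprS hfree_actM IHn iterS.
Qed.

Lemma hfree_act_gen g m : hfree_act (hfree_gen C g) m = op g m.
Proof. by rewrite hfree_act_const free_genE free_act_word. Qed.

Lemma hfree_act_stable (Q : M -> Prop) : Q 0 ->
  (forall (c : hser C) u v, Q u -> Q v -> Q (c *: u + v)) ->
  (forall p, (forall n, Q (p n)) -> Q (S p)) ->
  (forall g m, Q m -> Q (op g m)) ->
  forall x m, Q m -> Q (hfree_act x m).
Proof.
move=> Q0 QL QS Qop x m Qm; apply: QS => n; move: (x n); apply: free_alg_ind.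
- by rewrite free_act0.
- by move=> c u v Qu Qv; rewrite free_actL; apply: QL.
move=> w; rewrite free_act_word; elim: w => //= g w; exact: Qop.
Qed.

(** The relations are asked to vanish on Q alone, because the Serre relations fail on the whole
    module. Stability of Q takes care of right multiples, separatedness of M of the closure. *)
Lemma hfree_act_ideal (rel : hfree C G -> Prop) (Q : M -> Prop) :
  (forall x m, Q m -> Q (hfree_act x m)) ->
  (forall r m, rel r -> Q m -> hfree_act r m = 0) ->
  forall x m, x \in closed_ideal rel -> Q m -> hfree_act x m = 0.
Proof.
move=> Qact Qrel x m /asboolP Ix Qm; apply: Msep => n.
have [y [z [Iy ->]]] := Ix n; exists (hfree_act z m).
rewrite hfree_actD hfree_actZ [X in X + _](_ : _ = 0) ?add0r //.
have act0 u : hfree_act u 0 = 0.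
  exact: linear_at0 (hfree_act_linear u).
elim: {Ix} Iy m Qm => [r rr||u v _ IHu _ IHv|a u _ IHu|a u _ IHu] m Qm.
- exact: Qrel.
- exact: hfree_act0.
- by rewrite hfree_actD IHu ?IHv ?addr0.
- by rewrite hfree_actM IHu ?act0.
by rewrite hfree_actM IHu //; apply: Qact.
Qed.
End FreeAction.

Lemma hfree_act_comm (C : fieldType) (G : choiceType) (M N : lmodType (hser C))
    (Nsep : hseparated N) (S : (nat -> M) -> M) (S' : (nat -> N) -> N)
    (SP : hsummation S) (S'P : hsummation S')
    (op : G -> {linear M -> M}) (op' : G -> {linear N -> N}) (f : {linear M -> N}) :
  (forall g m, f (op g m) = op' g (f m)) ->
  forall x m, f (hfree_act S op x m) = hfree_act S' op' x (f m).
Proof.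
move=> fop x m; rewrite (hsum_map Nsep SP S'P (linearP f)).
congr S'; apply: funext => n; move: (x n); apply: free_alg_ind.
- by rewrite !free_act0 linear0.
- by move=> c u v IHu IHv; rewrite !free_actL linearP IHu IHv.
by move=> w; rewrite !free_act_word; elim: w => //= g w <-.
Qed.

(** * Quantum binomial identities *)

Section Exponential.
Variable C : numFieldType.

Lemma hexp0 (A : lalgType C) : hexp (0 : A) = 1.
Proof.
apply: funext => -[|n]; rewrite /hexp; first by rewrite expr0 invr1 scale1r.
by rewrite expr0n scaler0.
Qed.

Lemma hexpD (A : algType C) (x y : A) :
  GRing.comm x y -> hexp (x + y) = hexp x * hexp y.
Proof.
move=> xy; apply: funext => n; rewrite hserME /hexp exprDn_comm //.
rewrite (reindex_inj rev_ord_inj) scaler_sumr; apply: eq_bigr => i _ /=.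
have le_in : (i <= n)%N by rewrite -ltnS.
rewrite subSS subKn // -scalerAl -scalerAr scalerA -scaler_nat scalerA.
congr (_ *: _); rewrite bin_sub //.
have nz k : (k`!%:R : C) != 0 by rewrite pnatr_eq0 -lt0n fact_gt0.
by rewrite -(bin_fact le_in) !natrM; field; rewrite !nz pnatr_eq0 -lt0n bin_gt0 le_in.
Qed.

Lemma kexp0 : kexp (0 : C) = 1. Proof. exact: (@hexp0 C^o). Qed.

Lemma kexpD (c1 c2 : C) : kexp (c1 + c2) = kexp c1 * kexp c2.
Proof. by apply: (@hexpD C^o); exact: mulrC. Qed.

Lemma kexpX (c : C) n : kexp c ^+ n = kexp (c * n%:R).
Proof.
elim: n => [|n IHn]; first by rewrite mulr0 kexp0.
by rewrite exprS IHn -kexpD -natr1 mulrDr mulr1 addrC.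
Qed.

Lemma kexpVr (c : C) : kexp c * kexp (- c) = 1.
Proof. by rewrite -kexpD subrr kexp0. Qed.
End Exponential.

Section Qbinom.
Variables (C : numFieldType) (n : nat).
Local Notation b := (@qbinom C n).

Lemma qbinom0 m : b m 0 = 1. Proof. by case: m. Qed.

Lemma qbinomS m k : b m.+1 k.+1 =
  kexp (n * k.+1)%N%:R * b m k.+1 + kexp (- (n * (m - k))%N%:R) * b m k.
Proof. by []. Qed.

Lemma qbinom_small m k : (m < k)%N -> b m k = 0.
Proof.
elim: m k => [|m IHm] [|k] //= ltmk.
by rewrite !IHm ?mulr0 ?addr0 // ltnW.
Qed.

Definition qnum k : hser C := kexp (n * k)%N%:R - kexp (- (n * k)%N%:R).

(** The q-analogue of binom(m,p) (m - p) = binom(m,p+1) (p + 1); [qnum k] is (q - q^-1) times the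
    q-number of k, for q = e^(hbar n). *)
Lemma qbinom_absorb m p : b m p * qnum (m - p) = b m p.+1 * qnum p.+1.
Proof.
elim: m p => [|m IHm] [|p].
- by rewrite /qnum muln0 oppr0 subrr mulr0 mul0r.
- by rewrite !mul0r.
- have := IHm 0; rewrite !qbinom0 mul1r mul1r !subn0 => IH.
  rewrite qbinomS qbinom0 mulr1 mulrDl -mulrA -IH subn0 /qnum !muln1.
  rewrite mulnS natrD opprD !kexpD.
  by ring.
(* For m <= p the truncated difference m - p is 0 and both sides vanish. *)
have [ltmp|lepm] := ltnP m p.+1.
  rewrite [b m.+1 p.+2]qbinom_small ?ltnS //.
  rewrite subSS (eqP (_ : (m - p)%N == 0)) ?subn_eq0 // /qnum.
  by rewrite muln0 oppr0 subrr mulr0 mul0r.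
have IH0 := IHm p; have IH1 := IHm p.+1.
rewrite !qbinomS subSS.
have E : (m - p = (m - p.+1).+1)%N by rewrite -subSn.
rewrite E in IH0 *; move: IH0 IH1; rewrite /qnum.
rewrite [(n * p.+2)%N]mulnS [(n * (m - p.+1).+1)%N]mulnS !natrD !opprD !kexpD.
move: (kexp n%:R) (kexp (- n%:R)) (b m p) (b m p.+1) (b m p.+2) => q qi B0 B1 B2.
move: (kexp (n * p.+1)%:R) (kexp (- (n * p.+1)%:R)) => X Xi.
move: (kexp (n * (m - p.+1))%:R) (kexp (- (n * (m - p.+1))%:R)) => Y Yi IH0 IH1.
transitivity (X * B1 * (q * Y - qi * Yi) + qi * Yi * (B1 * (X - Xi))).
  by rewrite -IH0; ring.
transitivity (q * X * (B1 * (Y - Yi)) + Yi * B1 * (q * X - qi * Xi)); first by ring.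
by rewrite IH1; ring.
Qed.

(** By the q-binomial theorem this is the product of the factors 1 - q^(2j-m+1) z for 0 <= j < m, so
    that its extreme zeros are q^(m-1) and q^-(m-1). *)
Definition qpoch m (z : hser C) := \sum_(k < m.+1) (-1) ^+ k * b m k * z ^+ k.

Lemma qpochS m z :
  qpoch m.+1 z = (1 - kexp (- (n * m)%N%:R) * z) * qpoch m (kexp n%:R * z).
Proof.
rewrite /qpoch big_ord_recl expr0 qbinom0 !mulr1.
under eq_bigr => k _.
  rewrite lift0 qbinomS mulrDr mulrDl.
  over.
rewrite big_split /= addrA mulrBl mul1r; congr (_ + _).
  rewrite [RHS](_ : _ = \sum_(k < m.+2) (-1) ^+ k * b m k * (kexp n%:R * z) ^+ k).
    rewrite [RHS]big_ord_recl expr0 qbinom0 !mulr1; congr (_ + _).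
    apply: eq_bigr => k _; rewrite lift0 exprMn kexpX natrM mulrA; ring.
  by rewrite [RHS]big_ord_recr /= [b m m.+1]qbinom_small // mulr0 mul0r addr0.
rewrite mulr_sumr -sumrN; apply: eq_bigr => k _.
have -> : kexp (- (n * (m - k))%N%:R) = kexp (- (n * m)%N%:R) * kexp n%:R ^+ k :> hser C.
  rewrite kexpX -kexpD mulnBr natrB ?leq_mul2l ?(leq_ord k) ?orbT //.
  by rewrite opprB [(n * k)%:R]natrM addrC.
by rewrite exprS exprS exprMn; ring.
Qed.

Lemma qpoch0p m : qpoch m.+1 (kexp (n * m)%N%:R) = 0.
Proof. by rewrite qpochS -kexpD addNr kexp0 subrr mul0r. Qed.

Lemma qpoch0n m : qpoch m.+1 (kexp (- (n * m)%N%:R)) = 0.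
Proof.
elim: m => [|m IHm]; first by have := qpoch0p 0; rewrite muln0 oppr0.
have E : kexp n%:R * kexp (- (n * m.+1)%N%:R) = kexp (- (n * m)%N%:R) :> hser C.
  by rewrite -kexpD mulnS natrD opprD addrA subrr add0r.
by rewrite qpochS E IHm mulr0.
Qed.
End Qbinom.

(** * Serre elements and lowering operators *)

Section HserComplete.
Variables (C : comNzRingType) (V : lmodType C).

Lemma hbarXZE n (s : hser V) m :
  (hbar C ^+ n *: s) m = if (n <= m)%N then s (m - n)%N else 0.
Proof.
elim: n m => [|n IHn] m; first by rewrite expr0 scale1r subn0.
by rewrite exprS -scalerA hbarZE; case: m => [|m] //; rewrite IHn.
Qed.

Lemma hser_sep : hseparated (hser V).
Proof.
move=> s ssep; apply: funext => n; have [w ->] := ssep n.+1.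
by rewrite hbarXZE ltnn.
Qed.

Definition hser_sum (p : nat -> hser V) : hser V :=
  fun m => \sum_(n < m.+1) p n (m - n)%N.

Lemma hser_sumP : hsummation hser_sum.
Proof.
move=> p; apply: funext => m; rewrite hserDE hbarZE /hser_sum.
rewrite big_ord_recl subn0; congr (_ + _).
by case: m => [|m]; rewrite ?big_ord0.
Qed.
End HserComplete.

Section HserInverse.
Variable C : fieldType.

(** Geometric series: s = s_0 (1 - hbar y), and v is the sum of the hbar^n y^n. *)
Lemma hser_inv (s : hser C) : s 0%N != 0 -> exists t, t * s = 1.
Proof.
move=> s0; pose y : hser C := - (hconst (s 0%N)^-1 * hquo s).
have Sl := @hsumZ C (hser C^o) (@hser_sep C C^o) _ (@hser_sumP C C^o).
pose v : hser C := @hser_sum C C^o (fun n => y ^+ n).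
have vE : v = 1 + hbar C * (y * v).
  have -> : y * v = @hser_sum C C^o (fun n => y * y ^+ n) := esym (Sl y _).
  rewrite {1}/v (@hser_sumP C C^o) expr0.
  have -> : (fun n => y ^+ n.+1) = (fun n => y * y ^+ n).
    by apply: funext => n; rewrite exprS.
  by [].
exists (v * hconst (s 0%N)^-1).
have {2}-> : s = hconst (s 0%N) + hbar C * hquo s := @hser_split C C^o s.
rewrite mulrDr -mulrA -hconstM mulVf // hconst1 mulr1.
rewrite {1}vE /y; ring.
Qed.

Lemma hserZ_reg (V : lmodType C) (s : hser C) (u : hser V) :
  s 0%N = 0 -> s 1%N != 0 -> s *: u = 0 -> u = 0.
Proof.
move=> s0 s1 su0; have [t ts] := @hser_inv (hquo s) s1.
have sE : s = hbar C * hquo s by rewrite -[LHS](@hbarZ_hquo C C^o s s0).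
rewrite -[u]scale1r -ts -scalerA.
suff -> : hquo s *: u = 0 by rewrite scaler0.
by rewrite -[LHS]hquo_hbar scalerA -sE su0.
Qed.
End HserInverse.

(** Absence of hbar-torsion, in the form in which it is applied. It will be applied to U_hbar(h),
    where the coefficients of all the commutators live. *)
Definition kexp_regular (C : numFieldType) (V : lmodType (hser C)) :=
  forall (n : nat) (u v : V), (n > 0)%N ->
  (kexp (n%:R : C) - kexp (- n%:R)) *: u = (kexp n%:R - kexp (- n%:R)) *: v -> u = v.

Lemma hser_kexp_regular (C : numFieldType) (U : lmodType C) : kexp_regular (hser U).
Proof.
move=> n u v n0 uv; apply/eqP; rewrite -subr_eq0; apply/eqP.
apply: (@hserZ_reg _ _ (kexp (n%:R : C) - kexp (- n%:R))).
- by rewrite hserDE hserNE /kexp /hexp !expr0 subrr.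
- rewrite hserDE hserNE /kexp /hexp !expr1 invr1 !scale1r opprK.
  have -> : (n%:R + n%:R : C) = (n + n)%N%:R by rewrite natrD.
  by rewrite pnatr_eq0 addn_eq0 negb_and -lt0n n0.
by rewrite scalerBr uv subrr.
Qed.

(** * Coefficients of the commutators of Serre elements with the f_l *)

Section Lowering.
Variables (C : numFieldType) (V : lmodType (hser C)) (N m : nat).
Variables (K Ki kap : V).
Hypothesis Vreg : kexp_regular V.
Hypothesis kapE : (kexp N%:R - kexp (- N%:R)) *: kap = K - Ki.

Lemma iter_scale (U : lmodType (hser C)) (f : {linear U -> U}) c u n :
  f u = c *: u -> iter n f u = c ^+ n *: u.
Proof.
move=> fu; elim: n => [|n IHn]; first by rewrite scale1r.
by rewrite iterS IHn linearZ /= fu scalerA exprSr.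
Qed.

Lemma iter_linearZ (U : lmodType (hser C)) (f : {linear U -> U}) c u n :
  iter n f (c *: u) = c *: iter n f u.
Proof. by elim: n => //= n ->; rewrite linearZ. Qed.

Lemma iter_linearB (U : lmodType (hser C)) (f : {linear U -> U}) u v n :
  iter n f (u - v) = iter n f u - iter n f v.
Proof. by elim: n => //= n ->; rewrite linearB. Qed.

(* The commutator of the Serre element with f_j. *)
Lemma serre_coef_j (D : nat) (t : C) (s : {linear V -> V}) :
  (N > 0)%N -> s K = kexp t *: K -> s Ki = kexp (- t) *: Ki ->
  t = (D * m)%:R ->
  \sum_(k < m.+2) ((-1) ^+ k * qbinom C D m.+1 k) *: iter (m.+1 - k) s kap = 0.
Proof.
move=> N0 sK sKi tE; apply: (Vreg N0); rewrite scaler0 scaler_sumr.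
(* On an eigenvector of s the alternating sum is a value of [qpoch]; K and K^-1 have the eigenvalues
   q^m and q^-m for q = e^(hbar D), both leading to extreme zeros. *)
have E c (L : V) : s L = kexp c *: L -> qpoch D m.+1 (kexp (- c)) = 0 ->
    \sum_(k < m.+2) ((-1) ^+ k * qbinom C D m.+1 k) *: iter (m.+1 - k) s L = 0.
  move=> sL q0; transitivity ((kexp c ^+ m.+1 * qpoch D m.+1 (kexp (- c))) *: L).
    rewrite /qpoch mulr_sumr scaler_suml; apply: eq_bigr => k _.
    have -> : kexp c ^+ m.+1 = kexp c ^+ (m.+1 - k) * kexp c ^+ k.
      by rewrite -exprD subnK // -ltnS.
    have e1 : kexp c ^+ k * kexp (- c) ^+ k = 1 by rewrite -exprMn kexpVr expr1n.
    rewrite (iter_scale _ sL) scalerA; congr (_ *: _).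
    by move: e1; move: (kexp c ^+ k) (kexp (- c) ^+ k) => x y e1; ring: e1.
  by rewrite q0 mulr0 scale0r.
transitivity (\sum_(k < m.+2) (((-1) ^+ k * qbinom C D m.+1 k) *: iter (m.+1 - k) s K
   - ((-1) ^+ k * qbinom C D m.+1 k) *: iter (m.+1 - k) s Ki)).
  apply: eq_bigr => k _; rewrite -scalerBr -iter_linearB -kapE iter_linearZ.
  by rewrite !scalerA mulrC.
rewrite sumrB (E t K sK) ?(E (- t) Ki sKi) ?subr0 //.
  by rewrite opprK tE qpoch0p.
by rewrite tE qpoch0n.
Qed.

(** The coefficient in e^n f = f e^n + (kap_sum s n) e^(n-1), where kap = [e, f] and e u = s(u)
    e. *)
Definition kap_sum (s : {linear V -> V}) n : V := \sum_(t < n) iter t s kap.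

Lemma lowering_coefN n :
  qnum C N n.+1 * kexp (- (N * n)%:R) +
    (kexp N%:R - kexp (- N%:R)) * kexp (- (N * 2)%:R) ^+ n.+1 =
  qnum C N n.+2 * kexp (- (N * n.+1)%:R).
Proof.
rewrite /qnum !natrM -!mulNr -!kexpX -!exprM mul2n -addnn exprD !exprS.
have q1 := kexpVr (N%:R : C).
have x1 : kexp (N%:R : C) ^+ n * kexp (- N%:R) ^+ n = 1 by rewrite -exprMn q1 expr1n.
move: (kexp (N%:R : C)) (kexp (- N%:R : C)) (_ ^+ n) (_ ^+ n) q1 x1 => q qi x xi q1 x1.
ring: q1 x1.
Qed.

Lemma lowering_coefP n :
  qnum C N n.+1 * kexp (N * n)%:R +
    (kexp N%:R - kexp (- N%:R)) * kexp (N * 2)%:R ^+ n.+1 =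
  qnum C N n.+2 * kexp (N * n.+1)%:R.
Proof.
rewrite /qnum !natrM -!mulNr -!kexpX -!exprM mul2n -addnn exprD !exprS.
have q1 := kexpVr (N%:R : C).
have x1 : kexp (N%:R : C) ^+ n * kexp (- N%:R) ^+ n = 1 by rewrite -exprMn q1 expr1n.
move: (kexp (N%:R : C)) (kexp (- N%:R : C)) (_ ^+ n) (_ ^+ n) q1 x1 => q qi x xi q1 x1.
ring: q1 x1.
Qed.

(** The sl_2 formula for [e^(n+1), f]: geometric sums of the powers of q^-2 and q^2, kept free of
    denominators by multiplying twice by q - q^-1, once for kap and once for the q-number. *)
Lemma kap_sumE (s : {linear V -> V}) n :
  s K = kexp (- (N * 2)%:R) *: K -> s Ki = kexp (N * 2)%:R *: Ki ->
  (kexp N%:R - kexp (- N%:R)) *: ((kexp N%:R - kexp (- N%:R)) *: kap_sum s n.+1) =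
  qnum C N n.+1 *: (kexp (- (N * n)%:R) *: K - kexp (N * n)%:R *: Ki).
Proof.
move=> sK sKi; elim: n => [|n IHn].
  by rewrite /kap_sum big_ord1 /= kapE /qnum muln1 muln0 oppr0 kexp0 !scale1r.
rewrite /kap_sum big_ord_recr /= -/(kap_sum s n.+1) !scalerDr IHn.
rewrite -[s (iter n s kap)]/(iter n.+1 s kap) -iter_linearZ kapE iter_linearB.
rewrite (iter_scale _ sK) (iter_scale _ sKi) !scalerBr !scalerA addrACA -opprD.
by rewrite -!scalerDl lowering_coefN lowering_coefP scalerN scalerA.
Qed.

(* The commutator of the Serre element with f_i. *)
Lemma serre_coef_i (s s' : {linear V -> V}) p : (N > 0)%N ->
  s K = kexp (- (N * 2)%:R) *: K -> s Ki = kexp (N * 2)%:R *: Ki ->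
  s' K = kexp (N * m)%:R *: K -> s' Ki = kexp (- (N * m)%:R) *: Ki ->
  (p <= m)%N ->
  qbinom C N m.+1 p *: kap_sum s (m.+1 - p) =
  qbinom C N m.+1 p.+1 *: iter (m - p) s (s' (kap_sum s p.+1)).
Proof.
(* After restoring the two factors q - q^-1 of [kap_sumE], both sides are multiples of one vector,
   and the scalars agree by [qbinom_absorb]. *)
move=> N0 sK sKi s'K s'Ki le_pm; do 2 apply: (Vreg N0).
set dl := kexp _ - kexp _.
have SL c u : iter (m - p) s (s' (c *: u)) = c *: iter (m - p) s (s' u).
  by rewrite linearZ iter_linearZ.
have B : dl *: (dl *: iter (m - p) s (s' (kap_sum s p.+1))) =
    qnum C N p.+1 *: (kexp (- (N * (m - p))%:R) *: K - kexp (N * (m - p))%:R *: Ki).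
  rewrite -!SL kap_sumE // SL; congr (_ *: _).
  rewrite linearB [s' (_ *: K)]linearZ [s' (_ *: Ki)]linearZ /= s'K s'Ki iter_linearB !iter_linearZ.
  rewrite (iter_scale _ sK) (iter_scale _ sKi) !scalerA !kexpX -!kexpD.
  by congr (kexp _ *: _ - kexp _ *: _); rewrite !natrM natrB //; ring.
have Z c (u : V) : dl *: (dl *: (c *: u)) = c *: (dl *: (dl *: u)).
  by rewrite !scalerA mulrC mulrA.
rewrite !Z B subSn // kap_sumE // scalerA [RHS]scalerA; congr (_ *: _).
by rewrite -subSn // qbinom_absorb.
Qed.

End Lowering.

Lemma iter_linear (R : pzRingType) (U : lmodType R) (e : {linear U -> U}) n : linear (iter n e).
Proof. by elim: n => // n IHn c u v; rewrite !iterS IHn linearP. Qed.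

Lemma iter_linearD (R : pzRingType) (U : lmodType R) (e : {linear U -> U}) n x y :
  iter n e (x + y) = iter n e x + iter n e y.
Proof. by elim: n => //= n ->; rewrite linearD. Qed.

(** * Serre elements as operators *)

Section SerreOp.
Variables (C : numFieldType) (r : nat) (a : 'M[int]_r) (d : 'I_r -> nat).
Variables (M : lmodType (hser C)).

Definition serre_op (e : 'I_r -> M -> M) i j (x : M) : M :=
  \sum_(k < `|1 - a i j|.+1)
    ((-1) ^+ k * qbinom C (d i) `|1 - a i j| k) *:
      iter (`|1 - a i j| - k) (e i) (e j (iter k (e i) x)).

(** It agrees with [serre_op] up to sign by the symmetry of Gaussian binomials; keeping both forms
    avoids proving that symmetry. It appears when products are reversed, by right multiplications,
    by chi_+ and chi_-, or by words. *)
Definition serre_op_rev (e : 'I_r -> M -> M) i j (x : M) : M :=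
  \sum_(k < `|1 - a i j|.+1)
    ((-1) ^+ k * qbinom C (d i) `|1 - a i j| k) *:
      iter k (e i) (e j (iter (`|1 - a i j| - k) (e i) x)).

(** What the arguments on the quantum group take from Lie theory. *)
Record cartan_datum : Prop := CartanDatum {
  cartan_diag : forall i, a i i = 2;
  cartan_off : forall i j, i != j -> a i j <= 0;
  cartan_symm : forall i j, (d i)%:Z * a i j = (d j)%:Z * a j i;
  cartan_pos : forall i, (0 < d i)%N }.

Hypothesis dat : cartan_datum.

Lemma iter_commute (T : Type) (f g : T -> T) n x :
  (forall y, f (g y) = g (f y)) -> iter n f (g x) = g (iter n f x).
Proof. by move=> fg; elim: n => //= n ->. Qed.

Section Commute.
Variables (V : lmodType (hser C)) (Vreg : kexp_regular V) (e f : 'I_r -> {linear M -> M}).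
Variables (act : V -> M -> M) (s : 'I_r -> {linear V -> V}).
Variables (K Ki kap : 'I_r -> V).
Hypothesis act_linear : forall x, linear (act^~ x).
Hypothesis e_act : forall i u x, e i (act u x) = act (s i u) (e i x).
Hypothesis e_f : forall i l x,
  e i (f l x) = f l (e i x) + (if i == l then act (kap i) x else 0).
Hypothesis s_K : forall i j, s i (K j) = kexp (- ((d j)%:Z * a j i)%:~R) *: K j.
Hypothesis s_Ki : forall i j, s i (Ki j) = kexp ((d j)%:Z * a j i)%:~R *: Ki j.
Hypothesis kapE : forall i,
  (kexp (d i)%:R - kexp (- (d i)%:R)) *: kap i = K i - Ki i.

Lemma e_f_neq i l x : i != l -> e i (f l x) = f l (e i x).
Proof. by move=> /negbTE nil; rewrite e_f nil addr0. Qed.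

Lemma act_at0 x : act 0 x = 0.
Proof. exact: linear_at0 (act_linear x). Qed.

Lemma actD u v x : act (u + v) x = act u x + act v x.
Proof. by rewrite -[u in LHS]scale1r act_linear scale1r. Qed.

Lemma actZ c u x : act (c *: u) x = c *: act u x.
Proof. by rewrite -[_ *: u in LHS]addr0 act_linear act_at0 addr0. Qed.

Lemma iter_e_act i n u x : iter n (e i) (act u x) = act (iter n (s i) u) (iter n (e i) x).
Proof. by elim: n => //= n ->; rewrite e_act. Qed.

Lemma iter_e_f i n x : iter n (e i) (f i x) =
  f i (iter n (e i) x) + act (kap_sum (kap i) (s i) n) (iter n.-1 (e i) x).
Proof.
elim: n => [|n IHn]; first by rewrite /kap_sum big_ord0 act_at0 addr0.
rewrite iterS IHn linearD /= e_f eqxx e_act -addrA; congr (_ + _).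
case: n {IHn} => [|n] /=.
  by rewrite /kap_sum big_ord1 big_ord0 linear0 act_at0 addr0.
rewrite -actD; congr act; rewrite /kap_sum [RHS]big_ord_recl linear_sum.
by congr (_ + _); apply: eq_bigr => t _; rewrite lift0.
Qed.

(** For l different from i and j the terms commute one by one; for l = j the powers of e_i collect
    into [serre_coef_j]; for l = i the sum telescopes by [serre_coef_i]. The operators are abstract
    because e and f exchange their roles in a second application. *)
Lemma serre_comm i j l x : i != j ->
  serre_op (fun i => e i) i j (f l x) = f l (serre_op (fun i => e i) i j x).
Proof.
move=> nij; rewrite /serre_op linear_sum.
have [n aij] : exists n : nat, a i j = - n%:Z.
  by have := cartan_off dat nij; exists `|a i j|%N; lia.
have -> : `|1 - a i j|%N = n.+1 by rewrite aij; lia.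
(* The symmetry of d_i a_ij turns the weight of K_j under e_i into a power of q_i, the parameter of
   the binomials, with the exponent n = -a_ij of an extreme zero. *)
have sK_ij : - ((d j)%:Z * a j i)%:~R = (d i * n)%N%:R :> C.
  by rewrite -(cartan_symm dat) aij mulrN rmorphN opprK -PoszM.
have sK_ji : - ((d i)%:Z * a i j)%:~R = (d i * n)%N%:R :> C.
  by rewrite aij mulrN rmorphN opprK -PoszM.
have sK_ii : ((d i)%:Z * a i i)%:~R = (d i * 2)%N%:R :> C.
  by rewrite (cartan_diag dat) -PoszM.
have [<-{l}|nil] := eqVneq i l; last first.
  have [<-{l nil}|njl] := eqVneq j l; last first.
    apply: eq_bigr => k _; rewrite [RHS]linearZ; congr (_ *: _).
    rewrite (iter_commute k _ (fun y => e_f_neq y nil)) e_f_neq //.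
    exact: iter_commute (fun y => e_f_neq y nil).
  apply/eqP; rewrite -subr_eq0 -sumrB; apply/eqP.
  transitivity (\sum_(k < n.+2) act (((-1) ^+ k * qbinom C (d i) n.+1 k) *:
      iter (n.+1 - k) (s i) (kap j)) (iter n.+1 (e i) x)).
    apply: eq_bigr => k _; rewrite [X in _ - X]linearZ -scalerBr actZ; congr (_ *: _).
    rewrite (iter_commute k _ (fun y => e_f_neq y nij)) e_f eqxx iter_linearD.
    rewrite (iter_commute _ _ (fun y => e_f_neq y nij)) addrAC subrr add0r iter_e_act.
    by rewrite -iterD subnK // -ltnS.
  pose phi u := act u (iter n.+1 (e i) x).
  have phiL : linear phi := act_linear _.
  rewrite -(linear_sum (mk_linear phiL)) /=.
  rewrite (serre_coef_j Vreg (kapE j) (cartan_pos dat j) _ _ erefl) /phi ?act_at0 //.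
    by rewrite s_K sK_ij.
  by rewrite s_Ki -sK_ij opprK.
apply/eqP; rewrite -subr_eq0 -sumrB; apply/eqP.
pose c k := (-1) ^+ k * qbinom C (d i) n.+1 k.
(* A k comes from moving f_i through the left power of e_i, B k from moving it through the right
   power. A k and B (k+1) carry the same monomial e_i^(n-k) e_j e_i^k and cancel, while A (n+1) and
   B 0 vanish. *)
pose A k := c k *: act (kap_sum (kap i) (s i) (n.+1 - k))
  (iter (n.+1 - k).-1 (e i) (e j (iter k (e i) x))).
pose B k := c k *: act (iter (n.+1 - k) (s i) (s j (kap_sum (kap i) (s i) k)))
  (iter (n.+1 - k) (e i) (e j (iter k.-1 (e i) x))).
transitivity (\sum_(k < n.+2) (A k + B k)).
  apply: eq_bigr => k _; rewrite [X in _ - X]linearZ -scalerBr /A /B -scalerDr; congr (_ *: _).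
  rewrite iter_e_f linearD iter_linearD e_act iter_e_act addrAC; congr (_ + _).
  by rewrite e_f_neq 1?eq_sym // iter_e_f addrAC subrr add0r.
rewrite big_split /= big_ord_recr [X in _ + X]big_ord_recl /=.
rewrite [A n.+1](_ : _ = 0) ?addr0; last first.
  by rewrite /A subnn /kap_sum big_ord0 act_at0 scaler0.
rewrite [B 0](_ : _ = 0) ?add0r; last first.
  rewrite /B /kap_sum big_ord0 !linear0 -[iter _ _ 0]addr0.
  by rewrite (linear_at0 (iter_linear (s i) _)) addr0 act_at0 scaler0.
rewrite -big_split big1 // => p _; rewrite /bump leq0n add1n /A /B.
have le_pn : (p <= n)%N by rewrite -ltnS.
have -> : (n.+1 - p).-1 = (n - p)%N by rewrite subSn.
rewrite subSS /= -!actZ -actD /c exprS mulN1r mulNr scaleNr -!scalerA -scalerBr.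
rewrite (@serre_coef_i _ _ (d i) n _ _ _ Vreg (kapE i) (s i) (s j) p (cartan_pos dat i)) //.
- by rewrite subrr scaler0 act_at0.
- by rewrite s_K sK_ii.
- by rewrite s_Ki sK_ii.
- by rewrite s_K sK_ji.
by rewrite s_Ki -sK_ji opprK.
Qed.
End Commute.
End SerreOp.

(** * The Cartan part *)

Section CartanPart.
Variables (C : numFieldType) (r : nat).
Local Notation uh := (uh C r).

Lemma mpolyX_word (m : 'X_{1..r}) :
  exists w : seq 'I_r, 'X_[C, m] = \prod_(i <- w) 'X_i.
Proof.
rewrite mpolyXE_id; elim/big_ind: _ => [|p q [w1 ->] [w2 ->]|i _].
- by exists [::]; rewrite big_nil.
- by exists (w1 ++ w2); rewrite big_cat.
by exists (nseq (m i) i); rewrite big_nseq iter_mulr_1.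
Qed.

Definition uconst (p : mpoly r C) : uh := hconst p.

Lemma uconstL c p q : uconst (c *: p + q) = hconst c *: uconst p + uconst q.
Proof.
have H : hconst (c *: p + q) = hconst c *: hconst p + hconst q :> hser (mpoly r C).
  by rewrite hconstD hconst_is_linear.
exact: H.
Qed.

Lemma uconstM p q : uconst (p * q) = uconst p * uconst q.
Proof. exact: hconstM. Qed.

Lemma uconst0 : uconst 0 = 0. Proof. exact: hconst0. Qed.

Lemma uconst1 : uconst 1 = 1. Proof. exact: hconst1. Qed.

(** Agreement on polynomials settles the constant term, and coinduction does the rest. *)
Lemma uh_monomial_ext (V : lmodType (hser C)) (Vsep : hseparated V) (f g : uh -> V) :
  linear f -> linear g ->
  (forall m, f (uconst 'X_[m]) = g (uconst 'X_[m])) -> f =1 g.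
Proof.
move=> fL gL fgm; apply: (hsep_coind2 Vsep (sh := fun u => hquo u)) => u.
have fgc (p : mpoly r C) : f (uconst p) = g (uconst p).
  rewrite (mpolyE p); elim: (msupp p) => [|m s IHs].
    by rewrite big_nil uconst0 (linear_at0 fL) (linear_at0 gL).
  by rewrite big_cons uconstL fL gL IHs fgm.
have E : u = hbar C *: (hquo u : uh) + uconst (u 0%N) by rewrite addrC -hser_split.
have fE : f u = hbar C *: f (hquo u) + f (uconst (u 0%N)) by rewrite {1}E fL.
have gE : g u = hbar C *: g (hquo u) + g (uconst (u 0%N)) by rewrite {1}E gL.
by rewrite fE gE fgc opprD addrACA subrr addr0 scalerBr.
Qed.

Lemma uh_word_ext (V : lmodType (hser C)) (Vsep : hseparated V) (f g : uh -> V) :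
  linear f -> linear g -> (forall w, f (uh_word C w) = g (uh_word C w)) -> f =1 g.
Proof.
move=> fL gL fgw; apply: (uh_monomial_ext Vsep fL gL) => m.
by have [w ->] := mpolyX_word m; apply: fgw.
Qed.

Lemma uh_word_cons i w : @uh_word C r (i :: w) = uconst 'X_i * uh_word C w.
Proof. by rewrite /uh_word big_cons; exact: uconstM. Qed.

Lemma uh_word0 : @uh_word C r [::] = 1.
Proof. by rewrite /uh_word big_nil; exact: uconst1. Qed.

Section Shift.
Variable lam : 'I_r -> C.

Definition pshift : mpoly r C -> mpoly r C :=
  mmap (@mpolyC r C) (fun j => 'X_j + (lam j)%:MP).

HB.instance Definition _ := GRing.RMorphism.on pshift.

Lemma pshiftZ c p : pshift (c *: p) = c *: pshift p.
Proof. by rewrite /pshift mmapZ mul_mpolyC. Qed.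

Lemma pshiftX i : pshift 'X_i = 'X_i + (lam i)%:MP.
Proof. by rewrite /pshift mmapX mmap1U. Qed.

Definition ushift (u : uh) : uh := fun n => pshift (u n).

Lemma ushift_linear : linear ushift.
Proof.
move=> c u v; apply: funext => n.
rewrite /ushift !hserDE !hserZE rmorphD rmorph_sum; congr (_ + _).
by apply: eq_bigr => i _; rewrite -pshiftZ.
Qed.
HB.instance Definition _ :=
  GRing.isLinear.Build (hser C) uh uh *:%R ushift ushift_linear.

Lemma ushiftM u v : ushift (u * v) = ushift u * ushift v.
Proof.
apply: funext => n; rewrite /ushift !hserME rmorph_sum.
by apply: eq_bigr => i _; rewrite rmorphM.
Qed.

Lemma ushift_const p : ushift (uconst p) = uconst (pshift p).
Proof. by apply: funext => -[|n] //; rewrite /ushift /= rmorph0. Qed.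

Lemma ushift1 : ushift 1 = 1.
Proof. by rewrite -uconst1 ushift_const rmorph1. Qed.

Lemma ushift_hexp p : ushift (hexp p) = hexp (pshift p).
Proof. by apply: funext => n; rewrite /ushift /hexp pshiftZ rmorphXn. Qed.

Lemma hexpCE (c : C) n : hexp (c%:MP : mpoly r C) n = (kexp c n)%:MP.
Proof. by rewrite /kexp /hexp -rmorphXn /= -mul_mpolyC -mpolyCM. Qed.

Lemma hexpCD (c : C) (p : mpoly r C) : hexp (c%:MP + p) = kexp c *: hexp p.
Proof.
rewrite hexpD; last by rewrite /GRing.comm mulrC.
apply: funext => n; rewrite hserME hserZE; apply: eq_bigr => i _.
by rewrite hexpCE mul_mpolyC.
Qed.

Lemma ushift_exp x :
  ushift (uh_exp x) = kexp (\sum_i x 0 i * lam i) *: uh_exp x.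
Proof.
rewrite /uh_exp ushift_hexp.
have -> : pshift (hlin x) = (\sum_i x 0 i * lam i)%:MP + hlin x.
  rewrite /hlin rmorph_sum raddf_sum -big_split; apply: eq_bigr => i _ /=.
  by rewrite pshiftZ pshiftX scalerDr addrC; congr (_ + _); rewrite -mul_mpolyC -mpolyCM.
exact: hexpCD.
Qed.
End Shift.

Lemma uh_sep : hseparated uh.
Proof. exact: (@hser_sep C (mpoly r C)). Qed.

Lemma uh_regular : kexp_regular uh.
Proof. exact: (@hser_kexp_regular C (mpoly r C)). Qed.

Lemma ushift_ext (f g : uh -> uh) : linear f -> linear g -> f 1 = g 1 ->
  (forall i u, f (uconst 'X_i * u) = f (uconst 'X_i) * f u) ->
  (forall i u, g (uconst 'X_i * u) = g (uconst 'X_i) * g u) ->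
  (forall i, f (uconst 'X_i) = g (uconst 'X_i)) -> f =1 g.
Proof.
move=> fL gL fg1 fM gM fgX; apply: (uh_word_ext uh_sep) => //.
by elim=> [|i w IHw]; rewrite ?uh_word0 // uh_word_cons fM gM fgX IHw.
Qed.

Lemma ushift_comp lam mu u :
  ushift lam (ushift mu u) = ushift (fun i => lam i + mu i) u.
Proof.
move: u; apply: ushift_ext.
- by move=> c u v; rewrite !linearP.
- exact: linearP.
- by rewrite !ushift1.
- by move=> i u; rewrite !ushiftM.
- by move=> i u; rewrite !ushiftM.
move=> i; rewrite !ushift_const !pshiftX rmorphD /= pshiftX.
rewrite /pshift mmapC -addrA; congr (uconst (_ + _)).
by rewrite -mpolyCD.
Qed.

Lemma ushift0 lam u : (forall i, lam i = 0) -> ushift lam u = u.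
Proof.
move=> lam0; move: u; apply: (@ushift_ext _ id).
- exact: linearP.
- by [].
- by rewrite !ushift1.
- by move=> i u; rewrite !ushiftM.
- by [].
by move=> i; rewrite ushift_const pshiftX lam0 addr0.
Qed.

Lemma ushiftK lam u : ushift (fun i => - lam i) (ushift lam u) = u.
Proof. by rewrite ushift_comp ushift0 // => i; rewrite addNr. Qed.

Lemma ushiftNK lam u : ushift lam (ushift (fun i => - lam i) u) = u.
Proof. by rewrite ushift_comp ushift0 // => i; rewrite subrr. Qed.
End CartanPart.

(** * The elements K_i, the value of [e_i, f_i] and the weights *)

Section CartanElements.
Variables (C : numFieldType) (r : nat) (a : 'M[int]_r) (d : 'I_r -> nat).
Local Notation uh := (uh C r).
Local Notation gH i := (inr i : uq_index r).
Local Notation H0 i := (@free_gen C (uq_index r) (gH i)).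

Definition uhK (i : 'I_r) : uh := hexp ((d i)%:R *: 'X_i : mpoly r C).
Definition uhKi (i : 'I_r) : uh := hexp (- (d i)%:R *: 'X_i : mpoly r C).

Definition hser_recip (s : hser C) : hser C :=
  if pselect (exists t, t * s = 1) is left e then projT1 (cid e) else 0.

Lemma hser_recipP s : s 0%N != 0 -> hser_recip s * s = 1.
Proof.
move=> s0; rewrite /hser_recip; case: pselect => [e|]; first by case: (cid e).
by move=> ns; case: ns; exact: hser_inv.
Qed.

(** (q_i - q_i^-1) / hbar, a unit for d_i > 0 because its constant term is 2 d_i. *)
Definition qunit (i : 'I_r) : hser C :=
  hquo (kexp (d i)%:R - kexp (- (d i)%:R)).

(** (K_i - K_i^-1) / (q_i - q_i^-1), the value of [e_i, f_i], with numerator and denominator both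
    divided by hbar. *)
Definition uhkap (i : 'I_r) : uh :=
  hser_recip (qunit i) *: (hquo (uhK i - uhKi i) : uh).

Lemma qunitE i : kexp (d i)%:R - kexp (- (d i)%:R) = hbar C * qunit i.
Proof.
apply: esym; apply: (@hbarZ_hquo C C^o).
by rewrite hserDE hserNE /kexp /hexp !expr0 subrr.
Qed.

Lemma hser_recip_qunit i : (0 < d i)%N -> hser_recip (qunit i) * qunit i = 1.
Proof.
move=> d0; apply: hser_recipP.
rewrite /qunit /hquo hserDE hserNE /kexp /hexp !expr1 invr1 !scale1r opprK.
have -> : ((d i)%:R + (d i)%:R : C) = (d i + d i)%N%:R by rewrite natrD.
by rewrite pnatr_eq0 addn_eq0 negb_and -lt0n d0.
Qed.

Lemma uhkapE i : (0 < d i)%N ->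
  (kexp (d i)%:R - kexp (- (d i)%:R)) *: uhkap i = uhK i - uhKi i.
Proof.
move=> d0; rewrite /uhkap scalerA qunitE -mulrA [qunit i * _]mulrC.
rewrite hser_recip_qunit // mulr1.
apply: (@hbarZ_hquo C (mpoly r C)).
by rewrite hserDE hserNE /uhK /uhKi /hexp !expr0 subrr.
Qed.

Lemma uhkap_unit i : (0 < d i)%N -> qunit i *: uhkap i = hquo (uhK i - uhKi i).
Proof.
by move=> d0; rewrite /uhkap scalerA [qunit i * _]mulrC hser_recip_qunit // scale1r.
Qed.

(** The sign is chosen so that e_i u = (ushift (wt i) u) e_i; equivalently u f_i = f_i (ushift (wt
    i) u). *)
Definition wt (i k : 'I_r) : C := - (a k i)%:~R.

Lemma ushift_hexpX lam c (i : 'I_r) :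
  ushift lam (hexp (c *: 'X_i : mpoly r C) : uh) =
  kexp (c * lam i) *: (hexp (c *: 'X_i : mpoly r C) : uh).
Proof.
rewrite ushift_hexp pshiftZ pshiftX scalerDr addrC.
by rewrite -[c *: _%:MP]mul_mpolyC -mpolyCM; exact: hexpCD.
Qed.

Lemma ushift_K i j :
  ushift (wt i) (uhK j) = kexp (- ((d j)%:Z * a j i)%:~R) *: uhK j.
Proof. by rewrite ushift_hexpX /wt mulrN rmorphM /= -pmulrn. Qed.

Lemma ushift_Ki i j :
  ushift (wt i) (uhKi j) = kexp ((d j)%:Z * a j i)%:~R *: uhKi j.
Proof. by rewrite ushift_hexpX /wt mulrNN rmorphM /= -pmulrn. Qed.

Lemma ushiftV_K i j : ushift (fun k => - wt i k) (uhK j) =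
  kexp ((d j)%:Z * a j i)%:~R *: uhK j.
Proof. by rewrite ushift_hexpX /wt opprK rmorphM /= -pmulrn. Qed.

Lemma ushiftV_Ki i j : ushift (fun k => - wt i k) (uhKi j) =
  kexp (- ((d j)%:Z * a j i)%:~R) *: uhKi j.
Proof. by rewrite ushift_hexpX /wt opprK mulNr rmorphM /= -pmulrn. Qed.

Definition uh_hfree (u : uh) : hfree C (uq_index r) := fun n => uh_lift (u n).

Lemma uh_hfree_linear : linear uh_hfree.
Proof.
move=> c u v; apply: funext => n.
rewrite hserDE /uh_hfree !hserDE !hserZE /uh_lift raddfD raddf_sum /=; congr (_ + _).
by apply: eq_bigr => i _; rewrite mmapZ /= mulr_algl.
Qed.

Lemma uh_hfree_const p : uh_hfree (uconst p) = hconst (uh_lift p).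
Proof. by apply: funext => -[|n]; rewrite /uh_hfree //= /uh_lift raddf0. Qed.

Lemma uh_liftX m : uh_lift 'X_[m] = \prod_(i < r) H0 i ^+ m i.
Proof. by rewrite /uh_lift mmapX. Qed.

Lemma uh_lift_expX c i n : uh_lift ((c *: 'X_i) ^+ n) = (c *: H0 i) ^+ n.
Proof.
rewrite exprZn /uh_lift mmapZ /= mulr_algl exprZn; congr (_ *: _).
rewrite mpolyXn mmapX /mmap1.
transitivity (\prod_(j < r) (if j == i then H0 j ^+ n else 1)).
  apply: eq_bigr => j _; rewrite mulmnE mnm1E eq_sym.
  by case: eqP => _; rewrite ?mul1n ?mul0n ?expr0.
by rewrite -big_mkcond big_pred1_eq.
Qed.

Lemma uh_hfree_hexp c i :
  uh_hfree (hexp (c *: 'X_i : mpoly r C)) = hexp (c *: H0 i).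
Proof.
apply: funext => n; rewrite /uh_hfree /hexp -uh_lift_expX /uh_lift.
by rewrite mmapZ /= mulr_algl.
Qed.

Lemma uh_hfree_quoK i : uh_hfree (hquo (uhK i - uhKi i)) =
  hquo (hexp ((d i)%:R *: H0 i) - hexp (- (d i)%:R *: H0 i)).
Proof.
apply: funext => n; rewrite /uh_hfree /hquo !hserDE !hserNE /uh_lift raddfB.
congr (_ - _).
  exact: (congr1 (fun f : hfree _ _ => f n.+1) (uh_hfree_hexp (d i)%:R i)).
exact: (congr1 (fun f : hfree _ _ => f n.+1) (uh_hfree_hexp (- (d i)%:R) i)).
Qed.

Section CartanAction.
Variables (M : lmodType (hser C)) (Msep : hseparated M).
Variables (S : (nat -> M) -> M) (SP : hsummation S).
Variables (op : uq_index r -> {linear M -> M}) (act : uh -> M -> M).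
Hypothesis act_linear : forall x, linear (act^~ x).
Hypothesis act1 : forall x, act 1 x = x.
Hypothesis actM : forall u v x, act (u * v) x = act u (act v x).
Hypothesis op_act : forall i x, op (gH i) x = act (uconst 'X_i) x.

Lemma hfree_act_uh u x : hfree_act S op (uh_hfree u) x = act u x.
Proof.
move: u; apply: (uh_monomial_ext Msep) => [c u v||m].
- by rewrite uh_hfree_linear hfree_actD // hfree_actZ.
- exact: act_linear.
rewrite uh_hfree_const hfree_act_const // uh_liftX mpolyXE_id.
move: x; elim: (index_enum _) => [|i s IHs] x.
  by rewrite !big_nil -(hfree_act_const Msep SP) hconst1 hfree_act1 // uconst1 act1.
rewrite !big_cons free_actM uconstM actM IHs.
elim: (m i) (act _ _) => [|n IHn] y.
  by rewrite !expr0 -(hfree_act_const Msep SP) hconst1 hfree_act1 // uconst1 act1.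
rewrite !exprS free_actM uconstM actM IHn.
by rewrite free_genE free_act_word /= op_act.
Qed.
End CartanAction.
End CartanElements.

(** * Functions on words *)

Definition wmod (C : numFieldType) (r : nat) (P : lmodType (hser C)) : Type :=
  seq 'I_r -> {linear uh C r -> P}.

Section WmodLmod.
Variables (C : numFieldType) (r : nat) (P : lmodType (hser C)).
Local Notation uh := (uh C r).
Local Notation W := (wmod r P).

HB.instance Definition _ := gen_eqMixin W.
HB.instance Definition _ := gen_choiceMixin W.

Lemma wmod_ext (g g' : W) : (forall w h, g w h = g' w h) -> g = g'.
Proof.
move=> gg'; apply: funext => w; move: (gg' w).
case: (g w) (g' w) => [f [[f1] [f2]]] [f' [[g1] [g2]]] /= /funext eq_ff'.
move: g1 g2; rewrite -eq_ff' => g1 g2.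
by rewrite (Prop_irrelevance g1 f1) (Prop_irrelevance g2 f2).
Qed.

Definition wmod_zero : W := fun=> (\0 : uh -> P).
Definition wmod_opp (g : W) : W := fun w => \- g w.
Definition wmod_add (g g' : W) : W := fun w => g w \+ g' w.
Definition wmod_scale (c : hser C) (g : W) : W := fun w => c \*: g w.

Fact wmod_addA : associative wmod_add.
Proof. by move=> g1 g2 g3; apply: wmod_ext => w h; apply: addrA. Qed.
Fact wmod_addC : commutative wmod_add.
Proof. by move=> g1 g2; apply: wmod_ext => w h; apply: addrC. Qed.
Fact wmod_add0 : left_id wmod_zero wmod_add.
Proof. by move=> g; apply: wmod_ext => w h; apply: add0r. Qed.
Fact wmod_addN : left_inverse wmod_zero wmod_opp wmod_add.
Proof. by move=> g; apply: wmod_ext => w h; apply: addNr. Qed.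
HB.instance Definition _ := GRing.isZmodule.Build W
  wmod_addA wmod_addC wmod_add0 wmod_addN.

Fact wmod_scaleA c1 c2 g : wmod_scale c1 (wmod_scale c2 g) = wmod_scale (c1 * c2) g.
Proof. by apply: wmod_ext => w h; apply: scalerA. Qed.
Fact wmod_scale1 : left_id 1 wmod_scale.
Proof. by move=> g; apply: wmod_ext => w h; apply: scale1r. Qed.
Fact wmod_scaleDr : right_distributive wmod_scale +%R.
Proof. by move=> c g1 g2; apply: wmod_ext => w h; apply: scalerDr. Qed.
Fact wmod_scaleDl g : {morph wmod_scale^~ g : c1 c2 / c1 + c2}.
Proof. by move=> c1 c2; apply: wmod_ext => w h; apply: scalerDl. Qed.
HB.instance Definition _ := GRing.Zmodule_isLmodule.Build (hser C) W
  wmod_scaleA wmod_scale1 wmod_scaleDr wmod_scaleDl.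

Lemma wmodDE (g g' : W) w h : (g + g') w h = g w h + g' w h. Proof. by []. Qed.
Lemma wmodZE c (g : W) w h : (c *: g) w h = c *: g w h. Proof. by []. Qed.
Lemma wmod0E w h : (0 : W) w h = 0. Proof. by []. Qed.

Lemma wmod_sumE (I : Type) (s : seq I) (F : I -> W) w h :
  (\sum_(i <- s) F i) w h = \sum_(i <- s) F i w h.
Proof. by elim: s => [|i s IHs]; rewrite ?big_nil // !big_cons wmodDE IHs. Qed.

Hypothesis Psep : hseparated P.
Variables (S : (nat -> P) -> P).
Hypothesis SP : hsummation S.

Lemma wmod_sep : hseparated W.
Proof.
move=> g gsep; apply: wmod_ext => w h; apply: Psep => n.
by have [g' ->] := gsep n; exists (g' w h).
Qed.

Lemma wmod_sum_linear (p : nat -> W) w : linear (fun h => S (fun n => p n w h)).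
Proof.
move=> c u v; rewrite -(hsum_linear Psep SP).
by congr S; apply: funext => n; rewrite linearP.
Qed.

Definition wmod_sum (p : nat -> W) : W := fun w => mk_linear (wmod_sum_linear p w).

Lemma wmod_sumP : hsummation wmod_sum.
Proof. by move=> p; apply: wmod_ext => w h; exact: SP. Qed.
End WmodLmod.

Lemma linear_serre_op (C : numFieldType) r (a : 'M[int]_r) d (M : lmodType (hser C))
    (e : 'I_r -> {linear M -> M}) i j : linear (serre_op a d (fun i => e i) i j).
Proof.
move=> c x y; rewrite /serre_op scaler_sumr -big_split; apply: eq_bigr => k _ /=.
by rewrite iter_linear linearP iter_linear scalerDr !scalerA mulrC.
Qed.

Lemma ushiftC (C : numFieldType) r (l m : 'I_r -> C) u :
  ushift l (ushift m u) = ushift m (ushift l u).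
Proof. by rewrite !ushift_comp; congr ushift; apply: funext => i; rewrite addrC. Qed.

(** * Right translations of functions by the generators *)

Section Operators.
Variables (C : numFieldType) (r : nat) (a : 'M[int]_r) (d : 'I_r -> nat).
Local Notation uh := (uh C r).
Hypothesis dat : cartan_datum a d.
Variables (P : lmodType (hser C)) (xm : 'I_r -> {linear P -> P}).
Local Notation W := (wmod r P).
Local Notation sg i := (ushift (wt C a i)).
Local Notation sgV i := (ushift (fun k => - wt C a i k)).

(** E_w u = (wshift w u) E_w. The same shift moves u to the right through a product of f_i, see
    [emb_Fword]. *)
Fixpoint wshift (w : seq 'I_r) (u : uh) : uh :=
  if w is j :: w' then wshift w' (sg j u) else u.

Lemma wshift_linear w : linear (wshift w).
Proof. by elim: w => //= j w IHw c u v; rewrite linearP IHw. Qed.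

Lemma wshiftM w u v : wshift w (u * v) = wshift w u * wshift w v.
Proof. by elim: w u v => //= j w IHw u v; rewrite ushiftM IHw. Qed.

Lemma wshift1 w : wshift w 1 = 1.
Proof. by elim: w => //= j w; rewrite ushift1. Qed.

(* g w h is the value at h E_w of a function on the quantum group, where
   E_(j :: w) = E_w e_j; thus wE j is the right translation by e_j, and wH u
   and wF i those by u and f_i. *)
Definition wE (i : 'I_r) (g : W) : W := fun w => g (i :: w).

Lemma wH_fun_linear u (g : W) w : linear (fun h => g w (h * wshift w u)).
Proof. by move=> c h h'; rewrite mulrDl -scalerAl linearP. Qed.

Definition wH (u : uh) (g : W) : W := fun w => mk_linear (wH_fun_linear u g w).

(** Dictated by h E_w e_j f_i = h E_w f_i e_j + h E_w [e_j, f_i] and, at the empty word, by h f_i =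
    f_i h' with h' the shift of h, a left factor f_i acting on values through [xm i]. *)
Fixpoint wF_fun (i : 'I_r) (g : W) (w : seq 'I_r) : {linear uh -> P} :=
  if w is j :: w' then
    wF_fun i (wE j g) w' \+ (if j == i then wH (uhkap C d i) g w' else \0)
  else xm i \o (g [::] \o sg i).

Definition wF (i : 'I_r) (g : W) : W := wF_fun i g.

Lemma wE_linear i : linear (wE i).
Proof. by move=> c g g'; apply: wmod_ext. Qed.
HB.instance Definition _ i :=
  GRing.isLinear.Build (hser C) W W *:%R (wE i) (wE_linear i).

Lemma wH_linear u : linear (wH u).
Proof. by move=> c g g'; apply: wmod_ext. Qed.
HB.instance Definition _ u :=
  GRing.isLinear.Build (hser C) W W *:%R (wH u) (wH_linear u).

Lemma wH_linearl g : linear (wH^~ g).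
Proof.
move=> c u v; apply: wmod_ext => w h.
by rewrite wmodDE wmodZE /= wshift_linear mulrDr -scalerAr linearP.
Qed.

Lemma wHN u g : wH (- u) g = - wH u g.
Proof. exact: (linearN (mk_linear (wH_linearl g)) u). Qed.

Lemma wHZ c u g : wH (c *: u) g = c *: wH u g.
Proof.
have H0 : wH 0 g = 0 := linear_at0 (wH_linearl g).
by rewrite -[c *: u]addr0 wH_linearl H0 addr0.
Qed.

Lemma wH1 g : wH 1 g = g.
Proof. by apply: wmod_ext => w h; rewrite /= wshift1 mulr1. Qed.

Lemma wHM u v g : wH (u * v) g = wH u (wH v g).
Proof. by apply: wmod_ext => w h; rewrite /= wshiftM mulrA. Qed.

Lemma wE_H i u g : wE i (wH u g) = wH (sg i u) (wE i g).
Proof. by apply: wmod_ext. Qed.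

Lemma wF_nil i g h : wF i g [::] h = xm i (g [::] (sg i h)).
Proof. by []. Qed.

Lemma wE_F i l g :
  wE i (wF l g) = wF l (wE i g) + (if i == l then wH (uhkap C d l) g else 0).
Proof. by apply: wmod_ext => w h; rewrite wmodDE /wE /wF /=; case: eqP. Qed.

Lemma wF_linear i : linear (wF i).
Proof.
move=> c g g'; apply: wmod_ext => w; elim: w g g' => [|j w IHw] g g' h.
  by rewrite wmodDE wmodZE !wF_nil wmodDE wmodZE linearP.
rewrite wmodDE wmodZE -[LHS]/(wE j (wF i (c *: g + g')) w h).
rewrite -[wF i g (j :: w) h]/(wE j (wF i g) w h).
rewrite -[wF i g' (j :: w) h]/(wE j (wF i g') w h) !wE_F.
rewrite (linearP (wE j)) wmodDE IHw !wmodDE wmodZE scalerDr addrACA; congr (_ + _).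
by case: eqP => _; rewrite ?linearP ?wmodDE ?wmodZE // !wmod0E scaler0 addr0.
Qed.
HB.instance Definition _ i :=
  GRing.isLinear.Build (hser C) W W *:%R (wF i) (wF_linear i).

(** Commuting with the [wE j] allows letters to be stripped from the word until it is empty. *)
Lemma wE_comm_ext (T T' : W -> W) :
  (forall j g, wE j (T g) = T (wE j g)) -> (forall j g, wE j (T' g) = T' (wE j g)) ->
  (forall g h, T g [::] h = T' g [::] h) -> forall g, T g = T' g.
Proof.
move=> ET ET' T0 g; apply: wmod_ext => w; elim: w g => [|j w IHw] g h; first exact: T0.
by rewrite -[LHS]/(wE j (T g) w h) -[RHS]/(wE j (T' g) w h) ET ET' IHw.
Qed.

Lemma wF_H i u g : wF i (wH u g) = wH (sgV i u) (wF i g).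
Proof.
apply: wmod_ext => w; elim: w u g => [|j w IHw] u g h.
  by rewrite !wF_nil /= ushiftM ushiftNK.
rewrite -[LHS]/(wE j (wF i (wH u g)) w h) -[RHS]/(wE j (wH (sgV i u) (wF i g)) w h).
rewrite wE_F !wE_H wmodDE IHw wE_F ushiftC.
rewrite linearD wmodDE; congr (_ + _).
have [->|_] := eqVneq j i; last by rewrite linear0.
(* The two correction terms agree because U_hbar(h) is commutative. *)
by rewrite ushiftNK -[RHS]/(wH u (wH (uhkap C d i) g) w h) -!wHM mulrC.
Qed.

(** The Serre element in the [wF] commutes with every [wE], so only the empty word matters, where it
    becomes the Serre element of the [xm]. *)
Lemma wF_serre i j g : i != j ->
  (forall p : P, serre_op a d (fun i => xm i) i j p = 0) ->
  serre_op a d (fun i => wF i) i j g = 0.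
Proof.
move=> nij xm0.
have EF l (x : W) : wE l (serre_op a d (fun i => wF i) i j x) =
    serre_op a d (fun i => wF i) i j (wE l x).
  have act_lin (y : W) : linear (fun u : uh => wH u y) by apply: wH_linearl.
  apply: esym.
  (* Raising and lowering exchange their roles: shifts are inverted, K_i and K_i^-1 are swapped, and
     [f_i, e_i] = -[e_i, f_i]. *)
  apply: (@serre_comm C r a d W dat uh (@uh_regular C r) (fun i => wF i) (fun i => wE i)
    (fun u y => wH u y) (fun i => sgV i) (fun i => uhKi C d i) (fun i => uhK C d i)
    (fun i => - uhkap C d i) act_lin) => //.
  - exact: wF_H.
  - move=> k m y; rewrite [X in _ = X + _](wE_F m k y) eq_sym.
    case: eqP => [->|_]; last by rewrite !addr0.
    by rewrite wHN addrK.
  - move=> k m; exact: ushiftV_Ki.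
  - move=> k m; exact: ushiftV_K.
  by move=> k; rewrite scalerN (uhkapE C (cartan_pos dat k)) opprB.
apply: (wE_comm_ext (T' := fun=> 0)) => // {}g h.
have iterF k n (y : W) h' : iter n (wF k) y [::] h' =
    iter n (xm k) (y [::] (iter n (ushift (wt C a k)) h')).
  elim: n h' => // n IHn h'.
  by rewrite [in LHS]iterS wF_nil IHn [iter n.+1 (ushift _) _]iterSr.
(* All terms have the same weight, so each evaluates g at the same shift of h. *)
rewrite wmod_sumE -[RHS](xm0 (g [::] (iter `|1 - a i j| (ushift (wt C a i)) (sg j h)))).
apply: eq_bigr => k _; rewrite wmodZE iterF wF_nil iterF.
congr (_ *: iter _ _ (xm j (iter _ _ (g [::] _)))).
rewrite -(iter_commute _ h (fun y => ushiftC (wt C a i) (wt C a j) y)) -iterD subnKC //.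
by rewrite -ltnS.
Qed.
End Operators.

(** * The submodule satisfying the Serre relations, and the extension of functions from U_hbar(h) *)

Section SerreSubmodule.
Variables (C : numFieldType) (r : nat) (a : 'M[int]_r) (d : 'I_r -> nat).
Local Notation uh := (uh C r).
Hypothesis dat : cartan_datum a d.
Variables (P : lmodType (hser C)) (xp xm : 'I_r -> {linear P -> P}).
Hypothesis Psep : hseparated P.
Variables (S : (nat -> P) -> P).
Hypothesis SP : hsummation S.
Local Notation W := (wmod r P).
Local Notation sg i := (ushift (wt C a i)).
Local Notation sgV i := (ushift (fun k => - wt C a i k)).
Local Notation E i := (@wE C r P i).
Local Notation F i := (wF a d xm i).
Local Notation T u := (wH a u).
Local Notation serreE := (serre_op a d (fun i => E i)).
Local Notation WS := (@wmod_sum C r P Psep S SP).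

Let Wsep : hseparated W := @wmod_sep C r P Psep.
Let WSP : hsummation WS := @wmod_sumP C r P Psep S SP.

Definition wEs (v : seq 'I_r) (g : W) : W := foldr (fun i => E i) g v.

Lemma wEs_linear v : linear (wEs v).
Proof. by elim: v => // i v IHv c x y; rewrite /= IHv linearP. Qed.

Lemma serreE_linear i j : linear (serreE i j : W -> W).
Proof. exact: (linear_serre_op a d (fun i => E i)). Qed.

(** Imposing the relations on all translates of g, and not on g alone, makes this set stable under
    the e_l. *)
Definition serre_sub (g : W) : Prop :=
  forall v i j, i != j -> serreE i j (wEs v g) = 0.

Lemma serre_sub_linear (c : hser C) g g' :
  serre_sub g -> serre_sub g' -> serre_sub (c *: g + g').
Proof.
by move=> s1 s2 v i j nij; rewrite wEs_linear serreE_linear s1 ?s2 // scaler0 addr0.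
Qed.

Lemma serre_sub0 : serre_sub 0.
Proof.
by move=> v i j _; rewrite (linear_at0 (wEs_linear v)) (linear_at0 (serreE_linear i j)).
Qed.

Lemma serre_sub_sum p : (forall n, serre_sub (p n)) -> serre_sub (WS p).
Proof.
move=> sp v i j nij.
have L : linear (fun g => serreE i j (wEs v g)).
  by move=> c g g'; rewrite wEs_linear serreE_linear.
rewrite (hsum_map Wsep WSP WSP L).
rewrite -(hsum0 Wsep WSP); congr WS; apply: funext => n.
exact: sp.
Qed.

Lemma serre_sub_E l g : serre_sub g -> serre_sub (E l g).
Proof. by move=> s1 v i j nij; have := s1 (rcons v l) i j nij; rewrite /wEs foldr_rcons. Qed.

(** The terms of a Serre element have a common weight, so u is shifted equally in all of them. *)
Lemma serre_op_H i j u g : exists u', serreE i j (T u g) = T u' (serreE i j g).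
Proof.
exists (iter `|1 - a i j| (sg i) (sg j u)).
have itE n k v x : iter n (E k) (T v x) = T (iter n (sg k) v) (iter n (E k) x).
  by elim: n => // n IHn; rewrite !iterS IHn wE_H.
rewrite /serre_op linear_sum; apply: eq_bigr => k _.
have Eu : iter (`|1 - a i j| - k) (sg i) (sg j (iter k (sg i) u)) =
    iter `|1 - a i j| (sg i) (sg j u).
  rewrite -(iter_commute _ u (fun y => ushiftC (wt C a i) (wt C a j) y)) -iterD subnK //.
  by rewrite -ltnS.
by rewrite [RHS]linearZ itE wE_H itE Eu.
Qed.

Lemma wEs_H v u g : exists u', wEs v (T u g) = T u' (wEs v g).
Proof.
elim: v => [|i v [u' IHv]]; first by exists u.
by exists (sg i u'); rewrite /= IHv wE_H.
Qed.

Lemma serre_sub_H u g : serre_sub g -> serre_sub (T u g).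
Proof.
move=> sg0 v i j nij; have [u' ->] := wEs_H v u g.
have [u'' ->] := serre_op_H i j u' (wEs v g).
by rewrite sg0 // linear0.
Qed.

Lemma serre_E_F i j l g : i != j -> serreE i j (F l g) = F l (serreE i j g).
Proof.
move=> nij; have act_lin (y : W) : linear (fun u : uh => T u y) by apply: wH_linearl.
apply: (@serre_comm C r a d W dat uh (@uh_regular C r) (fun i => E i) (fun i => F i)
  (fun u y => T u y) (fun i => sg i) (fun i => uhK C d i) (fun i => uhKi C d i)
  (fun i => uhkap C d i) act_lin) => //.
- by move=> k u y; exact: wE_H.
- move=> k m y; have := wE_F a d xm k m y.
  by case: (eqVneq k m) => [<-|_] EF; exact: EF.
- move=> k m; exact: ushift_K.
- move=> k m; exact: ushift_Ki.
by move=> k; exact: (uhkapE C (cartan_pos dat k)).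
Qed.

(** [serre_E_F] is the case of the empty v. Otherwise the last letter of v, which acts first, is
    moved past f_l, and the commutator stays in the submodule by [serre_sub_H]. *)
Lemma serre_sub_F l g : serre_sub g -> serre_sub (F l g).
Proof.
move=> sg0 v; elim/last_ind: v g sg0 => [|v k IHv] g sg0 i j nij.
  by rewrite /= serre_E_F // (sg0 [::] i j nij) linear0.
rewrite /wEs foldr_rcons -/(wEs v _) (wE_F a d xm k l g).
rewrite -[F l (E k g)]scale1r wEs_linear serreE_linear scale1r.
rewrite IHv //; last exact: serre_sub_E.
rewrite add0r; case: eqP => _; first by apply: serre_sub_H.
exact: serre_sub0.
Qed.

Definition uq_op (g : uq_index r) : {linear W -> W} :=
  match g with
  | inl (inl i) => E i
  | inl (inr i) => F i
  | inr i => T (uconst 'X_i)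
  end.

Local Notation rho := (hfree_act WS uq_op).

Lemma rho_E i g : rho (hfree_gen C (inl (inl i) : uq_index r)) g = E i g.
Proof. by rewrite (hfree_act_gen Wsep WSP). Qed.
Lemma rho_F i g : rho (hfree_gen C (inl (inr i) : uq_index r)) g = F i g.
Proof. by rewrite (hfree_act_gen Wsep WSP). Qed.
Lemma rho_H i g : rho (hfree_gen C (inr i : uq_index r)) g = T (uconst 'X_i) g.
Proof. by rewrite (hfree_act_gen Wsep WSP). Qed.

Let rhoM := hfree_actM Wsep WSP uq_op.
Let rhoB := hfree_actB Wsep WSP uq_op.
Let rhoD := hfree_actD Wsep WSP uq_op.
Let rhoZ := hfree_actZ Wsep WSP uq_op.

Lemma rho_uh u g : rho (uh_hfree u) g = T u g.
Proof.
apply: (hfree_act_uh Wsep WSP).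
- by move=> x; exact: wH_linearl.
- by move=> x; exact: wH1.
- by move=> u' v x; exact: wHM.
by [].
Qed.

Lemma rho_serre (e : 'I_r -> uq_index r) (op : 'I_r -> {linear W -> W}) i j g :
  (forall k x, rho (hfree_gen C (e k)) x = op k x) ->
  rho (qserre (hfree_gen C (e i)) (hfree_gen C (e j)) (d i) `|1 - a i j|%N) g =
  serre_op a d (fun k => op k) i j g.
Proof.
move=> rho_e; rewrite /qserre /serre_op.
rewrite (hfree_act_sum Wsep WSP).
have iterE n k x : iter n (rho (hfree_gen C (e k))) x = iter n (op k) x.
  by elim: n => //= n ->; rewrite rho_e.
apply: eq_bigr => k _; rewrite rhoZ 2!rhoM; congr (_ *: _).
rewrite 2!(hfree_actX Wsep WSP).
by rewrite !iterE rho_e.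
Qed.

Hypothesis xm_serre : forall i j p, i != j -> serre_op a d (fun i => xm i) i j p = 0.

Lemma rho_bracket x y g :
  rho (x * y - y * x) g = rho x (rho y g) - rho y (rho x g).
Proof. rewrite rhoB; congr (_ - _); exact: rhoM. Qed.

Lemma rho_int x n g : rho (x *~ n) g = n%:~R *: rho x g.
Proof. by rewrite -scaler_int rhoZ. Qed.

Lemma hconst_int n : hconst (n%:~R : C) = n%:~R.
Proof. by rewrite raddfMz /= hconst1. Qed.

Lemma hconst_intN n : hconst (- n%:~R : C) = - n%:~R.
Proof. by rewrite raddfN /= hconst_int. Qed.

Lemma ushift_X lam k :
  ushift lam (uconst 'X_k) = hconst (lam k) *: (1 : uh) + uconst ('X_k : mpoly r C).
Proof.
rewrite ushift_const pshiftX -uconst1 -uconstL addrC; congr (uconst (_ + _)).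
by rewrite -mul_mpolyC mulr1.
Qed.

Lemma wH_X lam k (g : W) : T (ushift lam (uconst 'X_k)) g =
  hconst (lam k) *: g + T (uconst 'X_k) g.
Proof. by rewrite ushift_X wH_linearl wH1. Qed.

Lemma rho_rel x g : uq_rel a d x -> serre_sub g -> rho x g = 0.
Proof.
move=> rel sg0; case: rel => [i j|i j|i j|i j nij|i|i j nij|i j nij].
- rewrite rho_bracket 4!rho_H.
  rewrite -[X in X - _]wHM -[X in _ - X]wHM [X in wH _ X g - _]mulrC.
  by rewrite subrr.
- rewrite rhoB rho_bracket 2!rho_E 2!rho_H rho_int rho_E.
  rewrite wE_H wH_X /wt opprD addrCA subrr addr0.
  by rewrite hconst_intN scaleNr opprK subrr.
- rewrite rhoD rho_bracket 2!rho_F 2!rho_H rho_int rho_F.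
  rewrite wF_H wH_X /wt opprK hconst_int opprD addrCA subrr addr0.
  by rewrite addNr.
- rewrite rho_bracket 2!rho_E 2!rho_F.
  by rewrite (wE_F a d xm i j g) (negbTE nij) addr0 subrr.
- rewrite rhoB rhoZ rho_bracket 2!rho_E 2!rho_F.
  rewrite -uh_hfree_quoK rho_uh (wE_F a d xm i i g) eqxx addrAC subrr add0r.
  by rewrite -wHZ (uhkap_unit C (cartan_pos dat i)) subrr.
- by rewrite (rho_serre (e := fun k => inl (inl k)) (op := fun k => E k) _ _ _ rho_E) (sg0 [::]).
rewrite (rho_serre (e := fun k => inl (inr k)) (op := fun k => F k) _ _ _ rho_F).
by rewrite wF_serre // => p; apply: xm_serre.
Qed.

Hypothesis xp_serre : forall i j p, i != j -> serre_op_rev a d (fun i => xp i) i j p = 0.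
Hypothesis xp_xm : forall i j p, xp i (xm j p) = xm j (xp i p).

Fixpoint psihat (psi : {linear uh -> P}) (w : seq 'I_r) : {linear uh -> P} :=
  if w is i :: w' then xp i \o psihat psi w' else psi.

(** On [psihat psi] this coincides with translation by e_i. As it commutes with the action of all
    generators, it brings [xp i] out of phi(x e_i). *)
Definition wL (i : 'I_r) (g : W) : W := fun w => xp i \o g w.

Lemma wL_linear i : linear (wL i).
Proof. by move=> c g g'; apply: wmod_ext => w h; rewrite /wL /= linearP. Qed.

HB.instance Definition _ i :=
  GRing.isLinear.Build (hser C) W W *:%R (wL i) (wL_linear i).

Lemma psihat_cat psi v w h :
  psihat psi (v ++ w) h = foldr (fun i => xp i) (psihat psi w h) v.
Proof. by elim: v => //= i v ->. Qed.

Lemma iter_wE n i (g : W) w : iter n (E i) g w = g (nseq n i ++ w).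
Proof. by elim: n g => // n IHn g; rewrite iterSr IHn. Qed.

Lemma wEs_rev v (g : W) w : wEs v g w = g (rev v ++ w).
Proof.
elim: v w => // i v IHv w.
by rewrite -[LHS]/(wEs v g (i :: w)) IHv rev_cons cat_rcons.
Qed.

(** Translations prepend letters in reversed order, so the Serre element in the e_i turns into
    [serre_op_rev] of the [xp], inside the operators of v. *)
Lemma serre_sub_psihat psi : serre_sub (psihat psi).
Proof.
move=> v i j nij; apply: wmod_ext => w h; rewrite wmod_sumE wmod0E.
pose f x := foldr (fun i => xp i) x (rev v).
have fL : linear f by rewrite /f; elim: (rev v) => //= l s IHs c x y; rewrite IHs linearP.
have foldr_nseq n k x : foldr (fun i => xp i) x (nseq n k) = iter n (xp k) x.
  by elim: n => //= n ->.
have E0 : f (serre_op_rev a d (fun i => xp i) i j (psihat psi w h)) = 0.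
  by rewrite xp_serre // linear_at0.
rewrite -[RHS]E0 /serre_op_rev.
have fS n (G : 'I_n -> P) : f (\sum_k G k) = \sum_k f (G k).
  exact: (linear_sum (mk_linear fL)).
have fZ c x : f (c *: x) = c *: f x by exact: (linearZZ (mk_linear fL)).
rewrite fS; apply: eq_bigr => k _; rewrite fZ.
rewrite wmodZE; congr (_ *: _).
rewrite iter_wE -[LHS]/(iter k (E i) (wEs v (psihat psi))
  (j :: nseq (`|1 - a i j| - k) i ++ w) h).
by rewrite iter_wE wEs_rev !psihat_cat foldr_nseq /= psihat_cat foldr_nseq.
Qed.

Lemma wL_E i j g : wL i (E j g) = E j (wL i g).
Proof. by []. Qed.

Lemma wL_F i l g : wL i (F l g) = F l (wL i g).
Proof.
apply: wmod_ext => w; elim: w g => [|j w IHw] g h.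
  by rewrite -[LHS]/(xp i (F l g [::] h)) !wF_nil xp_xm.
rewrite -[LHS]/(wL i (E j (F l g)) w h) -[RHS]/(E j (F l (wL i g)) w h).
rewrite (wE_F a d xm j l g) (wE_F a d xm j l (wL i g)) -wL_E.
rewrite linearD !wmodDE IHw wL_E; congr (_ + _).
by case: eqP => // _; rewrite linear0.
Qed.

Definition phi_free psi (x : hfree C (uq_index r)) : P := rho x (psihat psi) [::] 1.

Lemma phi_free_linear psi : linear (phi_free psi).
Proof. by move=> c x y; rewrite /phi_free rhoD rhoZ. Qed.

Lemma phi_free_ideal psi x : x \in closed_ideal (uq_rel (C := C) a d) -> phi_free psi x = 0.
Proof.
move=> Ix; rewrite /phi_free.
rewrite (hfree_act_ideal Wsep WSP (rel := uq_rel (C := C) a d) (Q := serre_sub)) //.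
- apply: hfree_act_stable => //.
  + exact: serre_sub0.
  + exact: serre_sub_linear.
  + exact: serre_sub_sum.
  by case=> [[i|i]|i] g; [exact: serre_sub_E | exact: serre_sub_F | exact: serre_sub_H].
- by move=> x' m; exact: rho_rel.
exact: serre_sub_psihat.
Qed.

Definition phi_uq psi (u : uq C a d) : P := phi_free psi (repr u).

Lemma phi_uqE psi x : phi_uq psi (presented_pi (uq_rel (C := C) a d) x) = phi_free psi x.
Proof.
apply/eqP; rewrite /phi_uq -subr_eq0 -[- phi_free psi x]scaleN1r addrC.
rewrite -phi_free_linear scaleN1r addrC; apply/eqP/phi_free_ideal.
by apply/presented_piP; rewrite presented_piK.
Qed.

Lemma phi_uq_linear psi : linear (phi_uq psi).
Proof.
move=> c u v; rewrite -[u]presented_piK -[v]presented_piK.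
rewrite -presented_piZ -raddfD !phi_uqE; exact: phi_free_linear.
Qed.

(** With P = P_omega this yields Whittaker functions; with P = U_hbar(g) it yields the projections
    onto U_hbar(n_+) and U_hbar(n_-), for which the last clause confines the values to the closed
    subalgebra. *)
Lemma whittaker_extension (psi : {linear uh -> P}) :
  exists phi : {linear uq C a d -> P},
  [/\ forall u, phi (uh_emb a d u) = psi u,
      forall x i, phi (x * uqE C a d i) = xp i (phi x),
      forall x i, phi (uqF C a d i * x) = xm i (phi x)
    & forall Q : P -> Prop, Q 0 ->
        (forall (c : hser C) p q, Q p -> Q q -> Q (c *: p + q)) ->
        (forall p, (forall n, Q (p n)) -> Q (S p)) ->
        (forall i p, Q p -> Q (xp i p)) -> (forall i p, Q p -> Q (xm i p)) ->
        (forall u, Q (psi u)) -> forall x, Q (phi x)].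
Proof.
exists (mk_linear (phi_uq_linear psi)); split=> /=.
- move=> u; rewrite phi_uqE /phi_free rho_uh /= mul1r //.
- move=> x i; rewrite -[x]presented_piK -presented_piM !phi_uqE /phi_free.
  rewrite rhoM rho_E.
  have -> : E i (psihat psi) = wL i (psihat psi) by apply: wmod_ext.
  have comm g m : wL i (uq_op g m) = uq_op g (wL i m).
    case: g => [[j|j]|j]; last by apply: wmod_ext.
      by apply: wmod_ext.
    exact: wL_F.
  by rewrite -(hfree_act_comm Wsep WSP WSP (f := wL i) comm).
- move=> x i; rewrite -[x]presented_piK -presented_piM !phi_uqE /phi_free.
  (* A left factor f_i acts last; at the empty word and h = 1 it only contributes [xm i]. *)
  by rewrite rhoM rho_F wF_nil ushift1.
move=> Q Q0 QL QS Qp Qm Qpsi x; rewrite /phi_uq /phi_free.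
pose QW (g : W) := forall w h, Q (g w h).
apply: (hfree_act_stable (Q := QW)) => //.
- by move=> c g g' Qg Qg' w h; apply: QL.
- by move=> p Qp' w h; apply: QS => n; apply: Qp'.
- case=> [[i|i]|i] g Qg w h; [exact: Qg| |exact: Qg].
  elim: w g Qg h => [|j w IHw] g Qg h; first by apply/Qm/Qg.
  rewrite -[F i g (j :: w) h]/(E j (F i g) w h) (wE_F a d xm j i g) wmodDE.
  rewrite -[X in X + _]scale1r; apply: QL.
    by apply: IHw => w' h'; apply: Qg.
  by case: eqP => _; [apply: Qg | apply: Q0].
by elim=> [|i w IHw] h; [apply: Qpsi | apply/Qp/IHw].
Qed.
End SerreSubmodule.

(** * Relations in the quantum group *)

Section PresentedMul.
Variables (C : fieldType) (G : choiceType) (rel : hfree C G -> Prop).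
Local Notation P := (presented rel).

Lemma lmul_linear (x : P) : linear (fun p : P => (x * p : P)).
Proof. by move=> c u v; rewrite mulrDr -presented_scaleAr. Qed.

Lemma rmul_linear (x : P) : linear (fun p : P => (p * x : P)).
Proof. by move=> c u v; rewrite mulrDl -presented_scaleAl. Qed.

Lemma presented_piX x n : presented_pi rel (x ^+ n) = presented_pi rel x ^+ n.
Proof. by elim: n => // n IHn; rewrite !exprS presented_piM IHn. Qed.

Lemma presented_piB x y :
  presented_pi rel (x - y) = presented_pi rel x - presented_pi rel y.
Proof. exact: raddfB. Qed.

Lemma presented_piD x y :
  presented_pi rel (x + y) = presented_pi rel x + presented_pi rel y.
Proof. exact: raddfD. Qed.

Lemma presented_pi_int x n :
  presented_pi rel (x *~ n) = n%:~R *: presented_pi rel x.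
Proof. by rewrite -presented_piZ scaler_int. Qed.

Lemma presented_pi_bracket x y : presented_pi rel (x * y - y * x) =
  presented_pi rel x * presented_pi rel y - presented_pi rel y * presented_pi rel x.
Proof.
exact: eq_trans (presented_piB _ _)
  (f_equal2 (fun u v => u - v) (presented_piM rel x y) (presented_piM rel y x)).
Qed.

Variable Sg : P -> Prop.
Local Notation A := (subalg_gen Sg).
Local Notation N := (closed_subalg_gen Sg).

Lemma subalg_gen0 : A 0.
Proof. by rewrite -(scale0r (1 : P)); apply/SubalgZ/Subalg1. Qed.

Lemma closed_subalg_incl u : A u -> N u.
Proof. by move=> Au n; exists u, 0; rewrite scaler0 addr0. Qed.

Lemma closed_subalg_linear (c : hser C) u v : N u -> N v -> N (c *: u + v).
Proof.
move=> Nu Nv n; have [y [z [Ay ->]]] := Nu n; have [y' [z' [Ay' ->]]] := Nv n.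
exists (c *: y + y'), (c *: z + z'); split; first by apply/SubalgD/Ay'/SubalgZ.
by rewrite !scalerDr !scalerA [c * _]mulrC addrACA.
Qed.

Lemma closed_subalg0 : N 0.
Proof. exact/closed_subalg_incl/subalg_gen0. Qed.

Lemma closed_subalgZ c u : N u -> N (c *: u).
Proof. by move=> Nu; rewrite -[c *: u]addr0; apply/closed_subalg_linear/closed_subalg0. Qed.

Lemma closed_subalgMl u v : A u -> N v -> N (u * v).
Proof.
move=> Au Nv n; have [y [z [Ay ->]]] := Nv n; exists (u * y), (u * z).
by split; [exact: SubalgM | rewrite mulrDr presented_scaleAr].
Qed.

Lemma closed_subalgMr u v : N u -> A v -> N (u * v).
Proof.
move=> Nu Av n; have [y [z [Ay ->]]] := Nu n; exists (y * v), (z * v).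
by split; [exact: SubalgM | rewrite mulrDl presented_scaleAl].
Qed.

Lemma closed_subalg_sum p : (forall n, N (p n)) -> N (presented_sum p).
Proof.
move=> Np n; have := hsep_tail (presented_sumP (rel := rel)) closed_subalg0
  closed_subalg_linear n Np.
case=> u [v [Nu ->]]; have [y [z [Ay ->]]] := Nu n.
by exists y, (z + v); split; [exact: Ay | rewrite scalerDr addrA].
Qed.

(* The topology induced on the closed subalgebra is its hbar-adic topology
   as soon as it is the image of a linear projection. *)
Lemma closed_subalg_split (e : P -> P) : linear e ->
  (forall y, A y -> e y = y) -> (forall x, N (e x)) ->
  forall u n, N u -> exists y z, [/\ A y, N z & u = y + hbar C ^+ n *: z].
Proof.
move=> eL eA eN.
have eyz n y z : A y -> e (y + hbar C ^+ n *: z) = y + hbar C ^+ n *: e z.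
  by move=> Ay; rewrite [X in e X]addrC eL addrC; congr (_ + _); exact: eA.
(* e is linear, hence continuous, and fixes the dense subalgebra A. *)
have eq_e u : N u -> e u = u.
  move=> Nu; apply/eqP; rewrite -subr_eq0; apply/eqP/presented_sep => n.
  have [y [z [Ay ->]]] := Nu n; exists (e z - z).
  by rewrite (eyz n y z Ay) opprD addrACA subrr add0r scalerBr.
move=> u n Nu; have [y [z [Ay uE]]] := Nu n; exists y, (e z).
split; [exact: Ay | exact: eN |].
exact: eq_trans (esym (eq_e u Nu)) (eq_trans (congr1 e uE) (eyz n y z Ay)).
Qed.
End PresentedMul.

Lemma prodM_comm (R : pzRingType) (I : Type) (s : seq I) (x y : I -> R) :
  (forall i j, x i * y j = y j * x i) ->
  \prod_(i <- s) (x i * y i) = (\prod_(i <- s) x i) * \prod_(i <- s) y i.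
Proof.
move=> xy; elim: s => [|i s IHs]; first by rewrite !big_nil mulr1.
rewrite !big_cons IHs -!mulrA; congr (_ * _); rewrite !mulrA; congr (_ * _).
elim: s {IHs} => [|j s IHs]; first by rewrite !big_nil mulr1 mul1r.
by rewrite !big_cons -mulrA -IHs !mulrA xy.
Qed.

Section UqRelations.
Variables (C : numFieldType) (r : nat) (a : 'M[int]_r) (d : 'I_r -> nat).
Local Notation uq := (uq C a d).
Local Notation uh := (uh C r).
Local Notation E i := (uqE C a d i).
Local Notation F i := (uqF C a d i).
Local Notation rel := (@uq_rel C r a d).

Definition uqH (i : 'I_r) : uq := presented_gen rel (inr i : uq_index r).

Lemma uq_sep : hseparated uq.
Proof. exact: (@presented_sep C _ rel). Qed.

Lemma uqHH i j : uqH i * uqH j = uqH j * uqH i.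
Proof.
apply/eqP; rewrite -subr_eq0; apply/eqP.
by rewrite -[RHS](presented_pi_rel (uq_hh C a d i j)) presented_pi_bracket.
Qed.

Lemma uqHE i j : uqH i * E j = E j * uqH i + (a i j)%:~R *: E j.
Proof.
apply/eqP; rewrite addrC -subr_eq -subr_eq0 addrAC; apply/eqP.
rewrite -[RHS](presented_pi_rel (uq_he C a d i j)) presented_piB presented_pi_bracket.
by rewrite presented_pi_int addrAC.
Qed.

Lemma uqHF i j : uqH i * F j = F j * uqH i - (a i j)%:~R *: F j.
Proof.
apply/eqP; rewrite addrC -subr_eq -subr_eq0 addrAC opprK; apply/eqP.
rewrite -[RHS](presented_pi_rel (uq_hf C a d i j)) presented_piD presented_pi_bracket.
by rewrite presented_pi_int addrAC.
Qed.

Lemma uh_emb_pi u : uh_emb a d u = presented_pi rel (uh_hfree u).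
Proof. by []. Qed.

Lemma uqEF_unit i : (0 < d i)%N ->
  E i * F i - F i * E i = uh_emb a d (uhkap C d i).
Proof.
move=> d0; have := presented_pi_rel (uq_ef C a d i).
rewrite presented_piB presented_piZ presented_pi_bracket -uh_hfree_quoK -uh_emb_pi.
move/eqP; rewrite subr_eq0 => /eqP EF.
have -> : uh_emb a d (uhkap C d i) =
    hser_recip (qunit C d i) *: uh_emb a d (hquo (uhK C d i - uhKi C d i)).
  exact: linearZZ.
by rewrite -EF scalerA hser_recip_qunit // scale1r.
Qed.

Lemma uqEF i j : (0 < d i)%N ->
  E i * F j = F j * E i + (if i == j then uh_emb a d (uhkap C d i) else 0).
Proof.
move=> d0; apply/eqP; rewrite addrC -subr_eq; apply/eqP.
have [<-|nij] := eqVneq; first exact: uqEF_unit.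
by rewrite -[RHS](presented_pi_rel (uq_ef_neq C a d nij)) presented_pi_bracket.
Qed.

Lemma uh_emb_const p : uh_emb a d (uconst p) = presented_pi rel (hconst (uh_lift p)).
Proof. by rewrite uh_emb_pi uh_hfree_const. Qed.

Lemma uh_emb1 : uh_emb a d (1 : uh) = 1.
Proof.
rewrite -uconst1 uh_emb_const /uh_lift -mpolyC1 mmapC /= scale1r.
by rewrite hconst1.
Qed.

Lemma uh_emb_monomial m :
  uh_emb a d (uconst 'X_[m]) = \prod_(i < r) uqH i ^+ m i.
Proof.
rewrite uh_emb_const uh_liftX.
elim: (index_enum _) => [|i s IHs]; first by rewrite !big_nil hconst1.
rewrite !big_cons hconstM presented_piM IHs; congr (_ * _).
elim: (m i) => [|n IHn]; first by rewrite !expr0 hconst1.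
by rewrite !exprS hconstM presented_piM IHn.
Qed.

Lemma uh_emb_X i : uh_emb a d (uconst 'X_i) = uqH i.
Proof. by rewrite uh_emb_const /uh_lift mmapX mmap1U. Qed.

(** [uh_lift] writes the factors of a monomial in a fixed order and is not multiplicative;
    commutativity of the h_i in the quotient repairs this. *)
Lemma uh_emb_mulX i u : uh_emb a d (uconst 'X_i * u) = uqH i * uh_emb a d u.
Proof.
move: u; apply: (uh_monomial_ext uq_sep).
- by move=> c u v; rewrite mulrDr -scalerAr linearP.
- by move=> c u v; rewrite linearP; exact: lmul_linear.
move=> m; rewrite -uconstM -mpolyXD -uh_emb_X !uh_emb_monomial.
rewrite -prodM_comm => [|j k]; last exact/commrX/commr_sym/commrX/uqHH.
by apply: eq_bigr => j _; rewrite mnmDE exprD.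
Qed.

Lemma uh_embM (u v : uh) : uh_emb a d (u * v) = uh_emb a d u * uh_emb a d v.
Proof.
move: u; apply: (uh_word_ext uq_sep).
- by move=> c u u'; rewrite mulrDl -scalerAl linearP.
- by move=> c u u'; rewrite linearP; exact: rmul_linear.
elim=> [|i w IHw]; first by rewrite uh_word0 mul1r uh_emb1 mul1r.
by rewrite uh_word_cons -mulrA uh_emb_mulX {}IHw uh_emb_mulX mulrA.
Qed.

Local Notation sg i := (ushift (wt C a i)).
Local Notation sgV i := (ushift (fun k => - wt C a i k)).

Lemma uh_emb_shiftX lam k (u : uh) : uh_emb a d (ushift lam (uconst 'X_k) * u) =
  hconst (lam k) *: uh_emb a d u + uqH k * uh_emb a d u.
Proof. by rewrite ushift_X mulrDl -scalerAl mul1r uh_emb_linear uh_emb_mulX. Qed.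

Lemma uqE_emb i u : E i * uh_emb a d u = uh_emb a d (sg i u) * E i.
Proof.
move: u; apply: (uh_word_ext uq_sep).
- by move=> c u v; rewrite linearP; exact: lmul_linear.
- by move=> c u v; rewrite !linearP; exact: rmul_linear.
elim=> [|k w IHw]; first by rewrite uh_word0 ushift1 uh_emb1 mul1r mulr1.
rewrite uh_word_cons uh_emb_mulX mulrA ushiftM uh_emb_shiftX.
have -> : E i * uqH k = uqH k * E i - (a k i)%:~R *: E i.
  by clear IHw; rewrite uqHE addrK.
transitivity (uqH k * (E i * uh_emb a d (uh_word C w)) -
    (a k i)%:~R *: (E i * uh_emb a d (uh_word C w))).
  rewrite mulrBl -mulrA; congr (_ - _); exact: esym (presented_scaleAl _ _ _).
rewrite {}IHw mulrDl -[X in _ = _ + X]mulrA /wt hconst_intN scaleNr [RHS]addrC; congr (_ + _).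
rewrite mulNr; congr (- _); exact: presented_scaleAl.
Qed.

Lemma uqF_emb i u : F i * uh_emb a d u = uh_emb a d (sgV i u) * F i.
Proof.
move: u; apply: (uh_word_ext uq_sep).
- by move=> c u v; rewrite linearP; exact: lmul_linear.
- by move=> c u v; rewrite !linearP; exact: rmul_linear.
elim=> [|k w IHw]; first by rewrite uh_word0 ushift1 uh_emb1 mul1r mulr1.
rewrite uh_word_cons uh_emb_mulX mulrA ushiftM uh_emb_shiftX.
have -> : F i * uqH k = uqH k * F i + (a k i)%:~R *: F i.
  by clear IHw; rewrite uqHF subrK.
transitivity (uqH k * (F i * uh_emb a d (uh_word C w)) +
    (a k i)%:~R *: (F i * uh_emb a d (uh_word C w))).
  rewrite mulrDl -mulrA; congr (_ + _); exact: esym (presented_scaleAl _ _ _).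
rewrite {}IHw mulrDl -[X in _ = _ + X]mulrA /wt opprK hconst_int [RHS]addrC; congr (_ + _).
exact: presented_scaleAl.
Qed.

Lemma uq_emb_F i u : uh_emb a d u * F i = F i * uh_emb a d (sg i u).
Proof. by rewrite uqF_emb ushiftK. Qed.

End UqRelations.

(** * Characters *)

Section Eval.
Variables (C : numFieldType) (r : nat) (lam : 'I_r -> C).
Local Notation uh := (uh C r).

(** As a function on the formal torus this is the character e^lam; at lam = 0 it is the counit. *)
Definition uev (u : uh) : (hser C)^o := fun n => (u n).@[lam].

Lemma uev_linear : linear uev.
Proof.
move=> c u v; apply: funext => n; rewrite /uev hserDE hserZE mevalD raddf_sum.
rewrite [RHS]hserDE; congr (_ + _).
rewrite -[RHS]/((c * ((fun n => (u n).@[lam]) : hser C)) n) hserME.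
by apply: eq_bigr => i _; rewrite /= mevalZ.
Qed.
HB.instance Definition _ :=
  GRing.isLinear.Build (hser C) uh (hser C)^o *:%R uev uev_linear.

Lemma uev_const p : uev (uconst p) = hconst p.@[lam].
Proof. by apply: funext => -[|n] //; rewrite /uev /= meval0. Qed.

Lemma uev1 : uev 1 = 1.
Proof. by rewrite -uconst1 uev_const meval1 hconst1. Qed.
End Eval.

Lemma iter_lmul (R : pzRingType) (x p : R) n : iter n (fun q => x * q) p = x ^+ n * p.
Proof. by elim: n => [|n IHn]; rewrite ?mul1r // iterS IHn exprS mulrA. Qed.

Lemma iter_rmul (R : pzRingType) (x p : R) n : iter n (fun q => q * x) p = p * x ^+ n.
Proof. by elim: n => [|n IHn]; rewrite ?mulr1 // iterS IHn exprSr mulrA. Qed.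

Lemma addIB (V : zmodType) (x y z : V) : x + y - (x + z) = y - z.
Proof. by rewrite opprD addrACA subrr add0r. Qed.

Section AlgebraSerre.
Variables (C : numFieldType) (r : nat) (a : 'M[int]_r) (d : 'I_r -> nat).
Variables (G : choiceType) (rl : hfree C G -> Prop).
Local Notation P := (presented rl).
Variables (x : 'I_r -> P).

Definition lmul (y : P) : {linear P -> P} := mk_linear (lmul_linear y).
Definition rmul (y : P) : {linear P -> P} := mk_linear (rmul_linear y).

Definition alg_serre i j : P :=
  \sum_(k < `|1 - a i j|.+1) ((-1) ^+ k * qbinom C (d i) `|1 - a i j| k) *:
    (x i ^+ (`|1 - a i j| - k) * x j * x i ^+ k).

Definition alg_serre_rev i j : P :=
  \sum_(k < `|1 - a i j|.+1) ((-1) ^+ k * qbinom C (d i) `|1 - a i j| k) *: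
    (x i ^+ k * x j * x i ^+ (`|1 - a i j| - k)).

Lemma serre_op_lmul i j p :
  serre_op a d (fun i => lmul (x i)) i j p = alg_serre i j * p.
Proof.
rewrite -[RHS]/(rmul p (alg_serre i j)) /alg_serre linear_sum.
apply: eq_bigr => k _; apply: eq_trans (esym (linearZZ (rmul p) _ _)).
congr (_ *: _); rewrite iter_lmul /= iter_lmul.
exact: eq_trans (mulrA _ _ _) (mulrA _ _ _).
Qed.

Lemma serre_op_rev_lmul i j p :
  serre_op_rev a d (fun i => lmul (x i)) i j p = alg_serre_rev i j * p.
Proof.
rewrite -[RHS]/(rmul p (alg_serre_rev i j)) /alg_serre_rev linear_sum.
apply: eq_bigr => k _; apply: eq_trans (esym (linearZZ (rmul p) _ _)).
congr (_ *: _); rewrite iter_lmul /= iter_lmul.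
exact: eq_trans (mulrA _ _ _) (mulrA _ _ _).
Qed.

Lemma serre_op_rmul i j p :
  serre_op a d (fun i => rmul (x i)) i j p = p * alg_serre_rev i j.
Proof.
rewrite -[RHS]/(lmul p (alg_serre_rev i j)) /alg_serre_rev linear_sum.
apply: eq_bigr => k _; apply: eq_trans (esym (linearZZ (lmul p) _ _)).
by congr (_ *: _); rewrite iter_rmul /= iter_rmul !mulrA.
Qed.

Lemma serre_op_rev_rmul i j p :
  serre_op_rev a d (fun i => rmul (x i)) i j p = p * alg_serre i j.
Proof.
rewrite -[RHS]/(lmul p (alg_serre i j)) /alg_serre linear_sum.
apply: eq_bigr => k _; apply: eq_trans (esym (linearZZ (lmul p) _ _)).
by congr (_ *: _); rewrite iter_rmul /= iter_rmul !mulrA.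
Qed.

Lemma serre_op0 (M : lmodType (hser C)) i j (p : M) :
  serre_op a d (fun=> \0 : {linear M -> M}) i j p = 0.
Proof.
rewrite /serre_op big1 // => k _.
by rewrite (linear_at0 (iter_linear _ _)) scaler0.
Qed.

Lemma serre_op_rev0 (M : lmodType (hser C)) i j (p : M) :
  serre_op_rev a d (fun=> \0 : {linear M -> M}) i j p = 0.
Proof.
rewrite /serre_op_rev big1 // => k _.
by rewrite (linear_at0 (iter_linear _ _)) scaler0.
Qed.
End AlgebraSerre.

Section Characters.
Variables (C : numFieldType) (r : nat) (a : 'M[int]_r) (d : 'I_r -> nat).
Hypothesis dat : cartan_datum a d.
Local Notation uq := (uq C a d).
Local Notation uh := (uh C r).
Local Notation E i := (uqE C a d i).
Local Notation F i := (uqF C a d i).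
Local Notation urel := (@uq_rel C r a d).
Local Notation Np := (@uq_np C r a d).
Local Notation Nm := (@uq_nm C r a d).
Local Notation Ap := (subalg_gen (fun u : uq => exists i, u = E i)).
Local Notation Am := (subalg_gen (fun u : uq => exists i, u = F i)).

Lemma uq_serre_pi (e : 'I_r -> uq_index r) i j :
  presented_pi urel (qserre (hfree_gen C (e i)) (hfree_gen C (e j)) (d i) `|1 - a i j|%N) =
  alg_serre a d (fun k => presented_gen urel (e k)) i j.
Proof.
rewrite /qserre raddf_sum; apply: eq_bigr => k _.
set x := hfree_gen C (e i); set y := hfree_gen C (e j); set n := `|_|%N.
have E : presented_pi urel (x ^+ (n - k) * y * x ^+ k) =
    presented_pi urel x ^+ (n - k) * presented_pi urel y * presented_pi urel x ^+ k.
  exact: eq_trans (presented_piM urel _ _) (f_equal2 *%R (eq_trans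
    (presented_piM urel _ _) (f_equal2 *%R (presented_piX urel x _) erefl))
    (presented_piX urel x _)).
exact: eq_trans (presented_piZ _ _ _) (congr1 _ E).
Qed.

Lemma uqE_serre i j : i != j -> alg_serre a d (fun k => E k) i j = 0.
Proof.
move=> nij; exact: eq_trans (esym (uq_serre_pi (fun k => inl (inl k)) i j))
  (presented_pi_rel (uq_serre_e C a d nij)).
Qed.

Lemma uqF_serre i j : i != j -> alg_serre a d (fun k => F k) i j = 0.
Proof.
move=> nij; exact: eq_trans (esym (uq_serre_pi (fun k => inl (inr k)) i j))
  (presented_pi_rel (uq_serre_f C a d nij)).
Qed.

Lemma counit_linear : linear (fun u : uh => uev (fun=> 0) u *: (1 : uq)).
Proof. by move=> c u v; rewrite linearP scalerDl -scalerA. Qed.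

Definition counit : {linear uh -> uq} := mk_linear counit_linear.

(** The projection e extends the counit, with e(x e_i) = e(x) e_i and e(f_i x) = 0: it is the
    projection along the triangular decomposition. *)
Lemma uq_np_split u n : Np u -> exists y z, [/\ Ap y, Np z & u = y + hbar C ^+ n *: z].
Proof.
have [||| e [eh eE _ eN]] := @whittaker_extension C r a d dat uq (fun i => rmul (E i)) (fun=> \0)
  (@uq_sep C r a d) _ (presented_sumP (rel := urel)) _ _ _ counit.
- by move=> i j p nij; exact: serre_op0.
- move=> i j p nij; apply: eq_trans (serre_op_rev_rmul a d (fun k => E k) i j p) _.
  by rewrite uqE_serre // mulr0.
- by move=> i j p /=; rewrite mul0r.
move: n; move: u.
suff H : forall u n, Np u -> exists y z, [/\ Ap y, Np z & u = y + hbar C ^+ n *: z] by [].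
apply: (@closed_subalg_split C _ urel _ e).
- exact: linearP.
- move=> y Ay; have e1 : e 1 = 1.
    transitivity (counit (1 : uh)); first by rewrite -eh uh_emb1.
    by rewrite -[LHS]/(uev (fun=> 0) (1 : uh) *: (1 : uq)) uev1 scale1r.
  (* Right linearity passes from generators to products, unlike the equation e y = y itself. *)
  suff H : forall x, e (x * y) = e x * y by rewrite -[y in LHS]mul1r H e1 mul1r.
  elim: {y} Ay => [_ [i ->]||c y _ IHy|y z _ IHy _ IHz|y z _ IHy _ IHz] x.
  + exact: eE.
  + by rewrite !mulr1.
  + rewrite -presented_scaleAr linearZZ IHy; exact: presented_scaleAr.
  + exact: eq_trans (congr1 e (mulrDr x y z)) (eq_trans (linearD e _ _)
      (eq_trans (f_equal2 +%R (IHy x) (IHz x)) (esym (mulrDr _ _ _)))).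
  by rewrite mulrA IHz IHy mulrA.
move=> x; apply: eN.
- exact: closed_subalg0.
- exact: closed_subalg_linear.
- exact: closed_subalg_sum.
- by move=> i p Np' /=; apply: closed_subalgMr => //; constructor; exists i.
- by move=> i p _; exact: closed_subalg0.
by move=> u; apply/closed_subalgZ/closed_subalg_incl/Subalg1.
Qed.

Lemma uq_nm_split u n : Nm u -> exists y z, [/\ Am y, Nm z & u = y + hbar C ^+ n *: z].
Proof.
have [||| e [eh _ eF eN]] := @whittaker_extension C r a d dat uq (fun=> \0) (fun i => lmul (F i))
  (@uq_sep C r a d) _ (presented_sumP (rel := urel)) _ _ _ counit.
- move=> i j p nij; apply: eq_trans (serre_op_lmul a d (fun k => F k) i j p) _.
  by rewrite uqF_serre // mul0r.
- by move=> i j p nij; exact: serre_op_rev0.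
- by move=> i j p /=; rewrite mulr0.
move: n; move: u.
suff H : forall u n, Nm u -> exists y z, [/\ Am y, Nm z & u = y + hbar C ^+ n *: z] by [].
apply: (@closed_subalg_split C _ urel _ e).
- exact: linearP.
- move=> y Ay; have e1 : e 1 = 1.
    transitivity (counit (1 : uh)); first by rewrite -eh uh_emb1.
    by rewrite -[LHS]/(uev (fun=> 0) (1 : uh) *: (1 : uq)) uev1 scale1r.
  suff H : forall x, e (y * x) = y * e x by rewrite -[y in LHS]mulr1 H e1 mulr1.
  elim: {y} Ay => [_ [i ->]||c y _ IHy|y z _ IHy _ IHz|y z _ IHy _ IHz] x.
  + exact: eF.
  + by rewrite !mul1r.
  + rewrite -presented_scaleAl linearZZ IHy; exact: presented_scaleAl.
  + exact: eq_trans (congr1 e (mulrDl y z x)) (eq_trans (linearD e _ _)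
      (eq_trans (f_equal2 +%R (IHy x) (IHz x)) (esym (mulrDl _ _ _)))).
  by rewrite -mulrA IHy IHz mulrA.
move=> x; apply: eN.
- exact: closed_subalg0.
- exact: closed_subalg_linear.
- exact: closed_subalg_sum.
- by move=> i p _; exact: closed_subalg0.
- by move=> i p Np' /=; apply: closed_subalgMl => //; constructor; exists i.
by move=> u; apply/closed_subalgZ/closed_subalg_incl/Subalg1.
Qed.

Variable om : rel 'I_r.
Local Notation pom := (pom C a d om).
Local Notation prel := (@pom_rel C r a d om).
Local Notation X i := (pomX C a d om i).
Variables chip chim : uq -> pom.
Hypothesis chipP : whittaker_char (@uqE C r a d) Np chip.
Hypothesis chimP : whittaker_char (@uqF C r a d) Nm chim.

Section Character.
Variables (g : 'I_r -> uq) (chi : uq -> pom).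
Local Notation Ag := (subalg_gen (fun u : uq => exists i, u = g i)).
Local Notation Ng := (closed_subalg_gen (fun u : uq => exists i, u = g i)).
Hypothesis chiP : whittaker_char g Ng chi.

Lemma char_gen i : Ng (g i).
Proof. by apply: closed_subalg_incl; constructor; exists i. Qed.

Lemma char_exp i n : Ng (g i ^+ n) /\ chi (g i ^+ n) = X i ^+ n.
Proof.
case: chiP => _ chi1 chiM chig; elim: n => [|n [Nn IHn]].
  by split; [apply/closed_subalg_incl/Subalg1 | rewrite chi1].
rewrite !exprS; split; first by apply: closed_subalgMl => //; constructor; exists i.
by rewrite chiM ?{}IHn ?chig -?exprSr ?exprS //; exact: char_gen.
Qed.

Lemma char0 : chi 0 = 0.
Proof.
case: chiP => chiL _ _ _; have N0 := closed_subalg0 (fun u : uq => exists i, u = g i).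
have := chiL 1 0 0 N0 N0; rewrite scale1r addr0 scale1r.
by move/(congr1 (fun p => p - chi 0)); rewrite subrr addrK.
Qed.

Lemma char_linear c u v : Ng u -> Ng v -> chi (c *: u + v) = c *: chi u + chi v.
Proof. by case: chiP => chiL _ _ _; exact: chiL. Qed.

(** chi is applied to the Serre relation; since it reverses products, the reversed Serre element
    comes out. *)
Lemma char_serre i j : alg_serre a d g i j = 0 -> alg_serre_rev a d (fun k => X k) i j = 0.
Proof.
move=> g0; case: chiP => _ chi1 chiM chig; rewrite -[RHS]char0 -g0 /alg_serre /alg_serre_rev.
set n := `|_|%N; pose y (k : nat) := g i ^+ (n - k) * g j * g i ^+ k.
have chiy k : Ng (y k) /\ chi (y k) = X i ^+ k * X j * X i ^+ (n - k).
  have [N1 c1] := char_exp i (n - k); have [N2 c2] := char_exp i k.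
  have N3 : Ng (g i ^+ (n - k) * g j).
    by apply: closed_subalgMr => //; constructor; exists j.
  have A2 : Ag (g i ^+ k).
    elim: (k : nat) => [|m IHm]; first exact: Subalg1.
    by rewrite exprS; apply: SubalgM => //; constructor; exists i.
  split; first exact: (closed_subalgMr N3 A2).
  rewrite [LHS](chiM _ _ N3 N2) c2 (chiM _ _ N1 (char_gen j)) chig c1.
  exact: mulrA.
have Ny (s : seq 'I_n.+1) (c : 'I_n.+1 -> hser C) : Ng (\sum_(k <- s) c k *: y k).
  elim: s => [|k s IHs]; first by rewrite big_nil; exact: closed_subalg0.
  by rewrite big_cons; apply: closed_subalg_linear => //; have [] := chiy k.
elim: (index_enum _) => [|k s IHs]; first by rewrite !big_nil char0.
have [Nk ck] := chiy k; rewrite !big_cons.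
exact: esym (eq_trans (char_linear _ Nk (Ny _ _))
  (f_equal2 +%R (congr1 _ ck) (esym IHs))).
Qed.

Hypothesis Ng_split : forall u n, Ng u ->
  exists y z, [/\ Ag y, Ng z & u = y + hbar C ^+ n *: z].

(** Equality on generators spreads to the algebraic subalgebra by induction and to its closure by
    approximation modulo hbar^n. *)
Lemma char_right (phi : {linear uq -> pom}) :
  (forall x i, phi (x * g i) = X i * phi x) ->
  forall u x, Ng u -> phi (x * u) = chi u * phi x.
Proof.
case: chiP => chiL chi1 chiM chig phig.
have phiA y : Ag y -> forall x, phi (x * y) = chi y * phi x.
  elim=> [_ [i ->]||c {}y Ay IHy|{}y z Ay IHy Az IHz|{}y z Ay IHy Az IHz] x.
  - by rewrite phig chig.
  - by rewrite mulr1 chi1 mul1r.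
  - have := char_linear c (closed_subalg_incl Ay) (closed_subalg0 _).
    rewrite char0 !addr0 => ->; rewrite -presented_scaleAr linearZZ IHy.
    exact: presented_scaleAl.
  - have := char_linear 1 (closed_subalg_incl Ay) (closed_subalg_incl Az).
    rewrite !scale1r => ->.
    exact: eq_trans (congr1 phi (mulrDr x y z)) (eq_trans (linearD phi _ _)
      (eq_trans (f_equal2 +%R (IHy x) (IHz x)) (esym (mulrDl _ _ _)))).
  rewrite (chiM _ _ (closed_subalg_incl Ay) (closed_subalg_incl Az)).
  by rewrite mulrA IHz IHy mulrA.
move=> u x Nu; apply/eqP; rewrite -subr_eq0; apply/eqP/presented_sep => n.
(* The remainder z lies again in the subalgebra, so chi(hbar^n z) = hbar^n chi(z) is available. *)
have [y [z [Ay Nz uE]]] := Ng_split n Nu.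
exists (phi (x * z) - chi z * phi x).
have cE : chi u = chi y + hbar C ^+ n *: chi z.
  by rewrite uE addrC (char_linear _ Nz (closed_subalg_incl Ay)) addrC.
have pE : phi (x * u) = chi y * phi x + hbar C ^+ n *: phi (x * z).
  rewrite -(phiA y Ay x) -linearZZ -linearD; congr (phi _).
  by rewrite uE mulrDr; congr (_ + _); exact: esym (presented_scaleAr _ _ _).
have dE : chi u * phi x = chi y * phi x + hbar C ^+ n *: (chi z * phi x).
  by rewrite cE mulrDl; congr (_ + _); exact: esym (presented_scaleAl _ _ _).
exact: eq_trans (f_equal2 (fun v w => v - w) pE dE)
  (eq_trans (addIB _ _ _) (esym (scalerBr _ _ _))).
Qed.

Lemma char_left (phi : {linear uq -> pom}) :
  (forall x i, phi (g i * x) = phi x * X i) ->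
  forall u x, Ng u -> phi (u * x) = phi x * chi u.
Proof.
case: chiP => chiL chi1 chiM chig phig.
have phiA y : Ag y -> forall x, phi (y * x) = phi x * chi y.
  elim=> [_ [i ->]||c {}y Ay IHy|{}y z Ay IHy Az IHz|{}y z Ay IHy Az IHz] x.
  - by rewrite phig chig.
  - by rewrite mul1r chi1 mulr1.
  - have := char_linear c (closed_subalg_incl Ay) (closed_subalg0 _).
    rewrite char0 !addr0 => ->; rewrite -presented_scaleAl linearZZ IHy.
    exact: presented_scaleAr.
  - have := char_linear 1 (closed_subalg_incl Ay) (closed_subalg_incl Az).
    rewrite !scale1r => ->.
    exact: eq_trans (congr1 phi (mulrDl y z x)) (eq_trans (linearD phi _ _)
      (eq_trans (f_equal2 +%R (IHy x) (IHz x)) (esym (mulrDr _ _ _)))).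
  rewrite (chiM _ _ (closed_subalg_incl Ay) (closed_subalg_incl Az)).
  by rewrite -mulrA IHy IHz mulrA.
move=> u x Nu; apply/eqP; rewrite -subr_eq0; apply/eqP/presented_sep => n.
have [y [z [Ay Nz uE]]] := Ng_split n Nu.
exists (phi (z * x) - phi x * chi z).
have cE : chi u = chi y + hbar C ^+ n *: chi z.
  by rewrite uE addrC (char_linear _ Nz (closed_subalg_incl Ay)) addrC.
have pE : phi (u * x) = phi x * chi y + hbar C ^+ n *: phi (z * x).
  rewrite -(phiA y Ay x) -linearZZ -linearD; congr (phi _).
  by rewrite uE mulrDl; congr (_ + _); exact: esym (presented_scaleAl _ _ _).
have dE : phi x * chi u = phi x * chi y + hbar C ^+ n *: (phi x * chi z).
  by rewrite cE mulrDr; congr (_ + _); exact: esym (presented_scaleAr _ _ _).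
exact: eq_trans (f_equal2 (fun v w => v - w) pE dE)
  (eq_trans (addIB _ _ _) (esym (scalerBr _ _ _))).
Qed.
End Character.

(** The extension is taken with [xp i] and [xm i] the left and right multiplications by x_i, which
    commute by associativity. *)
Lemma whittaker_restr_surj (psi : afun_h C a d om) :
  exists phi : afun_g C a d om, whittaker chip chim phi /\ restr_h phi = psi.
Proof.
have [||| phi [phih phiE phiF _]] := @whittaker_extension C r a d dat pom
  (fun i => lmul (X i)) (fun i => rmul (X i))
  (@presented_sep C _ prel) _ (presented_sumP (rel := prel)) _ _ _ psi.
- move=> i j p nij; apply: eq_trans (serre_op_rmul a d (fun k => X k) i j p) _.
  by rewrite (char_serre chimP (uqF_serre nij)) mulr0.
- move=> i j p nij; apply: eq_trans (serre_op_rev_lmul a d (fun k => X k) i j p) _.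
  by rewrite (char_serre chipP (uqE_serre nij)) mul0r.
- by move=> i j p; exact: mulrA.
exists phi; split; last by apply: afun_h_ext => u; exact: phih.
move=> am ap x Nam Nap.
rewrite (char_right chipP (fun u n => @uq_np_split u n) phiE _ Nap).
rewrite (char_left chimP (fun u n => @uq_nm_split u n) phiF _ Nam).
exact: mulrA.
Qed.
End Characters.

(** * Normal forms and difference operators *)

Lemma big_tuple_bool (V : nmodType) n (F : n.+1.-tuple bool -> V) :
  \sum_b F b = \sum_(b : n.-tuple bool) (F [tuple of true :: b] + F [tuple of false :: b]).
Proof.
rewrite (reindex (fun p : bool * n.-tuple bool => [tuple of p.1 :: p.2])) /=.
  rewrite -(pair_bigA _ (fun (x : bool) (b : n.-tuple bool) => F [tuple of x :: b])) /= big_bool.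
  by rewrite -big_split.
exists (fun b => (thead b, [tuple of behead b])) => [[x b] _|b _] /=.
  by congr (_, _); apply: val_inj.
by rewrite -tuple_eta.
Qed.

Section ExpSpan.
Variables (C : numFieldType) (r : nat).
Local Notation uh := (uh C r).
Implicit Types (g u : uh) (s : seq (hser C * 'rV[C]_r)).

Definition exp_comb s : uh := \sum_(cb <- s) cb.1 *: uh_exp cb.2.

(* The elements of the C((hbar))-span of the exponentials that lie in U_hbar(h). *)
Definition exp_span g : Prop := exists N s, hbar C ^+ N *: g = exp_comb s.

Lemma uh_expD (x y : 'rV[C]_r) : uh_exp (x + y) = uh_exp x * uh_exp y.
Proof.
have -> : uh_exp (x + y) = hexp (hlin x + hlin y).
  rewrite /uh_exp; congr hexp; rewrite /hlin -big_split; apply: eq_bigr => i _ /=.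
  by rewrite mxE scalerDl.
by apply: (@hexpD C (mpoly r C)); rewrite /GRing.comm mulrC.
Qed.

Lemma exp_comb_mul s1 s2 : exp_comb s1 * exp_comb s2 =
  exp_comb [seq (c1.1 * c2.1, c1.2 + c2.2) | c1 <- s1, c2 <- s2].
Proof.
rewrite /exp_comb big_allpairs_dep mulr_suml; apply: eq_bigr => c1 _.
rewrite mulr_sumr; apply: eq_bigr => c2 _ /=.
by rewrite uh_expD -scalerAl -scalerAr scalerA.
Qed.

Lemma exp_span_exp x : exp_span (uh_exp x).
Proof.
by exists 0, [:: (1, x)]; rewrite expr0 scale1r /exp_comb big_seq1 scale1r.
Qed.

Lemma exp_span1 : exp_span 1.
Proof.
have -> : (1 : uh) = uh_exp (0 : 'rV[C]_r).
  rewrite /uh_exp /hlin big1 => [|i _]; last by rewrite mxE scale0r.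
  exact: esym (@hexp0 C (mpoly r C)).
exact: exp_span_exp.
Qed.

Lemma exp_spanM g1 g2 : exp_span g1 -> exp_span g2 -> exp_span (g1 * g2).
Proof.
move=> [N1 [s1 E1]] [N2 [s2 E2]].
exists (N1 + N2)%N, [seq (c1.1 * c2.1, c1.2 + c2.2) | c1 <- s1, c2 <- s2].
by rewrite -exp_comb_mul -E1 -E2 -scalerAl -scalerAr scalerA exprD.
Qed.

Lemma ushiftZ lam c u : ushift lam (c *: u) = c *: ushift lam u.
Proof. exact: linearZZ. Qed.

Lemma exp_span_shift lam g : exp_span g -> exp_span (ushift lam g).
Proof.
move=> [N [s E]].
exists N, (map (fun cb : hser C * 'rV[C]_r =>
  (cb.1 * kexp (\sum_i cb.2 0 i * lam i), cb.2)) s).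
rewrite /exp_comb big_map -ushiftZ E /exp_comb linear_sum; apply: eq_bigr => cb _.
by rewrite /= ushiftZ ushift_exp scalerA.
Qed.

Lemma uevXM lam k u :
  uev lam (uconst 'X_k * u) = hconst (lam k) * (uev lam u : hser C).
Proof.
apply: funext => n; rewrite hconst_mul /uev.
have -> : (uconst 'X_k * u : uh) n = 'X_k * u n by exact: hconst_mul.
by rewrite mevalM mevalXU.
Qed.

(** Expansion of the product of the h_i + lam_i. Dually, composition with the shift multiplies a
    function by the character [uev lam], in the format of [diff_op]. *)
Lemma ushift_word lam (w : seq 'I_r) : ushift lam (uh_word C w) =
  \sum_(b : (size w).-tuple bool) (uev lam (uh_word C (mask b w)) : hser C) *:
     uh_word C (mask (map negb b) w).
Proof.
elim: w => [|i w IHw].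
  rewrite uh_word0 ushift1 (big_pred1 [tuple]) => [|b]; last first.
    by apply/esym/eqP; rewrite (tuple0 b); apply: val_inj.
  by rewrite /= uh_word0 uev1 scale1r.
rewrite uh_word_cons ushiftM ushift_X {}IHw mulrDl -scalerAl mul1r.
rewrite (big_tuple_bool (fun b : (size (i :: w)).-tuple bool => _)) big_split /=.
rewrite scaler_sumr mulr_sumr; congr (_ + _); apply: eq_bigr => b _.
  rewrite scalerA; congr (_ *: _).
  by rewrite uh_word_cons uevXM.
by rewrite uh_word_cons -scalerAr.
Qed.
End ExpSpan.

(** * Normal forms of noncommutative polynomials in the generators *)

Section Representation.
Variables (C : numFieldType) (r : nat) (a : 'M[int]_r) (d : 'I_r -> nat).
Hypothesis dat : cartan_datum a d.
Local Notation uq := (uq C a d).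
Local Notation uh := (uh C r).
Local Notation E i := (uqE C a d i).
Local Notation F i := (uqF C a d i).
Local Notation tau u := (uh_emb a d (u : uh)).

Lemma uh_exp_row c i : uh_exp (\row_k (c *+ (k == i))) = hexp (c *: 'X_i : mpoly r C).
Proof.
rewrite /uh_exp; congr hexp; rewrite /hlin (bigD1 i) //= mxE eqxx big1 ?addr0 //.
by move=> k /negbTE nki; rewrite mxE nki scale0r.
Qed.

(** The source of the denominators in [exp_span]: only hbar [e_i, f_i] is a C[[hbar]]-combination of
    K_i and K_i^-1. *)
Lemma exp_span_kap i : exp_span (uhkap C d i).
Proof.
exists 1%N, [:: (hser_recip (qunit C d i), \row_k ((d i)%:R *+ (k == i)));
  (- hser_recip (qunit C d i), \row_k (- (d i)%:R *+ (k == i)))].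
rewrite expr1 /exp_comb big_cons big_seq1 /= !uh_exp_row scaleNr -scalerBr.
have d0 := cartan_pos dat i; have := uhkapE C d0.
move/(congr1 (fun u => hser_recip (qunit C d i) *: u)).
by rewrite qunitE scalerA mulrCA hser_recip_qunit // mulr1.
Qed.

Definition Fword (w : seq 'I_r) : uq := \prod_(i <- w) F i.
Definition Eword (w : seq 'I_r) : uq := \prod_(i <- w) E i.

Inductive normal_form : uq -> Prop :=
| NfWord w g v of exp_span g : normal_form (Fword w * tau g * Eword v)
| NfD y z of normal_form y & normal_form z : normal_form (y + z)
| NfZ (c : hser C) y of normal_form y : normal_form (c *: y).

Lemma emb_Fword w (u : uh) : tau u * Fword w = Fword w * tau (wshift a w u).
Proof.
elim: w u => [|i w IHw] u; first by rewrite /Fword big_nil mulr1 mul1r.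
rewrite /Fword big_cons -/(Fword w).
exact: eq_trans (mulrA _ _ _) (eq_trans (congr1 ( *%R^~ _) (uq_emb_F a d i u))
  (eq_trans (esym (mulrA _ _ _)) (eq_trans (congr1 ( *%R _) (IHw _)) (mulrA _ _ _)))).
Qed.

Lemma exp_span_wshift w (g : uh) : exp_span g -> exp_span (wshift a w g).
Proof. by elim: w g => //= i w IHw g Gg; apply/IHw/exp_span_shift. Qed.

Lemma nf_F i y : normal_form y -> normal_form (F i * y).
Proof.
elim=> [w g v Gg|{}y z _ IHy _ IHz|c {}y _ IHy].
- have -> : F i * (Fword w * tau g * Eword v) = Fword (i :: w) * tau g * Eword v.
    by rewrite /Fword big_cons !mulrA.
  exact: NfWord.
- by rewrite mulrDr; apply: NfD.
by rewrite -presented_scaleAr; apply: NfZ.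
Qed.

Lemma nf_emb (h : uh) y : exp_span h -> normal_form y -> normal_form (tau h * y).
Proof.
move=> Gh; elim=> [w g v Gg|{}y z _ IHy _ IHz|c {}y _ IHy].
- have -> : tau h * (Fword w * tau g * Eword v) = Fword w * tau (wshift a w h * g) * Eword v.
    by rewrite !mulrA emb_Fword uh_embM !mulrA.
  by apply/NfWord/exp_spanM => //; exact: exp_span_wshift.
- by rewrite mulrDr; apply: NfD.
by rewrite -presented_scaleAr; apply: NfZ.
Qed.

Lemma uqE_FM i j (y : uq) : E i * (F j * y) =
  F j * (E i * y) + (if i == j then tau (uhkap C d i) else 0) * y.
Proof. by rewrite mulrA (uqEF C a j (cartan_pos dat i)) mulrDl -mulrA. Qed.

(** e_i moves right through the f_j, each crossing leaving at most a factor [e_i, f_i] of the Cartan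
    part, and then through g at the cost of a shift. *)
Lemma nf_E i y : normal_form y -> normal_form (E i * y).
Proof.
elim=> [w g v Gg|{}y z _ IHy _ IHz|c {}y _ IHy].
- elim: w => [|j w IHw].
    have -> : E i * (Fword [::] * tau g * Eword v) =
        Fword [::] * tau (ushift (wt C a i) g) * Eword (i :: v).
      rewrite /Fword big_nil [X in _ * (X * _)]mul1r [X in _ = X * _]mul1r.
      rewrite /Eword big_cons.
      exact: eq_trans (mulrA _ _ _) (eq_trans (congr1 ( *%R^~ _) (uqE_emb a d i g))
        (esym (mulrA _ _ _))).
    by apply/NfWord/exp_span_shift.
  have Fj : Fword (j :: w) * tau g * Eword v = F j * (Fword w * tau g * Eword v).
    rewrite /Fword big_cons.
    exact: eq_trans (congr1 ( *%R^~ _) (esym (mulrA _ _ _))) (esym (mulrA _ _ _)).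
  apply: (eq_ind_r normal_form _ (eq_trans (congr1 ( *%R _) Fj) (uqE_FM i j _))).
  apply: NfD; first exact: nf_F.
  case: eqP => _; first by apply: nf_emb; [exact: exp_span_kap | exact: NfWord].
  rewrite mul0r -(scale0r (Fword w * tau g * Eword v)); exact/NfZ/NfWord.
- by rewrite mulrDr; apply: NfD.
by rewrite -presented_scaleAr; apply: NfZ.
Qed.

Lemma nf_poly y : uq_poly y -> normal_form y.
Proof.
(* Stability under left multiplication, applied to z = 1, makes the case of products immediate. *)
suff H : uq_poly y -> forall z, normal_form z -> normal_form (y * z).
  move=> Py; rewrite -[y]mulr1; apply: H => //.
  have -> : (1 : uq) = Fword [::] * tau (1 : uh) * Eword [::].
    by rewrite /Fword /Eword !big_nil uh_emb1 !mulr1.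
  exact/NfWord/exp_span1.
elim=> [_ [[x ->]|[i [->|->]]]||c {}y _ IHy|{}y z _ IHy _ IHz|{}y z _ IHy _ IHz] z' nz.
- exact/nf_emb/nz/exp_span_exp.
- exact: nf_E.
- exact: nf_F.
- by rewrite mul1r.
- by rewrite -presented_scaleAl; apply/NfZ/IHy.
- by rewrite mulrDl; apply: NfD; [exact: IHy | exact: IHz].
by rewrite -mulrA; apply/IHy/IHz.
Qed.
End Representation.

(** * Difference operators attached to normal forms *)

Section DifferenceOperators.
Variables (C : numFieldType) (r : nat) (a : 'M[int]_r) (d : 'I_r -> nat).
Hypothesis dat : cartan_datum a d.
Variable om : rel 'I_r.
Local Notation uq := (uq C a d).
Local Notation uh := (uh C r).
Local Notation pom := (pom C a d om).
Local Notation tau u := (uh_emb a d (u : uh)).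
Variables chip chim : uq -> pom.

Lemma shift_mul_linear lam (g : uh) : linear (fun u : uh => ushift lam u * g).
Proof. by move=> c u v; rewrite linearP mulrDl -scalerAl. Qed.

(** For hbar^N g = sum c_k e^(hbar be_k), the coefficient functions are f_k = c_k [uev lam]. *)
Lemma diff_op_shift lam (g : uh) :
  exp_span g -> diff_op (mk_linear (shift_mul_linear lam g)).
Proof.
move=> [N [s Eg]].
have fL (c : hser C) : linear (fun u : uh => c *: uev lam u : (hser C)^o).
  by move=> c' u v; rewrite linearP scalerDr !scalerA mulrC.
exists N, (size s), (fun k => mk_linear (fL (nth (0, 0) s k).1)),
  (fun k => (nth (0, 0) s k).2) => w.
rewrite /= ushift_word.
have -> : hbar C ^+ N *: ((\sum_(b : (size w).-tuple bool)
    (uev lam (uh_word C (mask b w)) : hser C) *: uh_word C (mask (map negb b) w)) * g) =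
  (\sum_(b : (size w).-tuple bool)
    (uev lam (uh_word C (mask b w)) : hser C) *: uh_word C (mask (map negb b) w)) * exp_comb s.
  by rewrite -Eg scalerAr.
rewrite /exp_comb (big_nth (0, 0)) big_mkord mulr_sumr; apply: eq_bigr => k _.
rewrite mulr_suml; apply: eq_bigr => b _.
by rewrite -scalerAl -scalerAr scalerA mulrC.
Qed.

Definition representable (Y : uq) : Prop :=
  exists n (T : 'I_n -> {linear uh -> uh}) (x y : 'I_n -> pom),
    (forall k, diff_op (T k)) /\
    forall phi : afun_g C a d om, whittaker chip chim phi -> forall u : uh,
      phi (tau u * Y) = \sum_k x k * phi (tau (T k u)) * y k.

Lemma representableZ c Y : representable Y -> representable (c *: Y).
Proof.
move=> [n [T [x [y [dT TY]]]]]; exists n, T, (fun k => c *: x k), y.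
split; [exact: dT | move=> phi wphi u].
rewrite -presented_scaleAr linearZZ (TY phi wphi u) scaler_sumr.
apply: eq_bigr => k _.
exact: eq_trans (presented_scaleAl _ _ _) (congr1 ( *%R^~ _) (presented_scaleAl _ _ _)).
Qed.

Lemma representableD Y Y' : representable Y -> representable Y' -> representable (Y + Y').
Proof.
move=> [n [T [x [y [dT TY]]]]] [n' [T' [x' [y' [dT' TY']]]]].
exists (n + n')%N, (fun k => match split k with inl i => T i | inr i => T' i end),
  (fun k => match split k with inl i => x i | inr i => x' i end),
  (fun k => match split k with inl i => y i | inr i => y' i end); split.
  by move=> k; case: split.
move=> phi wphi u.
apply: eq_trans (congr1 phi (mulrDr _ _ _)) (eq_trans (linearD phi _ _) _).
apply: eq_trans (f_equal2 +%R (TY phi wphi u) (TY' phi wphi u)) _.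
rewrite big_split_ord; apply: f_equal2; apply: eq_bigr => k _.
  by rewrite (unsplitK (inl k)).
by rewrite (unsplitK (inr k)).
Qed.

Lemma representable_word w (g : uh) v :
  exp_span g -> representable (Fword C a d w * tau g * Eword C a d v).
Proof.
have Nw (e : 'I_r -> uq) s :
    closed_subalg_gen (fun u : uq => exists i, u = e i) (\prod_(i <- s) e i).
  apply: closed_subalg_incl; elim: s => [|i s IHs]; first by rewrite big_nil; exact: Subalg1.
  by rewrite big_cons; apply: SubalgM => //; constructor; exists i.
move=> Gg.
have sL : linear (fun u : uh => wshift a w u * g).
  by move=> c u v'; rewrite wshift_linear mulrDl -scalerAl.
exists 1%N, (fun=> mk_linear sL), (fun=> chip (Eword C a d v)),
  (fun=> chim (Fword C a d w)); split; last first.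
  move=> phi wphi u; rewrite big_ord1 /=.
  have uFE : tau u * (Fword C a d w * tau g * Eword C a d v) =
      Fword C a d w * tau (wshift a w u * g) * Eword C a d v.
    apply: eq_trans (mulrA _ _ _) (congr1 ( *%R^~ _) _).
    exact: eq_trans (mulrA _ _ _) (eq_trans (congr1 ( *%R^~ _) (emb_Fword a d w u))
      (eq_trans (esym (mulrA _ _ _)) (congr1 ( *%R _) (esym (uh_embM a d _ _))))).
  exact: eq_trans (congr1 phi uFE) (wphi _ _ _ (Nw _ w) (Nw _ v)).
move=> _.
(* The shift by a word is a single shift, by the sum of the weights of its letters. *)
have [lam lamE] : exists lam : 'I_r -> C, forall u : uh, wshift a w u = ushift lam u.
  elim: w {sL} => [|i w [lam IHw]]; first by exists (fun=> 0) => u /=; rewrite ushift0.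
  by exists (fun k => lam k + wt C a i k) => u /=; rewrite IHw ushift_comp.
have [N [n [f [be Tf]]]] := diff_op_shift lam Gg.
by exists N, n, f, be => w'; rewrite /= lamE; exact: Tf.
Qed.

Lemma representable_poly Y : uq_poly Y -> representable Y.
Proof.
move/(nf_poly dat); elim=> [w g v Gg|y z _ IHy _ IHz|c y _ IHy].
- exact: representable_word.
- exact: representableD.
exact: representableZ.
Qed.

Lemma represents_exists Y : uq_poly Y ->
  exists D : afun_h C a d om -> afun_h C a d om, represents chip chim Y D.
Proof.
move=> /representable_poly [n [T [x [y [dT TY]]]]].
have DL (psi : afun_h C a d om) :
    linear (fun u : uh => \sum_k x k * psi (T k u) * y k : pom).
  move=> c u v; rewrite scaler_sumr -big_split; apply: eq_bigr => k _ /=.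
  rewrite !linearP mulrDr mulrDl; congr (_ + _).
  apply: eq_trans (congr1 ( *%R^~ _) (esym (presented_scaleAr _ _ _))) _.
  exact: esym (presented_scaleAl _ _ _).
exists (fun psi => mk_linear (DL psi)); split; first by exists n, T, x, y.
by move=> phi wphi; apply: afun_h_ext => u; exact: TY.
Qed.
End DifferenceOperators.

(** * Cartan matrices *)

Section CartanMatrix.
Variables (K : numFieldType) (L : vectType K) (br : L -> L -> L).
Hypothesis brP : lie_bracket br.

Lemma brZl c x z : br (c *: x) z = c *: br x z.
Proof.
case: brP => brL _ _ _; have b0 : br 0 z = 0.
  have := brL 1 0 0 z; rewrite !scale1r addr0.
  by move/(congr1 (fun t => t - br 0 z)); rewrite addrK subrr.
by rewrite -[c *: x]addr0 brL b0 addr0.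
Qed.

Lemma br0r z : br z 0 = 0.
Proof.
case: brP => _ brR _ _; have := brR 1 0 0 z; rewrite !scale1r addr0.
by move/(congr1 (fun t => t - br z 0)); rewrite addrK subrr.
Qed.

Lemma brZr c x z : br z (c *: x) = c *: br z x.
Proof. by case: brP => _ brR _ _; rewrite -[c *: x]addr0 brR br0r addr0. Qed.

Lemma brDr x y z : br z (x + y) = br z x + br z y.
Proof. by case: brP => _ brR _ _; rewrite -[x]scale1r brR !scale1r. Qed.

Lemma brDl x y z : br (x + y) z = br x z + br y z.
Proof. by case: brP => brL _ _ _; rewrite -[x]scale1r brL !scale1r. Qed.

Lemma brC x y : br x y = - br y x.
Proof.
case: brP => _ _ brxx _; apply/eqP; rewrite -addr_eq0; apply/eqP.
by have := brxx (x + y); rewrite brDl !brDr !brxx add0r addr0.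
Qed.

Lemma br_derivation x y z : br x (br y z) = br (br x y) z + br y (br x z).
Proof.
case: brP => _ _ _ jacobi; have := jacobi x y z.
rewrite [br z x]brC [br z (br x y)]brC -scaleN1r brZr scaleN1r.
by move/eqP; rewrite -addrA -opprD subr_eq0 => /eqP ->; rewrite addrC.
Qed.

Variables (e f h v : L) (m : K).
Hypothesis he : br h e = 2%:R *: e.
Hypothesis ef : br e f = h.
Hypothesis hv : br h v = m *: v.
Hypothesis fv : br f v = 0.
Hypothesis v0 : v != 0.

Let vk k := iter k (br e) v.

Lemma string_weight k : br h (vk k) = (m + 2%:R * k%:R) *: vk k.
Proof.
elim: k => [|k IHk]; first by rewrite mulr0 addr0.
rewrite /vk iterS -/(vk k) br_derivation he brZl IHk brZr -scalerDl -natr1.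
by congr (_ *: _); ring.
Qed.

Lemma string_lower k :
  br f (vk k.+1) = - (k.+1%:R * (m + k%:R)) *: vk k.
Proof.
have fe : br f e = - h by rewrite brC ef.
elim: k => [|k IHk].
  rewrite /vk /= br_derivation fe fv -[- h]scaleN1r brZl hv.
  by rewrite br0r addr0 scalerA; congr (_ *: _); ring.
rewrite {1}/vk iterS -/(vk k.+1) br_derivation fe -[- h]scaleN1r brZl.
rewrite string_weight IHk brZr -[br e (vk k)]/(vk k.+1) scalerA -scalerDl.
by congr (_ *: _); rewrite -!natr1; ring.
Qed.

(** The h-eigenvalues m + 2k are distinct; subtracting the last eigenvalue from ad h kills the last
    term and leaves a shorter relation. *)
Lemma string_free n (c : nat -> K) : (forall k, (k < n)%N -> vk k != 0) ->
  \sum_(k < n) c k *: vk k = 0 -> forall k, (k < n)%N -> c k = 0.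
Proof.
elim: n c => // n IHn c nz sum0.
pose lam k : K := m + 2%:R * k%:R.
have c0 k : (k < n)%N -> c k = 0.
  move=> ltkn; apply/eqP; have : c k * (lam k - lam n) == 0.
    apply/eqP; apply: (IHn (fun k => c k * (lam k - lam n))) ltkn.
      by move=> k' ltk'n; apply/nz/ltnW.
    have : br h (\sum_(k < n.+1) c k *: vk k) - lam n *: (\sum_(k < n.+1) c k *: vk k) = 0.
      by rewrite sum0 scaler0 subr0 br0r.
    rewrite (big_morph _ (fun x y => brDr x y h) (id1 := 0)); last exact: br0r.
    rewrite scaler_sumr -sumrB big_ord_recr /= => {2}<-.
    rewrite brZr string_weight !scalerA mulrC subrr addr0.
    apply: eq_bigr => i _; rewrite brZr string_weight !scalerA -scalerBl.
    by congr (_ *: _); rewrite mulrBr [lam n * _]mulrC.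
  rewrite mulf_eq0 => /orP[//|]; rewrite /lam opprD addrACA subrr add0r -mulrBr.
  by rewrite mulf_eq0 pnatr_eq0 /= subr_eq0 eqr_nat ltn_eqF.
move=> k; rewrite ltnS leq_eqVlt => /orP[/eqP->|]; last exact: c0.
move: sum0; rewrite big_ord_recr /= big1 => [|i _]; last by rewrite c0 ?scale0r.
by rewrite add0r => /eqP; rewrite scaler_eq0 (negbTE (nz n _)) // orbF => /eqP.
Qed.

(** In finite dimension the string ends. At its last nonzero vector v_n, [string_lower] reads 0 =
    (n+1)(m+n) v_n. *)
Lemma string_weight_nat : exists n : nat, m = - n%:R.
Proof.
have [n vn0] : exists n, vk n = 0.
  apply: contrapT => nz; pose N := (\dim (fullv : {vspace L})).+1.
  have vnz k : vk k != 0 by apply/eqP => vk0; apply: nz; exists k.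
  pose X := [tuple vk i | i < N].
  have : free X.
    apply/freeP => c sum0 i; pose c' k := if insub k is Some j then c j else 0.
    have c'E (j : 'I_N) : c' j = c j by rewrite /c' valK.
    rewrite -c'E; apply: (@string_free N) => //.
    by rewrite -[RHS]sum0; apply: eq_bigr => j _; rewrite c'E -tnth_nth tnth_mktuple.
  rewrite /free => /eqP dimX; have := dimvS (subvf <<X>>%VS).
  by rewrite dimX size_tuple ltnn.
have : vk n == 0 by apply/eqP.
elim: n {vn0} => [|n IHn]; first by rewrite /vk /= (negbTE v0).
have [vn0 _|vn vSn] := boolP (vk n == 0); first exact: IHn.
exists n; have := string_lower n; rewrite (eqP vSn) br0r.
move/esym/eqP; rewrite scaler_eq0 (negbTE vn) orbF oppr_eq0 mulf_eq0 pnatr_eq0 /=.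
by rewrite addr_eq0 => /eqP.
Qed.
End CartanMatrix.

Section CartanDatum.
Variables (K : numFieldType) (L : vectType K) (br : L -> L -> L) (H : {vspace L}).
Variables (r : nat) (a : 'M[int]_r) (d : 'I_r -> nat).

Lemma sum_delta (F : 'I_r -> K) j : \sum_k (k == j)%:R * F k = F j.
Proof.
rewrite (bigD1 j) //= eqxx mul1r big1 ?addr0 // => k /negbTE ->.
by rewrite mul0r.
Qed.

(** For i != j, a root vector v of al_j is a lowest weight vector for the sl_2 of al_i, because al_j
    - al_i is not a root; its weight al_j(h_i) = a_ij is then minus a natural number. *)
Lemma cartan_matrix_datum : lie_bracket br -> cartan_matrix br H a ->
  symmetrizer a d -> cartan_datum a d.
Proof.
move=> brP [al [h [[roots al_free pos_neg] coroots alh]]] [d123 _ dsym].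
split=> // [i|i j nij|i]; last by have := d123 i; rewrite !inE; case: (d i).
  have [_ al2 _] := coroots i; apply/eqP; rewrite -(eqr_int K).
  by rewrite -alh al2.
have [hiH al2 [e [f [ehi fhi ef]]]] := coroots i.
have [_ [v v0 vj]] := roots j.
have fv0 : br f v = 0.
  apply/eqP; apply/negP => /negP fv.
  pose be : {linear L -> K^o} := al j \- al i.
  have be_root : lie_root br H be.
    split.
      apply: contrapT => nex; have := al_free (fun k => (k == j)%:R - (k == i)%:R).
      have sum0 : {in H, forall x, \sum_k ((k == j)%:R - (k == i)%:R) * al k x = 0}.
        move=> x xH; under eq_bigr do rewrite mulrBl.
        rewrite sumrB !sum_delta; apply: contrapT => /eqP bex.
        by apply: nex; exists x.
      by move/(_ sum0 j)/eqP; rewrite eqxx (eq_sym j i) (negbTE nij) subr0 oner_eq0.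
    exists (br f v) => // x xH; rewrite (br_derivation brP) (fhi x xH) (vj x xH).
    rewrite (brZl brP) (brZr brP) -scalerDl; congr (_ *: _).
    by rewrite /= addrC.
  (* By independence of the simple roots, the coefficient n_i + 1 of al_i would have to vanish in
     the positive case, and n_j + 1 of al_j in the negative one. *)
  have [n [] ben] := pos_neg be be_root.
    have sum0 : {in H, forall x,
        \sum_k ((n k)%:R - (k == j)%:R + (k == i)%:R) * al k x = 0}.
      move=> x xH; under eq_bigr do rewrite mulrDl mulrBl.
      by rewrite big_split sumrB /= !sum_delta -ben // /be /= addrAC subrK subrr.
    have /eqP := al_free _ sum0 i; rewrite eqxx (negbTE nij) subr0 natr1.
    by rewrite pnatr_eq0.
  have sum0 : {in H, forall x,
      \sum_k ((n k)%:R + (k == j)%:R - (k == i)%:R) * al k x = 0}.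
    move=> x xH; under eq_bigr do rewrite mulrBl mulrDl.
    rewrite sumrB big_split /= !sum_delta.
    have -> : \sum_k (n k)%:R * al k x = - be x by rewrite ben // opprK.
    by rewrite /be /= opprB subrK subrr.
  have /eqP := al_free _ sum0 j; rewrite eqxx (eq_sym j i) (negbTE nij) subr0 natr1.
  by rewrite pnatr_eq0.
have [n mn] := string_weight_nat brP
  (eq_trans (ehi _ hiH) (congr1 ( *:%R^~ e) al2)) ef (vj _ hiH) fv0 v0.
have aij : a i j = - n%:Z.
  by apply/eqP; rewrite -(eqr_int K) -alh mn rmorphN.
by rewrite aij oppr_le0.
Qed.
End CartanDatum.

(** * Central elements and the conclusion *)

Lemma mul4_comm (A : pzRingType) (u x v y : A) :
  y * v = v * y -> u * x * v * y = u * (x * y) * v.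
Proof. by move=> yv; rewrite -[LHS]mulrA -yv !mulrA. Qed.

Lemma LactE (C : fieldType) r (a : 'M[int]_r) d om Y (phi : afun_g C a d om) u :
  Lact Y phi u = phi (u * Y).
Proof. by rewrite /Lact /= /Lact_fun. Qed.

(** Y multiplies the argument on the right, beyond a_+; centrality moves it back next to x. *)
Lemma Lact_whittaker (C : fieldType) r (a : 'M[int]_r) d om
    (chip chim : uq C a d -> pom C a d om) Y phi :
  uq_central Y -> whittaker chip chim phi -> whittaker chip chim (Lact Y phi).
Proof.
move=> cY wphi am ap x Nam Nap; rewrite 2!LactE.
apply: eq_trans (wphi am ap (x * Y) Nam Nap).
have yv : Y * ap = ap * Y by exact: cY.
exact: congr1 (mul4_comm am x yv).
Qed.

Lemma LactM (C : fieldType) r (a : 'M[int]_r) d om Y Y' (phi : afun_g C a d om) u :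
  Lact (Y * Y') phi u = Lact Y (Lact Y' phi) u.
Proof. by rewrite 3!LactE; exact: congr1 (mulrA _ _ _). Qed.

Theorem proposition3p2 (R : realType) (L : vectType R[i]) (br : L -> L -> L)
    (H : {vspace L}) (r : nat) (a : 'M[int]_r) (d : 'I_r -> nat)
    (om : rel 'I_r) (chip chim : uq R[i] a d -> pom R[i] a d om)
    (br_simple : simple_lie br)
    (H_cartan : cartan_subalgebra br H)
    (a_cartan : cartan_matrix br H a)
    (d_symm : symmetrizer a d)
    (om_orient : orientation a om)
    (chip_char : whittaker_char (@uqE R[i] r a d) (@uq_np R[i] r a d) chip)
    (chim_char : whittaker_char (@uqF R[i] r a d) (@uq_nm R[i] r a d) chim) :
  (forall Y : uq R[i] a d, uq_poly Y ->
     exists! D : afun_h R[i] a d om -> afun_h R[i] a d om,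
       represents chip chim Y D)
  /\
  (forall Y Y' : uq R[i] a d, uq_poly Y -> uq_poly Y' ->
     uq_central Y -> uq_central Y' ->
     forall DY DY' DYY' : afun_h R[i] a d om -> afun_h R[i] a d om,
       represents chip chim Y DY -> represents chip chim Y' DY' ->
       represents chip chim (Y * Y') DYY' -> DYY' = DY \o DY').
Proof.
have [brP _ _] := br_simple.
have dat : cartan_datum a d := cartan_matrix_datum brP a_cartan d_symm.
have surj psi := @whittaker_restr_surj R[i] r a d dat om chip chim chip_char chim_char psi.
split=> [Y PY|Y Y' _ _ _ cY' DY DY' DYY' [_ DYE] [_ DYE'] [_ DYYE]].
  have [D DP] := @represents_exists R[i] r a d dat om chip chim Y PY.
  exists D; split; first exact: DP.
  (* Every psi is a restriction, so both operators have prescribed values on it. *)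
  move=> D' [_ DE']; apply: funext => psi.
  have [phi [wphi <-]] := surj psi.
  by case: DP => _ DE; exact: eq_trans (esym (DE phi wphi)) (DE' phi wphi).
(* L(YY') = L(Y) L(Y'), and L(Y') phi is again a Whittaker function, so the defining property of D_Y
   applies to it. *)
apply: funext => psi; have [phi [wphi <-]] := surj psi.
apply: eq_trans (esym (DYYE phi wphi)) _.
apply: eq_trans _ (congr1 DY (DYE' phi wphi)).
apply: eq_trans _ (DYE _ (Lact_whittaker cY' wphi)).
by apply: afun_h_ext => u; exact: LactM.
Qed.
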